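(* Let $p\ge 2$, $\alpha=p-1$ and $\theta\ge 0$. For every $0\le\sigma\le\mu_{\alpha,\theta}$, $TMC(\sigma,\alpha,\theta)$ is finite. The constant $\mu_{\alpha,\theta}$ is sharp, i.e. $TMC(\sigma,\alpha,\theta)=\infty$ for every $\sigma>\mu_{\alpha,\theta}$. In addition, for all $0<\sigma\le\mu_{\alpha,\theta}$, $$TMC(\sigma,\alpha,\theta)=\sup_{\mu\in(0,\sigma)}\left(\frac{1-\left(\frac{\mu}{\sigma}\right)^{p-1}}{\left(\frac{\mu}{\sigma}\right)^{p-1}}\right)TMSC(\mu,\alpha,\theta).$$
   Context: For real $\theta\ge 0$ let $\omega_\theta=\frac{2\pi^{(\theta+1)/2}}{\Gamma((\theta+1)/2)}$ and $\int_0^\infty f(r)\,\mathrm{d}\lambda_\theta=\omega_\theta\int_0^\infty f(r)r^\theta\,\mathrm{d}r$. For $1\le q<\infty$, $L^q_\theta$ is the space of measurable $u$ on $(0,\infty)$ with $\|u\|_{L^q_\theta}=\left(\int_0^\infty |u|^q\,\mathrm{d}\lambda_\theta\right)^{1/q}<\infty$ (similarly with $\alpha$ in place of $\theta$). $X^{1,p}_\infty=X^{1,p}_\infty(\alpha,\theta)$ is the set of all locally absolutely continuous functions $u$ on $(0,\infty)$ with $\lim_{r\to\infty}u(r)=0$, $u\in L^p_\theta$ and $u'\in L^p_\alpha$, with norm $\|u\|=\left(\|u\|^p_{L^p_\theta}+\|u'\|^p_{L^p_\alpha}\right)^{1/p}$. $\mu_{\alpha,\theta}=(\theta+1)\omega_\alpha^{1/\alpha}$.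 For $t\ge 0$, $\varphi_p(t)=\sum_{j\in\mathbb{N},\, j\ge p-1}\frac{t^j}{j!}$. For $0\le\mu<\mu_{\alpha,\theta}$, $$TMSC(\mu,\alpha,\theta)=\sup\left\{\frac{1}{\|u\|^p_{L^p_\theta}}\int_0^\infty\varphi_p\left(\mu|u|^{\frac{p}{p-1}}\right)\mathrm{d}\lambda_\theta \;:\; u\in X^{1,p}_\infty(\alpha,\theta)\setminus\{0\},\ \|u'\|_{L^p_\alpha}\le 1\right\}.$$ For $\sigma\ge 0$, $$TMC(\sigma,\alpha,\theta)=\sup\left\{\int_0^\infty\varphi_p\left(\sigma|u|^{\frac{p}{p-1}}\right)\mathrm{d}\lambda_\theta\;:\; u\in X^{1,p}_\infty(\alpha,\theta),\ \|u\|\le 1\right\}\in[0,\infty].$$ *)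

(* Defs.v *)
From HB Require Import structures.
From mathcomp Require Import all_boot all_order all_algebra.
From mathcomp Require Import all_classical all_reals all_analysis.

Set Implicit Arguments.
Unset Strict Implicit.
Unset Printing Implicit Defensive.

Import Order.TTheory GRing.Theory Num.Theory.
Import numFieldNormedType.Exports.

Local Open Scope classical_set_scope.
Local Open Scope ring_scope.

(* A function on (0, +oo) is represented by a total function R -> R, of which
   only the restriction to `]0, +oo[ is ever used. *)
Section Definitions.
Context {R : realType}.
Implicit Types (p q alpha theta mu sigma : R) (u : R -> R).

Definition Gamma (s : R) : R :=
  \int[lebesgue_measure]_(t in `]0, +oo[) (t `^ (s - 1) * expR (- t)).

Definition omega theta : R :=
  2 * pi `^ ((theta + 1) / 2) / Gamma ((theta + 1) / 2).

Definition int_lambda theta (f : R -> \bar R) : \bar R :=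
  ((omega theta)%:E *
   \int[lebesgue_measure]_(r in `]0%R, +oo[) (f r * (r `^ theta)%:E))%E.

Definition Lq_norm q theta u : \bar R :=
  (int_lambda theta (fun r => (`|u r| `^ q)%:E) `^ q^-1)%E.

Definition Lq q theta : set (R -> R) :=
  [set u | measurable_fun (`]0, +oo[ : set R) u /\ (Lq_norm q theta u < +oo)%E].

Definition absolutely_continuous_on (a b : R) u : Prop :=
  forall e : R, 0 < e -> exists2 d : R, 0 < d &
    forall (n : nat) (x y : 'I_n -> R),
      (forall i, a <= x i /\ x i <= y i /\ y i <= b) ->
      trivIset [set: 'I_n] (fun i => `]x i, y i[%classic) ->
      \sum_(i < n) (y i - x i) < d ->
      \sum_(i < n) `|u (y i) - u (x i)| < e.

Definition locally_absolutely_continuous u : Prop :=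
  forall a b : R, 0 < a -> a < b -> absolutely_continuous_on a b u.

(* derive1 u is defined almost everywhere on (0, +oo) for such u; the constant
   junk value derive1 takes elsewhere does not affect the integrals. *)
Definition X1p p alpha theta : set (R -> R) :=
  [set u | [/\ locally_absolutely_continuous u,
               u r @[r --> +oo] --> 0,
               Lq p theta u &
               Lq p alpha (derive1 u) ] ].

Definition X1p_norm p alpha theta u : \bar R :=
  ((Lq_norm p theta u `^ p + Lq_norm p alpha (derive1 u) `^ p) `^ p^-1)%E.

Definition mu_crit alpha theta : R :=
  (theta + 1) * omega alpha `^ alpha^-1.

Definition phi p (t : R) : R :=
  limn (fun n => \sum_(0 <= j < n | p - 1 <= j%:R) t ^+ j / j`!%:R).

Definition TM_integral p mu theta u : \bar R :=
  int_lambda theta (fun r => (phi p (mu * `|u r| `^ (p / (p - 1))))%:E).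

Definition TMSC p mu alpha theta : \bar R :=
  ereal_sup [set ((Lq_norm p theta u `^ p)^-1 * TM_integral p mu theta u)%E
            | u in [set u | [/\ X1p p alpha theta u,
                                exists2 r : R, 0 < r & u r != 0 &
                                (Lq_norm p alpha (derive1 u) <= 1)%E] ] ].

Definition TMC p sigma alpha theta : \bar R :=
  ereal_sup [set TM_integral p sigma theta u
            | u in [set u | X1p p alpha theta u /\
                            (X1p_norm p alpha theta u <= 1)%E] ].

End Definitions.

(* Main.v *)
Require Import Defs.
From HB Require Import structures.
From mathcomp Require Import all_boot all_order all_algebra.
From mathcomp Require Import all_classical all_reals all_analysis measurable_realfun.
From mathcomp Require Import ring lra.

Set Implicit Arguments.
Unset Strict Implicit.
Unset Printing Implicit Defensive.

Import Order.TTheory GRing.Theory Num.Theory.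
Import numFieldNormedType.Exports.

Local Open Scope classical_set_scope.
Local Open Scope ring_scope.

(** Finiteness needs no symmetrization. For [u] in the space, Hoelder bounds the
    increments, [omega * |u x - u y|^p <= E * (ln (y / x))^(p - 1)] with [E] the
    energy of [u'] between [x] and [y]; in the variable [s = - ln r] this is all
    that Moser's proof of the critical exponential integral requires. The
    full-norm constraint is absorbed as by Li and Ruf: with
    [A = ||u||_theta^p], some radius [r0] in (1, 2) has [|u r0|^p] of order [A],
    the energy inside [r0] is at most [1 - A], and convexity of [t |-> t^q],
    [q = p / (p - 1)], recombines the two with weights [1 - A] and [A].
    Outside [r0] the function is bounded and [phi p] is dominated by the norm.

    Absolute continuity enters through [|u b - u a| <= int |u'|]: the
    Stieltjes measure of the variation of [u] is dominated by the Lebesgue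
    measure, so Radon-Nikodym provides a density, which Lebesgue
    differentiation identifies with the derivative almost everywhere.

    Truncated logarithms violate every bound beyond the critical constant. The
    identity comes from the rescaling [r |-> c * u (l * r)], which multiplies
    the energy by [c^p] and [lambda_theta]-integrals by [l^-(theta + 1)]:
    normalizing the energy to [1] trades [sigma] for some [mu < sigma]. *)

(** The choice alpha = p - 1 makes the energy invariant under dilations: the factor l^p of the chain
    rule cancels l^(-(alpha + 1)). Hence ln r is the natural variable, truncated logarithms are
    extremal, and r^theta dr becomes exp(-(theta + 1) s) ds; balancing this decay against the growth
    that the increment bound allows gives mu^(p - 1) = (theta + 1)^(p - 1) * omega alpha.

    At the critical constant the bound |w|^q <= t is not enough, since it only bounds the integrand
    by 1. Finiteness comes from the size of the set where t - |w|^q <= lam: it grows linearly in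
    lam, while the integrand there is weighed by exp(- lam). The hypothesis 2 <= p acts in this
    estimate twice: Bernoulli's inequality has exponent p - 1 >= 1, and q <= 2.

    In the recombination, the weight A on |u r0|^q costs a factor A^(1 - q), unbounded as A tends to
    0. It is harmless because |u r0|^q is at most a constant times A^(q - 1). *)

(** * Integrals of real-valued nonnegative functions *)

Section integral_EFin.
Context {R : realType}.
Implicit Types (D : set R) (f g : R -> R).
Notation leb := (@lebesgue_measure R).

Lemma EFin_integralZl D f (k : R) : measurable D -> measurable_fun D f ->
  (forall x, D x -> 0 <= f x) -> 0 <= k ->
  (\int[leb]_(x in D) (k * f x)%:E = k%:E * \int[leb]_(x in D) (f x)%:E)%E.
Proof.
move=> mD mf f0 k0; under eq_integral do rewrite EFinM.
apply: ge0_integralZl_EFin => //; first exact/measurable_EFinP.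
Qed.

Lemma EFin_integralD D f g : measurable D -> measurable_fun D f ->
  measurable_fun D g -> (forall x, D x -> 0 <= f x) ->
  (forall x, D x -> 0 <= g x) ->
  (\int[leb]_(x in D) (f x + g x)%:E =
   \int[leb]_(x in D) (f x)%:E + \int[leb]_(x in D) (g x)%:E)%E.
Proof.
move=> mD mf mg f0 g0; under eq_integral do rewrite EFinD.
by apply: ge0_integralD => //; exact/measurable_EFinP.
Qed.

Lemma EFin_le_integral D f g : measurable D -> measurable_fun D f ->
  measurable_fun D g -> (forall x, D x -> 0 <= f x) ->
  (forall x, D x -> f x <= g x) ->
  (\int[leb]_(x in D) (f x)%:E <= \int[leb]_(x in D) (g x)%:E)%E.
Proof.
move=> mD mf mg f0 fg; apply: ge0_le_integral => //.
- exact/measurable_EFinP.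
- exact/measurable_EFinP.
Qed.

Lemma EFin_integral_subset D E f : measurable D -> measurable E ->
  measurable_fun E f -> (forall x, E x -> 0 <= f x) -> D `<=` E ->
  (\int[leb]_(x in D) (f x)%:E <= \int[leb]_(x in E) (f x)%:E)%E.
Proof.
by move=> mD mE mf f0 DE; apply: ge0_subset_integral => //; exact/measurable_EFinP.
Qed.

Lemma EFin_integral_ge0 D f : (forall x, D x -> 0 <= f x) ->
  (0 <= \int[leb]_(x in D) (f x)%:E)%E.
Proof. by move=> f0; apply: integral_ge0 => x Dx; rewrite lee_fin f0. Qed.

Lemma measurable_fun_powR D (p : R) : measurable_fun D (fun x => x `^ p).
Proof. by apply: measurable_funTS; exact: measurable_powR. Qed.

Lemma measurable_fun_norm_powR D f (p : R) : measurable_fun D f ->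
  measurable_fun D (fun x => `|f x| `^ p).
Proof.
move=> mf; apply: (measurableT_comp (measurable_powR p)).
exact: measurableT_comp.
Qed.

End integral_EFin.

(** * Absolute continuity *)

Section ac.
Context {R : realType}.
Implicit Types (a b : R) (u : R -> R) (s : seq (R * R)).

Definition ordered_intervals a b s : Prop :=
  all (fun I => [&& a <= I.1, I.1 <= I.2 & I.2 <= b]) s /\
  pairwise (fun I J => I.2 <= J.1) s.

(* [absolutely_continuous_on] with the disjoint intervals listed from left to
   right, a form in which families can be concatenated. *)
Definition ac_seq a b u := forall e, 0 < e -> exists2 d, 0 < d &
  forall s, ordered_intervals a b s -> \sum_(I <- s) (I.2 - I.1) < d ->
    \sum_(I <- s) `|u I.2 - u I.1| < e.

Lemma absolutely_continuous_on_seq a b u :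
  absolutely_continuous_on a b u -> ac_seq a b u.
Proof.
move=> uac e /uac[d d0 ud]; exists d => // s [/allP sab ps] sd.
pose i0 : R * R := (0, 0).
have := ud (size s) (fun i => (nth i0 s i).1) (fun i => (nth i0 s i).2).
have big_s (F : R * R -> R) : \sum_(i < size s) F (nth i0 s i) = \sum_(I <- s) F I.
  by rewrite (big_nth i0) big_mkord.
rewrite (big_s (fun I => I.2 - I.1)) (big_s (fun I => `|u I.2 - u I.1|)).
apply => //.
  by move=> i; have /sab/and3P[] := mem_nth i0 (ltn_ord i).
have dis (i j : 'I_(size s)) : (i < j)%N ->
    `](nth i0 s i).1, (nth i0 s i).2[ `&` `](nth i0 s j).1, (nth i0 s j).2[
      !=set0 -> False.
  move=> ij [x /= []]; rewrite !in_itv/= => /andP[_ xi] /andP[xj _].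
  have /(pairwiseP i0)/(_ i j (ltn_ord i) (ltn_ord j) ij) := ps.
  by rewrite leNgt (lt_trans xj).
move=> i j _ _ ij; apply/val_inj => /=; have [lij|lji|//] := ltngtP i j.
  by case: (dis _ _ lij ij).
by case: (dis _ _ lji); rewrite setIC.
Qed.

Lemma ac_seqB a b u v : ac_seq a b u -> ac_seq a b v -> ac_seq a b (u \- v).
Proof.
move=> uac vac e e0; have e20 : 0 < e / 2 by rewrite divr_gt0.
have [d d0 ud] := uac _ e20; have [r r0 vr] := vac _ e20.
exists (Num.min d r); first by rewrite lt_min d0.
move=> s sab; rewrite lt_min => /andP[sd sr].
have us := ud s sab sd; have vs := vr s sab sr.
apply: (@le_lt_trans _ _ (\sum_(I <- s) `|u I.2 - u I.1| +
                          \sum_(I <- s) `|v I.2 - v I.1|)); last lra.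
rewrite -big_split/=; apply: ler_sum => I _.
rewrite /= [X in `|X|](_ : _ = (u I.2 - u I.1) - (v I.2 - v I.1)); last by ring.
exact: ler_normB.
Qed.

Lemma ac_seq_dist a b u : ac_seq a b u -> forall e, 0 < e ->
  exists2 d, 0 < d & forall x y, a <= x -> x <= y -> y <= b -> y - x < d ->
    `|u y - u x| < e.
Proof.
move=> uac e /uac[d d0 ud]; exists d => // x y ax xy yb yxd.
have := ud [:: (x, y)]; rewrite !big_seq1/=; apply => //.
by rewrite /ordered_intervals/= ax xy yb.
Qed.

(** The zip has the right endpoint first, to match [variation_zip]; the map puts it second, as in
    [ordered_intervals]. *)
Definition steps a (l : seq R) : seq (R * R) :=
  map (fun I => (I.2, I.1)) (zip l (a :: l)).

Lemma itv_partition_ordered a b l : itv_partition a b l ->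
  ordered_intervals a b (steps a l) /\
  \sum_(I <- steps a l) (I.2 - I.1) = b - a.
Proof.
elim: l a => [|c l ih] a.
  by move=> [_ /=] /eqP ->; split => //; rewrite big_nil subrr.
move=> /[dup] abcl [/= /andP[ac cl] /eqP lb].
have /ih[[al pl] suml] : itv_partition c b l by split => //; exact/eqP.
have cb : c <= b.
  by rewrite (itv_partition_le (_ : itv_partition c b l))//; split => //; apply/eqP.
split; last by rewrite /steps/= big_cons/= suml; ring.
split; rewrite /steps/=.
  rewrite lexx (ltW ac) cb/=; apply: sub_all al => I /and3P[cI -> ->].
  by rewrite (le_trans (ltW ac) cI).
by rewrite pl andbT; apply: sub_all al => I /and3P[].
Qed.

Lemma variation_steps a b l u : itv_partition a b l ->
  variation a b u l = \sum_(I <- steps a l) `|u I.2 - u I.1|.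
Proof. by move=> abl; rewrite (variation_zip _ abl) /steps big_map. Qed.

(** Every partition of a short interval is an ordered family of total length [y - x], so a single
    [d] serves all of them and the bound passes to the supremum. *)
Lemma ac_seq_tv a b u : ac_seq a b u -> forall e, 0 < e ->
  exists2 d, 0 < d & forall x y, a <= x -> x <= y -> y <= b -> y - x < d ->
    (total_variation x y u <= e%:E)%E.
Proof.
move=> uac e /uac[d d0 ud]; exists d => // x y ax xy yb yxd.
apply: ge_ereal_sup => _ [_ [l xyl <-] <-]; rewrite lee_fin.
rewrite (variation_steps _ xyl); have [[al pl] suml] := itv_partition_ordered xyl.
apply/ltW/ud; last by rewrite suml.
split=> //; apply: sub_all al => I /and3P[xI -> Iy].
by rewrite (le_trans ax xI) (le_trans Iy yb).
Qed.

(** The variation is at most 1 over any interval shorter than [d], and finitely many steps of length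
    [d / 2] lead from [a] to [b]. *)
Lemma ac_seq_bounded_variation a b u : a <= b -> ac_seq a b u ->
  bounded_variation a b u.
Proof.
move=> ab /ac_seq_tv/(_ _ ltr01)[d d0 ud]; apply/bounded_variationP => //.
have {}ud x y : a <= x -> x <= y -> y <= b -> y - x < d ->
    total_variation x y u \is a fin_num.
  move=> ax xy yb xyd; rewrite ge0_fin_numE ?total_variation_ge0//.
  by apply: le_lt_trans (ltry 1); exact: ud.
suff H n : forall x, a <= x -> x <= b -> x - a < n%:R * (d / 2) ->
    total_variation a x u \is a fin_num.
  apply: (H (Num.Def.archi_bound ((b - a) / (d / 2)))) => //.
  rewrite -ltr_pdivrMr ?divr_gt0//; apply: archi_boundP.
  by rewrite divr_ge0 ?subr_ge0// ltW// divr_gt0.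
elim: n => [|n ih] x ax xb xn; first by exfalso; lra.
have [xad|xad] := ltP (x - a) (d / 2).
  by apply: ud => //; lra.
have zx : x - d / 2 <= x by lra.
have az : a <= x - d / 2 by lra.
rewrite (total_variationD u az zx) fin_numD; apply/andP; split.
  apply: ih => //; first by lra.
  by move: xn; rewrite -natr1 mulrDl mul1r; lra.
by apply: ud => //; lra.
Qed.

Lemma bounded_variation_sub a b x y u : a <= x -> x <= y -> y <= b ->
  bounded_variation a b u -> bounded_variation x y u.
Proof.
move=> ax xy yb /(bounded_variationl (le_trans ax xy) yb).
exact: bounded_variationr.
Qed.

(** Refining every interval by a partition keeps the total length, so the refined family still obeys
    the bound on increments; the non-strict form of that bound survives the suprema. *)
Lemma le_sum_total_variation a b u d e : bounded_variation a b u ->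
  (forall s, ordered_intervals a b s -> \sum_(I <- s) (I.2 - I.1) < d ->
    \sum_(I <- s) `|u I.2 - u I.1| <= e) ->
  forall s, ordered_intervals a b s -> \sum_(I <- s) (I.2 - I.1) < d ->
    \sum_(I <- s) fine (total_variation I.1 I.2 u) <= e.
Proof.
move=> bvu ud.
(* The suprema are taken one interval at a time: [t] holds the pieces of the intervals already
   partitioned, [s] the intervals whose total variation is still to be replaced. *)
suff H s : forall t, ordered_intervals a b (t ++ s) ->
    \sum_(I <- t ++ s) (I.2 - I.1) < d ->
    \sum_(I <- t) `|u I.2 - u I.1| +
    \sum_(I <- s) fine (total_variation I.1 I.2 u) <= e.
  by move=> s sab sd; have := H s [::] sab sd; rewrite big_nil add0r.
elim: s => [|J s ih] t; first by rewrite cats0 big_nil addr0; exact: ud.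
move=> [allt pairt] sumt; rewrite big_cons.
have /and3P[aJ J12 Jb] : [&& a <= J.1, J.1 <= J.2 & J.2 <= b].
  by move: allt; rewrite all_cat/= => /and3P[].
have fJ : total_variation J.1 J.2 u \is a fin_num.
  by apply/bounded_variationP => //; exact: (@bounded_variation_sub a b).
rewrite addrCA -lerBrDr -lee_fin fineK//.
apply: ge_ereal_sup => _ [_ [l Jl <-] <-]; rewrite lee_fin lerBrDr.
rewrite (variation_steps _ Jl) addrA [X in X + _]addrC -big_cat/=.
have [[al pl] suml] := itv_partition_ordered Jl.
apply: ih; last first.
  by move: sumt; rewrite -catA !big_cat/= big_cons suml.
split.
  move: allt; rewrite !all_cat/= => /and3P[-> _ ->]; rewrite !andbT/=.
  apply: sub_all al => I /and3P[JI -> IJ].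
  by rewrite (le_trans aJ JI) (le_trans IJ Jb).
move: pairt; rewrite !pairwise_cat/= allrel_consr => /and4P[/andP[tJ ts] pt Js ps].
rewrite pt pl ps allrel_catl ts !andbT/=; apply/andP; split.
  apply/allrelP => I K Il Ks; move/allP : Js => /(_ _ Ks) /=.
  by move/allP : al => /(_ _ Il) /and3P[_ _ IJ]; exact: le_trans.
apply/allrelP => I K It Kl; move/allP : tJ => /(_ _ It) /= IJ.
by move/allP : al => /(_ _ Kl) /and3P[JK _ _]; exact: le_trans JK.
Qed.

(** By additivity the increment of the variation function over an interval is the variation over
    that interval. This is what makes both parts of the Jordan decomposition absolutely
    continuous. *)
Lemma ac_seq_total_variation a b u : a <= b -> ac_seq a b u ->
  ac_seq a b (fun x => fine (total_variation a x u)).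
Proof.
move=> ab uac e e0; have bvu := ac_seq_bounded_variation ab uac.
have e20 : 0 < e / 2 by lra.
have [d d0 ud] := uac _ e20.
exists d => // s sab sd; apply: (@le_lt_trans _ _ (e / 2)); last by lra.
rewrite big_seq (eq_bigr (fun I => fine (total_variation I.1 I.2 u))); last first.
  move=> I Is; have /and3P[aI I12 Ib] := allP sab.1 _ Is.
  have fin x y : a <= x -> x <= y -> y <= b -> total_variation x y u \is a fin_num.
    move=> ax xy yb; apply/bounded_variationP => //.
    exact: (@bounded_variation_sub a b).
  rewrite (total_variationD u aI I12) fineD ?fin// ?(le_trans I12)//.
  by rewrite addrAC subrr add0r ger0_norm// fine_ge0// total_variation_ge0.
rewrite -big_seq.
exact: (le_sum_total_variation bvu (fun t tab td => ltW (ud t tab td)) sab sd).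
Qed.

End ac.

(** * The Stieltjes measure of the variation *)

Section mono.
Context {R : realType}.
Implicit Types (a b : R) (v : cumulative R R).
Notation leb := (@lebesgue_measure R).

Lemma lebesgue_stieltjes_itv v a b : a <= b ->
  lebesgue_stieltjes_measure v `]a, b]%classic = (v b - v a)%:E.
Proof.
move=> ab; rewrite /lebesgue_stieltjes_measure /measure_extension.
rewrite measurable_mu_extE/=; last exact: is_ocitv.
by rewrite wlength_itv_bnd.
Qed.

Definition dyadic a b n k : R := a + (b - a) * (k%:R / (2 ^ n)%:R).

Lemma dyadic_double a b n k : dyadic a b n.+1 k.*2 = dyadic a b n k.
Proof.
rewrite /dyadic -muln2 expnS !natrM.
have : (2 ^ n)%:R != 0 :> R by rewrite pnatr_eq0 expn_eq0.
by move=> h; field.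
Qed.

Lemma le_dyadic a b n : a <= b -> {homo dyadic a b n : i j / (i <= j)%N >-> i <= j}.
Proof.
move=> ab i j ij; rewrite /dyadic lerD2l ler_wpM2l ?subr_ge0//.
by rewrite ler_pM2r ?ler_nat// invr_gt0 ltr0n expn_gt0.
Qed.

Definition dyadic_cell a b n k : set R := `]dyadic a b n k, dyadic a b n k.+1]%classic.

(** An inner approximation of an open set by finitely many disjoint intervals in order: [ac_seq]
    speaks of such families and not of open sets. *)
Definition dyadic_inner a b (U : set R) n : set R :=
  \big[setU/set0]_(k < 2 ^ n | `[< dyadic_cell a b n k `<=` U >]) dyadic_cell a b n k.

Lemma dyadic_innerP a b U n x : dyadic_inner a b U n x <->
  exists2 k, (k < 2 ^ n)%N & dyadic_cell a b n k `<=` U /\ dyadic_cell a b n k x.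
Proof.
rewrite /dyadic_inner big_mkcond/=.
rewrite -(bigcup_mkord (2 ^ n) (fun k => if `[< dyadic_cell a b n k `<=` U >]
  then dyadic_cell a b n k else set0)); split.
  by move=> [k /= kn]; case: asboolP => // kU kx; exists k.
by move=> [k kn [kU kx]]; exists k => //=; rewrite asboolT.
Qed.

(** A cell of index [k] splits into the cells [k.*2] and [k.*2.+1] of the next level. The nesting
    gives continuity from below in [lebesgue_stieltjes_dominated]. *)
Lemma dyadic_innerS a b U n : a <= b ->
  dyadic_inner a b U n `<=` dyadic_inner a b U n.+1.
Proof.
move=> ab x /dyadic_innerP[k kn [kU kx]]; apply/dyadic_innerP.
move: kx; rewrite /dyadic_cell/= in_itv/= => /andP[kx xk].
have sub j : (k.*2 <= j)%N -> (j.+1 <= k.+1.*2)%N ->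
    dyadic_cell a b n.+1 j `<=` U.
  move=> kj jk y; rewrite /dyadic_cell/= in_itv/= => /andP[jy yj]; apply: kU.
  rewrite /dyadic_cell/= in_itv/= -(dyadic_double a b n k) -(dyadic_double a b n k.+1).
  by rewrite (le_lt_trans _ jy) ?le_dyadic// (le_trans yj)// le_dyadic.
have [xj|jx] := leP x (dyadic a b n.+1 k.*2.+1).
  exists k.*2; first by rewrite expnS mul2n ltn_double.
  split; first by apply: sub => //; rewrite doubleS.
  by rewrite /dyadic_cell/= in_itv/= dyadic_double kx.
exists k.*2.+1; first by rewrite expnS mul2n -doubleS leq_double.
split; first by apply: sub; rewrite ?doubleS.
by rewrite /dyadic_cell/= in_itv/= jx -doubleS dyadic_double.
Qed.

Lemma open_dyadic a b U : a < b -> open U ->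
  U `&` `]a, b]%classic `<=` \bigcup_n dyadic_inner a b U n.
Proof.
move=> ab oU x [Ux /=]; rewrite in_itv/= => /andP[ax xb].
have /nbhs_ballP[r /= r0 rU] : nbhs x U by exact: open_nbhs_nbhs.
have ba0 : 0 < b - a by rewrite subr_gt0.
pose n := Num.Def.archi_bound ((b - a) / r).
have nr : (b - a) / (2 ^ n)%:R < r.
  rewrite ltr_pdivrMr ?ltr0n ?expn_gt0// mulrC -ltr_pdivrMr//.
  apply: (lt_le_trans (archi_boundP _)); first by rewrite divr_ge0// ltW.
  by rewrite ler_nat ltnW// ltn_expl.
have N0 : 0 < (2 ^ n)%:R :> R by rewrite ltr0n expn_gt0.
pose y := (x - a) / (b - a) * (2 ^ n)%:R.
have y0 : 0 < y by rewrite mulr_gt0// divr_gt0// subr_gt0.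
have yN : y <= (2 ^ n)%:R.
  apply: ler_piMl; first exact: ltW.
  by rewrite ler_pdivrMr// mul1r lerD2r.
have xE : x = a + (b - a) * (y / (2 ^ n)%:R).
  by rewrite /y; field; rewrite ?gt_eqF.
have exy : exists j, y <= j%:R by exists (2 ^ n)%N.
(* [k.+1] is the ceiling of [y]: cells are open on the left and closed on the right, so a grid point
   belongs to the cell that it ends. *)
case: (ex_minnP exy) => -[|k] yk kmin; first by move: yk; rewrite leNgt y0.
have ky : k%:R < y by rewrite ltNge; apply/negP => /kmin; rewrite ltnn.
exists n => //; apply/dyadic_innerP; exists k; first exact: kmin.
have kx : dyadic a b n k < x.
  by rewrite xE /dyadic ltrD2l ltr_pM2l// ltr_pM2r// invr_gt0.
have xk : x <= dyadic a b n k.+1.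
  by rewrite xE /dyadic lerD2l ler_pM2l// ler_pM2r// invr_gt0.
have kk : dyadic a b n k.+1 - dyadic a b n k < r.
  by apply: le_lt_trans nr; rewrite /dyadic -natr1 le_eqVlt; apply/orP; left; apply/eqP; field; rewrite gt_eqF.
rewrite /dyadic_cell/= in_itv/= kx xk; split=> // z.
rewrite /= in_itv/= => /andP[kz zk]; apply: rU; rewrite /ball/= ltr_norml.
by apply/andP; split; lra.
Qed.

Lemma trivIset_dyadic_cell a b n : a <= b -> trivIset setT (dyadic_cell a b n).
Proof.
move=> ab; apply/ltn_trivIset => j i ij; apply/seteqP; split=> // x [].
rewrite /dyadic_cell/= !in_itv/= => /andP[_ xi] /andP[jx _].
by have := lt_le_trans jx xi; rewrite ltNge le_dyadic.
Qed.

Lemma measure_dyadic_inner a b U n (mu : {measure set (measurableTypeR R) -> \bar R}) : a <= b ->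
  mu (dyadic_inner a b U n) =
  (\sum_(k < 2 ^ n | `[< dyadic_cell a b n k `<=` U >]) mu (dyadic_cell a b n k))%E.
Proof.
move=> ab; rewrite /dyadic_inner measure_bigsetU_ord//.
  by move=> k; exact: measurable_itv.
have := @trivIset_dyadic_cell a b n ab.
by move=> + i j _ _ ij => /(_ _ _ I I ij)/val_inj.
Qed.

Lemma dyadic_ordered a b n (P : pred nat) : a <= b ->
  ordered_intervals a b
    [seq (dyadic a b n k, dyadic a b n k.+1) | k <- iota 0 (2 ^ n) & P k].
Proof.
move=> ab; have N0 : (2 ^ n)%:R != 0 :> R by rewrite pnatr_eq0 expn_eq0.
split.
  apply/allP => J /mapP[k]; rewrite mem_filter mem_iota/= add0n => /andP[_ kn] ->/=.
  rewrite le_dyadic//=; apply/andP; split.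
    by rewrite /dyadic lerDl mulr_ge0 ?subr_ge0// divr_ge0.
  have bE : dyadic a b n (2 ^ n) = b by rewrite /dyadic divff// mulr1; ring.
  by rewrite -[leRHS]bE le_dyadic.
rewrite pairwise_map; apply: pairwise_filter.
apply: (@sub_pairwise _ ltn); first by move=> i j /= ij; exact: le_dyadic.
by rewrite -sorted_pairwise ?iota_ltn_sorted//; exact: ltn_trans.
Qed.

(** Outer regularity encloses [N] in an open [U] of Lebesgue measure below [d]. The inner dyadic
    unions of [U] have total length below [d], so absolute continuity bounds their Stieltjes measure
    by [e], and they increase to a set containing the part of [N] in []a, b]]. *)
Lemma lebesgue_stieltjes_dominated v a b : a < b -> ac_seq a b v ->
  forall N, measurable N -> leb N = 0%E ->
    lebesgue_stieltjes_measure v (N `&` `]a, b]%classic) = 0%E.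
Proof.
move=> ab vac N mN N0; apply/eqP; rewrite eq_le measure_ge0 andbT.
apply/lee_addgt0Pr => e e0; rewrite add0e.
have [d d0 vd] := vac e e0.
have Nlty : (leb N < +oo)%E by rewrite N0.
have [U [oU NU Ud]] := lebesgue_regularity_outer mN Nlty d0.
have {}Ud : (leb U < d%:E)%E.
  rewrite -(setDUK NU) measureU//; first by rewrite [X in (X + _)%E]N0 add0e.
  - by apply: measurableD => //; exact: open_measurable.
  - by rewrite setDE setIA setIAC setICr set0I.
have mU n : measurable (dyadic_inner a b U n).
  by apply: bigsetU_measurable => k _; exact: measurable_itv.
have Ue n : (lebesgue_stieltjes_measure v (dyadic_inner a b U n) <= e%:E)%E.
  set s := [seq (dyadic a b n k, dyadic a b n k.+1) | k <- iota 0 (2 ^ n) & `[< dyadic_cell a b n k `<=` U >]].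
  have sumE (F : R * R -> R) : \sum_(k < 2 ^ n | `[< dyadic_cell a b n k `<=` U >])
      F (dyadic a b n k, dyadic a b n k.+1) = \sum_(I <- s) F I.
    by rewrite /s big_map big_filter -(big_mkord (fun k => `[< dyadic_cell a b n k `<=` U >]) (fun k => F (dyadic a b n k, dyadic a b n k.+1))) /index_iota subn0.
  rewrite (measure_dyadic_inner _ _ (lebesgue_stieltjes_measure v) (ltW ab)).
  rewrite (eq_bigr (fun k : 'I_(2 ^ n) => (v (dyadic a b n k.+1) - v (dyadic a b n k))%:E)); last first.
    by move=> k _; rewrite [LHS]lebesgue_stieltjes_itv// le_dyadic// ltW.
  rewrite sumEFin lee_fin (sumE (fun I => v I.2 - v I.1)).
  apply: (le_trans (ler_sum _ (fun I _ => ler_norm _))); apply/ltW/vd.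
    exact/dyadic_ordered/ltW.
  rewrite -lte_fin -(sumE (fun I => I.2 - I.1)) -sumEFin.
  apply: le_lt_trans Ud.
  rewrite (eq_bigr (fun k : 'I_(2 ^ n) => leb (dyadic_cell a b n k))); last first.
    move=> k _; rewrite /dyadic_cell lebesgue_measure_itv/= lte_fin EFinB.
    case: ifPn => //; rewrite -leNgt => h.
    rewrite -EFinB; congr EFin; apply/eqP; rewrite subr_eq0 eq_le h/=.
    by rewrite le_dyadic// ltW.
  rewrite -(measure_dyadic_inner _ _ leb (ltW ab)); apply: le_measure; rewrite ?inE.
  - exact: mU.
  - exact: open_measurable.
  - by move=> x /dyadic_innerP[k _ [kU kx]]; exact: kU.
apply: (@le_trans _ _ (lebesgue_stieltjes_measure v (\bigcup_n dyadic_inner a b U n))).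
  apply: le_measure; rewrite ?inE.
  - by apply: measurableI => //; exact: measurable_itv.
  - by apply: bigcupT_measurable => n; exact: mU.
  - by move=> x [/NU Ux xab]; exact: (open_dyadic ab oU).
have : lebesgue_stieltjes_measure v (dyadic_inner a b U n) @[n --> \oo] -->
    lebesgue_stieltjes_measure v (\bigcup_n dyadic_inner a b U n).
  apply: nondecreasing_cvg_mu; first by move=> n; exact: mU.
    by apply: bigcupT_measurable => n; exact: mU.
  apply/nondecreasing_seqP => n; apply/subsetPset; exact/dyadic_innerS/ltW.
move=> /[dup] /cvg_lim <-//; move=> /cvgP c.
by apply: lime_le => //; near=> n; exact: Ue.
Unshelve. all: by end_near. Qed.

End mono.

(** * Absolutely continuous functions as integrals of their derivatives *)

Section ftc.
Context {R : realType}.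
Implicit Types (a b : R) (u : R -> R).
Notation leb := (@lebesgue_measure R).

Lemma cumulative_ac_integral (v : cumulative R R) a b : a < b -> ac_seq a b v ->
  exists f : R -> R, leb.-integrable setT (EFin \o f) /\
    forall x, a <= x -> x <= b ->
      v x - v a = \int[leb]_(t in `]a, x]) f t.
Proof.
move=> ab vac.
have mab : measurable (`]a, b]%classic : set (measurableTypeR R)).
  exact: measurable_itv.
have voo : (lebesgue_stieltjes_measure v `]a, b]%classic < +oo)%E.
  by rewrite lebesgue_stieltjes_itv ?ltW// ltry.
(* Restricting to []a, b]] makes the measure finite, and it is there that domination by the Lebesgue
   measure is known. *)
pose nu : {finite_measure set (measurableTypeR R) -> \bar R} := mfrestr mab voo.
have nuleb : nu `<< leb.
  apply/null_content_dominatesP => N mN N0.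
  exact: lebesgue_stieltjes_dominated.
pose g := Radon_Nikodym_SigmaFinite.f nu leb.
have gfin := Radon_Nikodym_SigmaFinite.f_fin_num nuleb.
have gE : EFin \o (fine \o g) = g by apply/funext => x /=; rewrite fineK.
exists (fine \o g); split.
  by rewrite gE; exact: Radon_Nikodym_SigmaFinite.f_integrable.
move=> x ax xb; rewrite /Rintegral (eq_integral g) => [|y _]; last by rewrite /= fineK.
rewrite -(Radon_Nikodym_SigmaFinite.f_integral nuleb); last exact: measurable_itv.
rewrite /nu/= /mfrestr /mrestr.
rewrite (_ : _ `&` _ = `]a, x]%classic); first by rewrite lebesgue_stieltjes_itv.
apply/seteqP; split => y /=; rewrite !in_itv/=; first by case.
by move=> /andP[ay yx]; rewrite ay yx (le_trans yx).
Qed.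

Lemma ae_derive1_integral (f : R -> R) a : leb.-integrable setT (EFin \o f) ->
  let F x := \int[leb]_(t in `]a, x]) f t in
  {ae leb, forall x, a < x -> derivable F x 1 /\ derive1 F x = f x}.
Proof.
move=> fint F.
have /(@FTC1 _ f (BRight a)) H : forall y : R,
    leb.-integrable [set` Interval (BRight a) (BRight y)] (EFin \o f).
  by move=> y; apply: integrableS fint => //; exact: measurable_itv.
have /H : locally_integrable [set: R] f.
  by apply: open_integrable_locally => //; exact: openT.
apply: filterS; first exact: (ae_filter_ringOfSetsType leb).
move=> x /= Hx ax; apply: Hx.
by rewrite lte_fin.
Qed.

Lemma derive1_near_eq (f g : R -> R) x :
  (\forall y \near x, f y = g y) -> derive1 f x = derive1 g x.
Proof.
move=> fg; rewrite !derive1E; exact: near_eq_derive.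
Qed.

(** Serves twice: composed with a monotone function on [[a, b]] it yields a cumulative function on
    the whole line, and it truncates the logarithm in [moser_fun]. *)
Definition clamp a b (x : R) := Num.max a (Num.min b x).

Lemma clampE a b x : a <= x -> x <= b -> clamp a b x = x.
Proof. by move=> ax xb; rewrite /clamp (min_idPr xb) (max_idPr ax). Qed.

Lemma clamp_ge a b x : a <= clamp a b x.
Proof. by rewrite /clamp le_max lexx. Qed.

Lemma clamp_le a b x : a <= b -> clamp a b x <= b.
Proof. by move=> ab; rewrite /clamp ge_max ab ge_min lexx. Qed.

Lemma le_clamp a b x y : x <= y -> clamp a b x <= clamp a b y.
Proof.
move=> xy; rewrite /clamp ge_max !le_max lexx/= !le_min !ge_min lexx xy/=.
by rewrite !orbT.
Qed.

Lemma clampB a b x y : a <= b -> x <= y -> clamp a b y - clamp a b x <= y - x.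
Proof.
move=> ab xy; rewrite /clamp.
case: (leP b x) => bx; case: (leP b y) => b_y.
- by case: (leP a b) => ?; lra.
- by case: (leP a b) => ?; case: (leP a y) => ?; lra.
- by case: (leP a b) => ?; case: (leP a x) => ?; lra.
- by case: (leP a y) => ?; case: (leP a x) => ?; lra.
Qed.

Lemma ac_clamp_cumulative a b u : a <= b -> ac_seq a b u ->
  (forall x y, a <= x -> x <= y -> y <= b -> u x <= u y) ->
  exists v : cumulative R R, forall x, v x = u (clamp a b x).
Proof.
move=> ab uac ndu; pose w x := u (clamp a b x).
have wnd : nondecreasing w.
  by move=> x y xy; apply: ndu; rewrite ?clamp_ge ?clamp_le// le_clamp.
have wrc : right_continuous w.
  move=> x; apply/cvgrPdist_lt => e e0.
  have [d d0 ud] := ac_seq_dist uac e0.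
  near=> y; have xy : x <= y by near: y; exact: nbhs_right_ge.
  rewrite distrC; apply: ud; rewrite ?clamp_ge ?clamp_le ?le_clamp//.
  apply: le_lt_trans (clampB ab xy) _; rewrite ltrBlDr addrC.
  by near: y; apply: nbhs_right_lt; rewrite ltrDl.
pose V : cumulative R R := HB.pack w (isCumulative.Build R _ R w wnd wrc).
by exists V.
Unshelve. all: by end_near. Qed.

(** Jordan decomposition: with [T] the variation of [u] from [a], both [T] and [T - u] are
    nondecreasing and absolutely continuous, so each is the integral of a density and [g] is the
    difference of the two. *)
Lemma ac_seq_integral a b u : a < b -> ac_seq a b u ->
  exists g : R -> R, [/\ leb.-integrable setT (EFin \o g),
    forall x, a <= x -> x <= b -> u x - u a = \int[leb]_(t in `]a, x]) g t &
    {ae leb, forall x, a < x -> x < b -> derive1 u x = g x}].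
Proof.
move=> ab uac; have ab' := ltW ab.
pose T x := fine (total_variation a x u).
have bvu := ac_seq_bounded_variation ab' uac.
have TD x y : a <= x -> x <= y -> y <= b -> `|u y - u x| <= T y - T x.
  move=> ax xy yb; rewrite /T.
  have fin z w : a <= z -> z <= w -> w <= b -> total_variation z w u \is a fin_num.
    move=> az zw wb; apply/bounded_variationP => //.
    exact: (@bounded_variation_sub _ a b).
  rewrite (total_variationD u ax xy) fineD ?fin// ?(le_trans xy)//.
  rewrite addrAC subrr add0r -lee_fin fineK ?fin//.
  exact: total_variation_ge.
have Tac : ac_seq a b T := ac_seq_total_variation ab' uac.
have Wac : ac_seq a b (T \- u) := ac_seqB Tac uac.
have [|V VE] := ac_clamp_cumulative ab' Tac.
  move=> x y ax xy yb; rewrite -subr_ge0 (le_trans _ (TD x y _ _ _))//.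
have [|W WE] := ac_clamp_cumulative ab' Wac.
  move=> x y ax xy yb /=; have := TD x y ax xy yb; rewrite ler_norml => /andP[_ h].
  by lra.
have acE v w : (forall x, v x = w (clamp a b x)) -> ac_seq a b w -> ac_seq a b v.
  move=> vw wac e /wac[d d0 wd]; exists d => // s [/allP alls ps] sd.
  rewrite big_seq (eq_bigr (fun I => `|w I.2 - w I.1|)) -?big_seq; first exact: wd (conj (introT allP alls) ps) sd.
  move=> I /alls/and3P[aI I12 Ib].
  by rewrite !vw !clampE// ?(le_trans I12) ?(le_trans aI).
have [f [fint fE]] := cumulative_ac_integral ab (acE _ _ VE Tac).
have [h [hint hE]] := cumulative_ac_integral ab (acE _ _ WE Wac).
have VW x : a <= x -> x <= b -> u x = V x - W x.
  by move=> ax xb; rewrite VE WE !clampE//=; ring.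
have intab x (k : R -> R) : leb.-integrable setT (EFin \o k) ->
    leb.-integrable `]a, x] (EFin \o k).
  by move=> kint; apply: integrableS kint => //; exact: measurable_itv.
have uE x : a <= x -> x <= b -> u x - u a = \int[leb]_(t in `]a, x]) (f \- h) t.
  move=> ax xb.
  have mx : measurable (`]a, x]%classic : set (measurableTypeR R)) by exact: measurable_itv.
  rewrite (RintegralB mx (intab x _ fint) (intab x _ hint)).
  rewrite -fE// -hE// !VW//; ring.
exists (f \- h); split => //.
  rewrite (_ : _ \o _ = (EFin \o f) \- (EFin \o h))%E; first exact: integrableB.
  by apply/funext => x /=; rewrite EFinB.
have fhint : leb.-integrable setT (EFin \o (f \- h)).
  rewrite (_ : _ \o _ = (EFin \o f) \- (EFin \o h))%E; first exact: integrableB.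
  by apply/funext => x /=; rewrite EFinB.
have := ae_derive1_integral a fhint; apply: filterS; first exact: (ae_filter_ringOfSetsType leb).
move=> x /= Fx ax xb.
have [Fd <-] := Fx ax.
rewrite (@derive1_near_eq u (fun x => u a + \int[leb]_(t in `]a, x]) (f \- h) t)).
  by rewrite derive1E (deriveD (derivable_cst (u a) x 1) Fd) derive_cst add0r -derive1E.
near=> y; rewrite -uE; first by rewrite addrC subrK.
  by apply/ltW; near: y; exact: lt_nbhsr.
by apply/ltW; near: y; exact: lt_nbhsl.
Unshelve. all: by end_near. Qed.

Lemma ac_seq_le_integral a b u : a < b -> ac_seq a b u ->
  measurable_fun `]a, b[ (derive1 u) ->
  (`|u b - u a|%:E <= \int[leb]_(x in `]a, b[) `|derive1 u x|%:E)%E.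
Proof.
move=> ab uac mu; have [g [gint uE gE]] := ac_seq_integral ab uac.
have mo : measurable (`]a, b[%classic : set (measurableTypeR R)) by exact: measurable_itv.
have mc : measurable (`]a, b]%classic : set (measurableTypeR R)) by exact: measurable_itv.
have gab : leb.-integrable `]a, b] (EFin \o g) by apply: integrableS gint.
have mg : measurable_fun setT g by apply/measurable_EFinP; exact: (measurable_int leb gint).
rewrite uE ?lexx ?(ltW ab)// -abse_EFin fineK; last exact: integrable_fin_num.
apply: (le_trans (le_abse_integral _ mc (measurable_int _ gab))).
rewrite -integral_itv_bndo_bndc; last first.
  apply/measurable_EFinP; apply: measurableT_comp => //.
  exact: measurable_funTS.
rewrite (@ae_eq_integral _ _ _ leb _ (fun x => `|derive1 u x|%:E))//.
- apply/measurable_EFinP; apply: measurableT_comp => //.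
  exact: measurable_funTS.
- by apply/measurable_EFinP; apply: measurableT_comp.
- move: gE; apply: filterS; first exact: (ae_filter_ringOfSetsType leb).
  by move=> x /= uxg; rewrite in_itv/= => /andP[ax xb]; rewrite uxg.
Qed.
End ftc.

(** * Moser's exponential integral *)

Section powers.
Context {R : realType}.
Implicit Types p q x y c t : R.

(** The power function lies above its tangent at [c]. It is Young's inequality for x and c^(p - 1),
    with equality at x = c. *)
Lemma powR_tangent p x c : 1 < p -> 0 <= x -> 0 <= c ->
  p * c `^ (p - 1) * x <= x `^ p + (p - 1) * c `^ p.
Proof.
move=> p1 x0 c0; have p0 : 0 < p by lra.
have pn0 : p != 0 by rewrite gt_eqF.
have pn1 : p - 1 != 0 by rewrite gt_eqF// subr_gt0.
have := @conjugate_powR _ x (c `^ (p - 1)) p (p / (p - 1)) x0 (powR_ge0 _ _) p0.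
rewrite divr_gt0 ?subr_gt0// => /(_ isT).
have -> : p^-1 + (p / (p - 1))^-1 = 1 by field; rewrite pn0 pn1.
move=> /(_ erefl); rewrite -powRrM.
have -> : (p - 1) * (p / (p - 1)) = p by field.
rewrite -(ler_pM2l p0) => /le_trans h.
rewrite -mulrA [_ * x]mulrC; apply: h.
rewrite le_eqVlt; apply/orP; left; apply/eqP; field.
by rewrite pn0 pn1.
Qed.

Lemma bernoulli_powR p x : 1 <= p -> 0 <= x -> x <= 1 ->
  1 - p * x <= (1 - x) `^ p.
Proof.
move=> p1 x0 x1; have x1' : 0 <= 1 - x by lra.
move: p1; rewrite le_eqVlt => /predU1P[<-|p1].
  by rewrite powRr1// mul1r.
by have := powR_tangent p1 x1' ler01; rewrite !powR1; lra.
Qed.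

(** Convexity applied to x + y = (1 - t) * (x / (1 - t)) + t * (y / t): the tangent bounds at
    [x + y] for the two quotients are added with weights 1 - t and t. *)
Lemma powRD_split q t x y : 1 < q -> 0 < t -> t < 1 -> 0 <= x -> 0 <= y ->
  (x + y) `^ q <= (1 - t) `^ (1 - q) * x `^ q + t `^ (1 - q) * y `^ q.
Proof.
move=> q1 t0 t1 x0 y0; have t1' : 0 < 1 - t by lra.
have q0 : 0 < q by lra.
have xy0 : 0 <= x + y by rewrite addr_ge0.
have scale s z : 0 < s -> 0 <= z -> s `^ (1 - q) * z `^ q = s * (z / s) `^ q.
  move=> s0 z0; rewrite powRM// ?invr_ge0 ?(ltW s0)// -powR_inv1 ?(ltW s0)//.
  rewrite -powRrM mulN1r powRD ?(gt_eqF s0) ?implybT// powRr1 ?(ltW s0)//.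
  by rewrite mulrA mulrAC.
rewrite !scale//.
have hx := powR_tangent q1 (divr_ge0 x0 (ltW t1')) xy0.
have hy := powR_tangent q1 (divr_ge0 y0 (ltW t0)) xy0.
rewrite -(ler_pM2l t1') in hx; rewrite -(ler_pM2l t0) in hy.
have := lerD hx hy.
set c := x + y; set P := c `^ (q - 1).
have cP : P * c = c `^ q by rewrite mulrC mulr_powRB1.
have -> : (1 - t) * (q * P * (x / (1 - t))) + t * (q * P * (y / t)) = q * (P * c).
  by rewrite /c; field; rewrite !gt_eqF.
rewrite cP; lra.
Qed.

Lemma le_powR p x y : 0 <= p -> 0 <= x -> x <= y -> x `^ p <= y `^ p.
Proof.
by move=> p0 x0 xy; apply: ge0_ler_powR; rewrite ?nnegrE// (le_trans x0).
Qed.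

Lemma powRK p x : p != 0 -> 0 <= x -> (x `^ p) `^ p^-1 = x.
Proof. by move=> p0 x0; rewrite -powRrM mulfV// powRr1. Qed.

Lemma powRVK p x : p != 0 -> 0 <= x -> (x `^ p^-1) `^ p = x.
Proof. by move=> p0 x0; rewrite -powRrM mulVf// powRr1. Qed.

Section moser.
Variables (p : R) (w M : R -> R).
Let q := p / (p - 1).
(** Chosen so that [K * lam <= s] keeps the parameter [tau] of [moser_spread] at most 1/2. *)
Let K := 2 `^ p * (p - 1).
Hypotheses (p2 : 2 <= p) (w0 : w 0 = 0) (M0 : M 0 = 0) (M1 : forall t, 0 <= t -> M t <= 1).
Hypothesis wM : forall s t, 0 <= s -> s <= t ->
  `|w t - w s| `^ p <= (M t - M s) * (t - s) `^ (p - 1).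

Lemma moser_ge4 : 4 <= K.
Proof.
rewrite /K; have h : 2 `^ 2%:R <= 2 `^ p :> R by rewrite ler_powR// ler1n.
have {h} : 4 <= 2 `^ p :> R by apply: le_trans h; rewrite powR_mulrn//; lra.
by move: (2 `^ p) p2 => X; nra.
Qed.

(* If [M s] is nearly [1] the remaining energy on [s, t] is at most
   [(p - 1) * lam / s], too little for [w] to follow [t `^ q^-1] for long. *)
Lemma moser_spread lam s t : 0 < lam -> K * lam <= s -> s <= t ->
  s - `|w s| `^ q <= lam -> t - `|w t| `^ q <= lam ->
  t - s <= 2 * (1 + K) * lam.
Proof.
move=> lam0 Ks st Fs Ft.
have K4 := moser_ge4; have p_ge2 := p2.
have p0 : 0 < p by lra.
have p10 : 0 < p - 1 by lra.
have pn0 : p != 0 by rewrite gt_eqF.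
have pn1 : p - 1 != 0 by rewrite gt_eqF.
have q1 : 1 < q by rewrite /q ltr_pdivlMr//; lra.
have q0 : 0 < q by lra.
have qn0 : q != 0 by rewrite gt_eqF.
have s4 : 4 * lam <= s by apply: le_trans Ks; rewrite ler_pM2r.
have s0 : 0 < s by lra.
have sn0 : s != 0 by rewrite gt_eqF.
have t0 : 0 <= t by lra.
pose D := (p - 1) * (lam / s).
have ls0 : 0 < lam / s by rewrite divr_gt0.
have ls1 : lam / s <= 1 by rewrite ler_pdivrMr//; lra.
have D0 : 0 < D by rewrite mulr_gt0.
have h0 : 0 <= t - s by lra.
have ws : `|w s| `^ p <= M s * s `^ (p - 1).
  by have := wM (lexx 0) (ltW s0); rewrite w0 M0 !subr0.
(* Raising s - lam <= |w s|^q to the power p - 1 gives (s - lam)^(p - 1) <= |w s|^p <= M s * s^(p -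
   1). Thus M s >= (1 - lam / s)^(p - 1) >= 1 - D by Bernoulli, while M t <= 1. *)
have MD : M t - M s <= D.
  have : (s - lam) `^ (p - 1) <= M s * s `^ (p - 1).
    apply: le_trans ws.
    have -> : `|w s| `^ p = (`|w s| `^ q) `^ (p - 1).
      by rewrite -powRrM; congr powR; rewrite /q; field.
    by apply: le_powR; lra.
  have -> : s - lam = s * (1 - lam / s) by field.
  rewrite powRM//; [|by lra|by lra].
  rewrite mulrC ler_pM2r ?powR_gt0// => h.
  have p11 : 1 <= p - 1 by lra.
  have := bernoulli_powR p11 (ltW ls0) ls1.
  have := M1 t0; rewrite /D; lra.
have ws' : `|w s| <= s `^ q^-1.
  rewrite -(powRK pn0 (normr_ge0 (w s))).
  have -> : s `^ q^-1 = (s `^ (p - 1)) `^ p^-1.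
    by rewrite -powRrM; congr powR; rewrite /q; field; rewrite pn0 pn1.
  apply: le_powR; rewrite ?powR_ge0 ?invr_ge0 ?(ltW p0)//.
  apply: (le_trans ws); rewrite ler_piMl ?powR_ge0//.
  by apply: M1; lra.
have wts : `|w t - w s| <= (D * (t - s) `^ (p - 1)) `^ p^-1.
  rewrite -(powRK pn0 (normr_ge0 _)).
  apply: le_powR; rewrite ?powR_ge0 ?invr_ge0 ?(ltW p0)//.
  apply: (le_trans (wM (ltW s0) st)); rewrite ler_wpM2r ?powR_ge0//.
(* The weight for which tau^(1 - q) cancels D^(1 / (p - 1)) and leaves exactly (t - s) / 2, half of
   which can be absorbed on the left. *)
pose tau := 2 `^ (p - 1) * D.
have tau0 : 0 < tau by rewrite mulr_gt0// powR_gt0.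
have tausE : tau * s = K / 2 * lam.
  rewrite /tau /D /K -(@mulr_powRB1 _ 2 p)//; field; lra.
have tau12 : tau <= 1 / 2.
  by rewrite -(ler_pM2r s0) tausE; lra.
have := powRD_split q1 tau0 (_ : tau < 1) (powR_ge0 s q^-1)
  (powR_ge0 (D * (t - s) `^ (p - 1)) p^-1).
have tau1 : tau < 1 by lra.
move=> /(_ tau1); rewrite powRVK ?(ltW s0)//.
have -> : ((D * (t - s) `^ (p - 1)) `^ p^-1) `^ q = D `^ (p - 1)^-1 * (t - s).
  rewrite -powRrM; have -> : p^-1 * q = (p - 1)^-1.
    by rewrite /q; field; rewrite pn0 pn1.
  by rewrite powRM ?powR_ge0 ?(ltW D0)// powRK.
have -> : tau `^ (1 - q) * (D `^ (p - 1)^-1 * (t - s)) = (t - s) / 2.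
  have -> : 1 - q = - (p - 1)^-1 by rewrite /q; field.
  rewrite /tau powRM ?powR_ge0 ?(ltW D0)// [in X in _ * X * _]powRN.
  rewrite -[(2 `^ _) `^ _]powRrM mulrN mulfV// powR_inv1//.
  have : D `^ (p - 1)^-1 != 0 by rewrite gt_eqF// powR_gt0.
  by move=> ?; field.
(* Here q <= 2, so the exponent is at least -1; then 1 / (1 - tau) <= 1 + 2 * tau because tau <=
   1/2. *)
have : (1 - tau) `^ (1 - q) <= 1 + 2 * tau.
  apply: (@le_trans _ _ ((1 - tau) `^ (- 1))).
    apply: ger_powR; first by lra.
    rewrite lerBrDr addrC lerBlDr.
    by rewrite /q ler_pdivrMr//; lra.
  rewrite powR_inv1; last by lra.
  rewrite -[leLHS]mul1r ler_pdivrMr; last by lra.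
  have : 0 <= tau * (1 - 2 * tau) by rewrite mulr_ge0; lra.
  by lra.
move=> h1 h2.
have h3 : `|w t| `^ q <= (s `^ q^-1 + (D * (t - s) `^ (p - 1)) `^ p^-1) `^ q.
  apply: le_powR; rewrite ?(ltW q0)//.
  rewrite -(subrK (w s) (w t)) addrC; apply: (le_trans (ler_normD _ _)).
  exact: lerD.
have h4 : (1 - tau) `^ (1 - q) * s <= (1 + 2 * tau) * s by rewrite ler_pM2r.
have h5 : (1 + 2 * tau) * s = s + K * lam by rewrite mulrDl -mulrA tausE mul1r; field.
clear - h1 h2 h3 h4 h5 Ft; lra.
Qed.

End moser.
End powers.

(** * Increments bounded by the energy *)

Section energy.
Context {R : realType}.
Implicit Types (a b p : R) (u : R -> R).
Notation leb := (@lebesgue_measure R).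

Lemma measurable_fun_inv a b : 0 <= a ->
  measurable_fun `]a, b[ (fun x : R => x^-1).
Proof.
move=> a0; apply: (eq_measurable_fun (fun x => x `^ (-1))).
  move=> x; rewrite inE/= in_itv/= => /andP[ax _].
  by rewrite powR_inv1// (le_trans a0)// ltW.
by apply: measurable_funTS; exact: measurable_powR.
Qed.

Lemma integral_inv a b : 0 < a -> a < b ->
  (\int[leb]_(x in `]a, b[) (x^-1)%:E = (ln b - ln a)%:E)%E.
Proof.
move=> a0 ab; have b0 : 0 < b by exact: lt_trans ab.
have pos x : x \in `[a, b] -> 0 < x.
  by rewrite in_itv/= => /andP[ax _]; exact: lt_le_trans ax.
have cinv : {within `[a, b], continuous (@GRing.inv R)}.
  apply: continuous_in_subspaceT => x /set_mem/= /pos x0.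
  by apply: inv_continuous; rewrite gt_eqF.
rewrite -(@integral_itv_bndoo _ _ _ _ true false); last first.
  by apply/measurable_EFinP; apply: measurable_fun_inv; exact: ltW.
rewrite (@continuous_FTC2 _ _ (@ln R))//.
- have cln x : 0 < x -> {for x, continuous (@ln R)} by exact: continuous_ln.
  split.
  + move=> x; rewrite in_itv/= => /andP[ax _].
    by have [] := is_derive1_ln (lt_trans a0 ax).
  + exact/cvg_at_right_filter/cln.
  + exact/cvg_at_left_filter/cln.
- move=> x; rewrite in_itv/= => /andP[ax _].
  by rewrite derive1E; have [_ ->] := is_derive1_ln (lt_trans a0 ax).
Qed.

(** Hoelder's inequality obtained by integrating a tangent. [powR_tangent] at x * |u' x|, divided by
    x, integrates to p c^(p - 1) d <= E + (p - 1) c^p L. The value c = d / L is the slope of the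
    extremal |u' x| = c / x and turns this into c^p L <= E, which is the claim. *)
Lemma energy_ineq p a b u : 1 < p -> 0 < a -> a < b -> ac_seq a b u ->
  measurable_fun `]a, b[ (derive1 u) ->
  ((`|u b - u a| `^ p)%:E <=
   \int[leb]_(x in `]a, b[) (`|derive1 u x| `^ p * x `^ (p - 1))%:E *
   ((ln b - ln a) `^ (p - 1))%:E)%E.
Proof.
move=> p1 a0 ab uac mu.
have b0 : 0 < b by exact: lt_trans ab.
pose L := ln b - ln a; have L0 : 0 < L by rewrite subr_gt0 ltr_ln.
pose d := `|u b - u a|; pose c := d / L.
have d0 : 0 <= d by exact: normr_ge0.
have c0 : 0 <= c by rewrite divr_ge0// ltW.
have mo : measurable (`]a, b[%classic : set (measurableTypeR R)).
  exact: measurable_itv.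
have le_int := ac_seq_le_integral ab uac mu.
have mnorm : measurable_fun `]a, b[ (fun x => `|derive1 u x|).
  exact: measurableT_comp.
have mE : measurable_fun `]a, b[ (fun x => `|derive1 u x| `^ p * x `^ (p - 1)).
  apply: measurable_funM; last exact: measurable_fun_powR.
  exact: measurable_fun_norm_powR.
have mV : measurable_fun `]a, b[ (fun x : R => x^-1).
  by apply: measurable_fun_inv; exact: ltW.
have pos x : `]a, b[%classic x -> 0 < x.
  by rewrite /= in_itv/= => /andP[ax _]; exact: lt_trans ax.
have : ((p * c `^ (p - 1))%:E * d%:E <=
    \int[leb]_(x in `]a, b[) (`|derive1 u x| `^ p * x `^ (p - 1))%:E +
    ((p - 1) * c `^ p)%:E * L%:E)%E.
  have k0 : 0 <= p * c `^ (p - 1) by rewrite mulr_ge0 ?powR_ge0//; lra.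
  have k1 : 0 <= (p - 1) * c `^ p by rewrite mulr_ge0 ?powR_ge0//; lra.
  apply: (@le_trans _ _ ((p * c `^ (p - 1))%:E *
      \int[leb]_(x in `]a, b[) `|derive1 u x|%:E)%E).
    by rewrite lee_wpmul2l.
  rewrite -(integral_inv a0 ab) -EFin_integralZl//.
  rewrite -EFin_integralZl//; last by move=> x /pos x0; rewrite invr_ge0 ltW.
  rewrite -EFin_integralD//; last 3 first.
  - exact: measurable_funM.
  - by move=> x _; rewrite mulr_ge0 ?powR_ge0.
  - by move=> x /pos x0; rewrite mulr_ge0 ?invr_ge0 ?(ltW x0).
  apply: EFin_le_integral => //.
  - exact: measurable_funM.
  - by apply: measurable_funD => //; exact: measurable_funM.
  - by move=> x _; rewrite mulr_ge0.
  - move=> x /pos x0.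
    have := powR_tangent p1 (mulr_ge0 (normr_ge0 (derive1 u x)) (ltW x0)) c0.
    rewrite (powRM _ (normr_ge0 _) (ltW x0)) -(mulr_powRB1 (ltW x0)); last by lra.
    rewrite -(ler_pM2r (_ : 0 < x^-1)) ?invr_gt0//.
    by congr (_ <= _); field; rewrite gt_eqF.
set E := (\int[leb]_(x in _) _)%E.
have E0 : (0 <= E)%E.
  by apply: integral_ge0 => x _; rewrite lee_fin mulr_ge0 ?powR_ge0.
case: E E0 => [E| |]//; last first.
  by move=> _ _; rewrite gt0_mulye ?leey// lte_fin powR_gt0.
rewrite -!EFinM -EFinD !lee_fin => E0.
have dE : d = c * L by rewrite /c divfK// gt_eqF.
have cL : c `^ p = c * c `^ (p - 1) by rewrite mulr_powRB1//; lra.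
rewrite -/d -/L dE (powRM _ c0 (ltW L0)) -(mulr_powRB1 (ltW L0)); last by lra.
rewrite cL => h; rewrite mulrA ler_pM2r ?powR_gt0//.
by move: h; set z := c `^ (p - 1); lra.
Qed.

End energy.

(** * Moser's integral summed over the layers of the exponent *)

Section moser_integral.
Context {R : realType}.
Implicit Types (a b r : R).
Notation leb := (@lebesgue_measure R).

Lemma integral_inv_indic a b : 0 < a -> a < b ->
  (\int[leb]_(x in `]0%R, +oo[) (\1_(`]a, b[%classic : set R) x * x^-1)%:E = (ln b - ln a)%:E)%E.
Proof.
move=> a0 ab; rewrite -(integral_inv a0 ab).
have -> : (`]a, b[%classic : set R) = `]0, +oo[%classic `&` `]a, b[%classic.
  apply/seteqP; split => x /=; rewrite !in_itv/= ?andbT; last by case.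
  by move=> /andP[ax xb]; rewrite (lt_trans a0 ax) ax xb.
rewrite [RHS]integral_mkcondr; apply: eq_integral => x.
move=> xD; rewrite patchE indicE in_setI xD/=.
by case: ifP => _; rewrite ?mul1r ?mul0r.
Qed.

(** Since n + 1 <= 2 exp(n / 2), the terms are dominated by a geometric sequence of ratio exp(-
    1/2). *)
Lemma series_expRN_bound N :
  \sum_(0 <= n < N) expR (- n%:R) * n.+1%:R <= 2 / (1 - expR (- 2^-1)) :> R.
Proof.
have z0 : 0 < expR (- 2^-1) :> R by exact: expR_gt0.
have z1 : `|expR (- 2^-1)| < 1 :> R.
  by rewrite gtr0_norm// -[ltRHS]expR0 ltr_expR oppr_lt0 invr_gt0.
have z2 : 0 <= 2 :> R by [].
apply: le_trans (geometric_le_lim N z2 z0 z1); rewrite /series/=.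
apply: ler_sum => n _; rewrite /geometric/=.
rewrite -expRM_natl mulrN; set x := n%:R * _.
have -> : - n%:R = - x - x :> R by rewrite /x; field.
have nx : n.+1%:R <= 2 * expR x.
  have := expR_ge1Dx x; rewrite -natr1; move: (expR x) => y.
  by rewrite /x; move: (n%:R) => z; lra.
rewrite expRD -mulrA mulrC ler_wpM2r ?expR_ge0//.
by rewrite expRN mulrC ler_pdivrMr ?expR_gt0.
Qed.

Section moser.
Variables (p : R) (w M : R -> R).
Let q := p / (p - 1).
Let K := 2 `^ p * (p - 1).
Hypotheses (p2 : 2 <= p) (w0 : w 0 = 0) (M0 : M 0 = 0) (M1 : forall t, 0 <= t -> M t <= 1).
Hypothesis wM : forall s t, 0 <= s -> s <= t ->
  `|w t - w s| `^ p <= (M t - M s) * (t - s) `^ (p - 1).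

(** By [moser_spread], any two points of the sublevel set beyond [K * lam] are close, so any one of
    them, if there is one, can serve as the centre [s]. The constants leave room for strict
    inequalities. *)
Lemma moser_interval lam : 0 < lam -> exists s, forall t, 0 <= t ->
  t - `|w t| `^ q <= lam -> t < 2 * K * lam \/ `|t - s| < 4 * (1 + K) * lam.
Proof.
move=> lam0; have p2' := p2.
have K4 : 4 <= K by exact: moser_ge4.
have Kl : 0 < K * lam by rewrite mulr_gt0//; lra.
have [[s [Ks Fs]]|no] := pselect (exists s, K * lam <= s /\ s - `|w s| `^ q <= lam).
  exists s => t t0 Ft; have [tK|Kt] := ltP t (K * lam); first by left; lra.
  right; have CK : 0 < (1 + K) * lam by rewrite mulr_gt0//; lra.
  have [st|ts] := leP s t.
    have := moser_spread p2 w0 M0 M1 wM lam0 Ks st Fs Ft.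
    by rewrite ger0_norm ?subr_ge0// -/K; lra.
  have := moser_spread p2 w0 M0 M1 wM lam0 Kt (ltW ts) Ft Fs.
  by rewrite distrC gtr0_norm ?subr_gt0// -/K; lra.
exists 0 => t t0 Ft; left; have [tK|Kt] := ltP t (K * lam); first by lra.
by case: no; exists t.
Qed.

Lemma moser_F_ge0 t : 0 <= t -> `|w t| `^ q <= t.
Proof.
move=> t0; have p2' := p2.
have := wM (lexx 0) t0; rewrite w0 M0 !subr0 => h.
have {}h : `|w t| `^ p <= t `^ (p - 1).
  apply: le_trans h _; rewrite ler_piMl ?powR_ge0//; exact: M1.
have -> : `|w t| `^ q = (`|w t| `^ p) `^ (p - 1)^-1 by rewrite -powRrM.
have p1 : 0 < p - 1 by lra.
have pn1 : p - 1 != 0 by rewrite gt_eqF.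
rewrite -[leRHS](powRK pn1 t0).
by apply: le_powR => //; rewrite invr_ge0 ltW.
Qed.

Variables (k r0 : R) (V : R -> R).
Hypotheses (k0 : 0 < k) (r00 : 0 < r0).
Hypothesis mV : measurable_fun `]0, r0[ V.
Hypothesis VE : forall r, 0 < r -> r < r0 -> V r = w (k * (ln r0 - ln r)).

(** With t = k (ln r0 - ln r) and F = t - |w t|^q, the integrand is r0^k exp(- F) / r. On the layer
    n <= F < n + 1 it is at most r0^k exp(- n) / r, and by [moser_interval] that layer lies in two
    intervals whose dr / r measures are 2 K (n + 1) / k and 8 (1 + K) (n + 1) / k; hence 8 + 10
    K. *)
Lemma moser_integral :
  (\int[leb]_(r in `]0%R, r0[) (expR (`|V r| `^ q) * r `^ (k - 1))%:E <=
   (r0 `^ k * ((8 + 10 * K) / k * (2 / (1 - expR (- 2^-1)))))%:E)%E.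
Proof.
have p2' := p2; have k0' := k0.
have K4 : 4 <= K by exact: moser_ge4.
have iv n : {s | forall t, 0 <= t -> t - `|w t| `^ q <= n.+1%:R ->
    t < 2 * K * n.+1%:R \/ `|t - s| < 4 * (1 + K) * n.+1%:R}.
  by apply/cid/moser_interval; rewrite ltr0n.
pose s n := sval (iv n).
(* [A n] and [B n] are the two intervals of [moser_interval] at level [n.+1], carried to the
   variable r by ln r = ln r0 - t / k; this replaces a change of variables in the integral. *)
pose A n : set R := `]expR (ln r0 - 2 * K * n.+1%:R / k), r0[%classic.
pose B n : set R := `]expR (ln r0 - (s n + 4 * (1 + K) * n.+1%:R) / k),
                      expR (ln r0 - (s n - 4 * (1 + K) * n.+1%:R) / k)[%classic.
pose h n r : \bar R := (expR (- n%:R) * (\1_(A n) r * r^-1 + \1_(B n) r * r^-1))%:E.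
have mD : measurable (`]0, r0[%classic : set (measurableTypeR R)).
  exact: measurable_itv.
have mP : measurable (`]0, +oo[%classic : set (measurableTypeR R)).
  exact: measurable_itv.
have mAB (C : nat -> set R) (n : nat) : (forall n, measurable (C n)) ->
    measurable_fun (`]0, +oo[%classic : set R) (fun r => \1_(C n) r * r^-1).
  move=> mC; apply: measurable_funM; first exact: measurable_indic.
  apply: (eq_measurable_fun (fun x => x `^ (-1))).
    by move=> x; rewrite inE/= in_itv/= andbT => x0; rewrite powR_inv1// ltW.
  exact: measurable_fun_powR.
have mA n : measurable (A n) by exact: measurable_itv.
have mB n : measurable (B n) by exact: measurable_itv.
have mhP n : measurable_fun (`]0, +oo[%classic : set R) (h n).
  apply/measurable_EFinP; apply: measurable_funM => //.
  by apply: measurable_funD; exact: mAB.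
have mh n : measurable_fun (`]0, r0[%classic : set R) (h n).
  apply: measurable_funS (mhP n) => // x /=.
  by rewrite !in_itv/= => /andP[->].
have h0 n x : 0 < x -> (0 <= h n x)%E.
  move=> x0; rewrite lee_fin mulr_ge0 ?expR_ge0// addr_ge0// mulr_ge0//.
    by rewrite invr_ge0 ltW.
  by rewrite invr_ge0 ltW.
have h0D n x : `]0, r0[%classic x -> (0 <= h n x)%E.
  by rewrite /= in_itv/= => /andP[x0 _]; exact: h0.
have DP : `]0, r0[%classic `<=` (`]0, +oo[%classic : set R).
  by move=> x /=; rewrite !in_itv/= => /andP[->].
have key r : 0 < r -> r < r0 ->
    ((expR (`|V r| `^ q) * r `^ (k - 1))%:E <=
     (r0 `^ k)%:E * \sum_(0 <= n <oo) h n r)%E.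
  move=> rpos rr0; rewrite VE//; set t := k * _.
  have t0 : 0 <= t.
    by rewrite mulr_ge0 ?(ltW k0)// subr_ge0 ler_ln ?posrE// ltW.
  pose F := t - `|w t| `^ q.
  have F0 : 0 <= F by rewrite subr_ge0 moser_F_ge0.
  (* The layer of [r]: [n <= F] bounds the exponential, and [F < n.+1] places [t] in the sublevel
     set of level [n.+1]. *)
  have /andP[nF Fn] := truncn_itv F0; set n := Num.truncn F in nF Fn.
  apply: (@le_trans _ _ ((r0 `^ k)%:E * h n r)%E); last first.
    rewrite lee_wpmul2l// ?lee_fin ?powR_ge0//.
    apply: (le_trans _ (nneseries_lim_ge n.+1 _)); last first.
      by move=> m _ _; exact: h0.
    rewrite big_nat_recr//= leeDr// sume_ge0// => m _.
    exact: h0.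
  have ind : 1 <= \1_(A n) r + \1_(B n) r :> R.
    have := svalP (iv n) t t0 (ltW Fn); rewrite -/(s n).
    have tk : ln r = ln r0 - t / k by rewrite /t; field; rewrite gt_eqF.
    move=> [tK|tB].
      have -> : \1_(A n) r = 1 :> R; last by rewrite lerDl.
      rewrite indicE mem_set// /A/= in_itv/= rr0 andbT.
      rewrite -[ltRHS]lnK ?posrE// ltr_expR tk ltrD2l ltrN2 ltr_pM2r ?invr_gt0//.
    have -> : \1_(B n) r = 1 :> R; last by rewrite lerDr.
    move: tB; rewrite ltr_norml => /andP[tB1 tB2].
    rewrite indicE mem_set// /B/= in_itv/=; apply/andP; split.
      rewrite -[ltRHS]lnK ?posrE// ltr_expR tk ltrD2l ltrN2 ltr_pM2r ?invr_gt0//.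
      by lra.
    rewrite -[ltLHS]lnK ?posrE// ltr_expR tk ltrD2l ltrN2 ltr_pM2r ?invr_gt0//.
    by lra.
  rewrite /h -EFinM lee_fin.
  have -> : `|w t| `^ q = t - F by rewrite /F; lra.
  have et : expR t * r `^ k = r0 `^ k.
    rewrite /powR !gt_eqF// -expRD /t; congr expR; ring.
  have -> : expR (t - F) * r `^ (k - 1) = r0 `^ k * (expR (- F) * r^-1).
    rewrite expRD -et powRB ?powRr1 ?(ltW rpos)//; first by ring.
    by rewrite (gt_eqF rpos) implybT.
  rewrite ler_wpM2l ?powR_ge0// -mulrDl mulrA ler_wpM2r ?invr_ge0 ?(ltW rpos)//.
  apply: (@le_trans _ _ (expR (- n%:R))); first by rewrite ler_expR lerN2.
  by rewrite ler_peMr// expR_ge0.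
apply: (@le_trans _ _ ((r0 `^ k)%:E * \int[leb]_(r in `]0%R, r0[) \sum_(0 <= n <oo) h n r)%E).
  rewrite -ge0_integralZl_EFin ?powR_ge0//; last 2 first.
  - move=> x Dx; apply: nneseries_ge0 => n _ _; exact: h0D.
  - apply: ge0_emeasurable_sum => n; [by move=> x Dx _; exact: h0D|].
    by move=> _; exact: mh.
  apply: ge0_le_integral => //.
  - by move=> x _; rewrite lee_fin mulr_ge0 ?expR_ge0 ?powR_ge0.
  - apply/measurable_EFinP; apply: measurable_funM; last exact: measurable_fun_powR.
    by apply: measurableT_comp => //; exact: measurable_fun_norm_powR.
  - apply: emeasurable_funM => //; apply: ge0_emeasurable_sum => n; [by move=> x Dx _; exact: h0D|].
    by move=> _; exact: mh.
  - by move=> x /=; rewrite in_itv/= => /andP[]; exact: key.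
rewrite [leRHS]EFinM lee_wpmul2l// ?lee_fin ?powR_ge0//.
rewrite integral_nneseries//.
have term n : (\int[leb]_(r in `]0%R, r0[) h n r <= ((8 + 10 * K) / k * (expR (- n%:R) * n.+1%:R))%:E)%E.
  apply: (@le_trans _ _ (\int[leb]_(r in `]0%R, +oo[) h n r)%E).
    apply: ge0_subset_integral => //.
      exact: mhP.
    by move=> x /=; rewrite in_itv/= andbT; exact: h0.
  have lt_expR x y : x < y -> expR x < expR y :> R by rewrite ltr_expR.
  have n0 : 0 < n.+1%:R :> R by [].
  have i0 C x : `]0, +oo[%classic x -> 0 <= \1_C x * x^-1 :> R.
    by rewrite /= in_itv/= andbT => x0; rewrite mulr_ge0// invr_ge0 ltW.
  rewrite EFin_integralZl ?expR_ge0//; last 2 first.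
  - by apply: measurable_funD; exact: mAB.
  - by move=> x x0; rewrite addr_ge0// i0.
  rewrite EFin_integralD//; [|exact: mAB|exact: mAB|exact: i0|exact: i0].
  rewrite {1}/A {1}/B !integral_inv_indic ?expR_gt0//; last 2 first.
  - apply: lt_expR; rewrite ltrD2l ltrN2 ltr_pM2r ?invr_gt0// ltrD2l.
    by rewrite gtrN// !mulr_gt0//; lra.
  - rewrite -[ltRHS]lnK ?posrE// ltr_expR gtrBl divr_gt0//.
    by rewrite !mulr_gt0//; lra.
  rewrite !expRK -EFinD -EFinM lee_fin le_eqVlt; apply/orP; left; apply/eqP.
  by field; rewrite gt_eqF.
have term0 n : (0 <= \int[leb]_(r in `]0%R, r0[) h n r)%E.
  by apply: integral_ge0 => x; exact: h0D.
apply: lime_le; first by apply: is_cvg_nneseries => n _ _; exact: term0.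
near=> N; apply: (@le_trans _ _ (\sum_(0 <= n < N) ((8 + 10 * K) / k * (expR (- n%:R) * n.+1%:R))%:E)%E).
  by apply: lee_sum => n _; exact: term.
rewrite sumEFin lee_fin -mulr_sumr ler_wpM2l//; last exact: series_expRN_bound.
by rewrite divr_ge0 ?(ltW k0)//; lra.
Unshelve. all: by end_near. Qed.

End moser.
End moser_integral.

(** * The truncated exponential *)

Section phi_theory.
Context {R : realType}.
Implicit Types (m p t x y : R).

Lemma phi_index p : exists N, forall j, (p - 1 <= j%:R) = (N <= j)%N.
Proof.
have ex : exists j, p - 1 <= j%:R.
  exists (Num.Def.archi_bound (p - 1)); case: (ltP 0 (p - 1)) => h.
    by rewrite ltW// archi_boundP// ltW.
  exact: le_trans h _.
exists (ex_minn ex) => j; case: ex_minnP => m pm mmin.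
apply/idP/idP => [/mmin//|mj]; apply: (le_trans pm); by rewrite ler_nat.
Qed.

Definition phi_head p t : R :=
  \sum_(0 <= j < sval (cid (phi_index p))) t ^+ j / j`!%:R.

Lemma cvg_phi p t :
  (fun n => \sum_(0 <= j < n | p - 1 <= j%:R) t ^+ j / j`!%:R) @ \oo -->
  expR t - phi_head p t.
Proof.
rewrite /phi_head; case: cid => N /= HN.
have ce : series (exp_coeff t) @ \oo --> expR t by exact: is_cvg_series_exp_coeff.
have : (fun n => series (exp_coeff t) n - \sum_(0 <= j < N) t ^+ j / j`!%:R) @ \oo -->
    expR t - \sum_(0 <= j < N) t ^+ j / j`!%:R.
  by apply: cvgB => //; exact: cvg_cst.
apply: cvg_trans; apply: near_eq_cvg; near=> n.
have Nn : (N <= n)%N by near: n; exact: nbhs_infty_ge.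
rewrite /series/= (big_cat_nat (leq0n N) Nn)//= addrAC subrr add0r.
rewrite [RHS](big_cat_nat (leq0n N) Nn)/=.
rewrite [X in _ = X + _]big_nat_cond [X in _ = X + _]big_pred0 ?add0r.
  rewrite [RHS]big_nat_cond [LHS]big_nat_cond; apply: eq_bigl => j.
  by rewrite HN; case: (leqP N j); rewrite ?andbF ?andbT.
by move=> j; rewrite HN; case: (leqP N j); rewrite ?andbF ?andbT.
Unshelve. all: by end_near. Qed.

Lemma phiE p t : phi p t = expR t - phi_head p t.
Proof. by rewrite /phi; apply/cvg_lim => //; exact: cvg_phi. Qed.

Lemma is_cvg_phi p t :
  cvgn (fun n => \sum_(0 <= j < n | p - 1 <= j%:R) t ^+ j / j`!%:R).
Proof. by apply/cvg_ex; exists (expR t - phi_head p t); exact: cvg_phi. Qed.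

Lemma measurable_phi p : measurable_fun setT (phi p).
Proof.
rewrite (_ : phi p = fun t => expR t - phi_head p t); last exact/funext/phiE.
apply: measurable_funB; first exact: measurable_expR.
rewrite /phi_head; apply: measurable_sum => j.
by apply: measurable_funM => //; exact: measurable_funX.
Qed.

(** [1 < p] discards the term j = 0, the only one that does not vanish at 0. *)
Lemma phi0 p : 1 < p -> phi p 0 = 0.
Proof.
move=> p1; rewrite /phi (_ : (fun n => _) = cst 0); first exact: lim_cst.
apply/funext => n; apply: big1 => -[|j] /=; last by rewrite expr0n mul0r.
by rewrite leNgt; case/negP; lra.
Qed.

Lemma phi_ge0 p t : 0 <= t -> 0 <= phi p t.
Proof.
move=> t0; apply: limr_ge; first exact: is_cvg_phi.
by near=> n; apply: sumr_ge0 => j _; rewrite divr_ge0// exprn_ge0.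
Unshelve. all: by end_near. Qed.

Lemma phi_head_ge0 p t : 0 <= t -> 0 <= phi_head p t.
Proof. by move=> t0; apply: sumr_ge0 => j _; rewrite divr_ge0// exprn_ge0. Qed.

Lemma phi_le_expR p t : 0 <= t -> phi p t <= expR t.
Proof. by move=> t0; rewrite phiE gerBl phi_head_ge0. Qed.

Lemma le_phi p x y : 0 <= x -> x <= y -> phi p x <= phi p y.
Proof.
move=> x0 xy; apply: ler_lim; [exact: is_cvg_phi|exact: is_cvg_phi|].
near=> n; apply: ler_sum => j _; rewrite ler_wpM2r ?invr_ge0//.
by apply: lerXn2r; rewrite ?nnegrE ?(le_trans x0).
Unshelve. all: by end_near. Qed.

(** Termwise: x / y <= 1, and every exponent j kept in [phi] is at least p - 1. Applied to multiples
    of |u|^q it produces |u|^p, since q (p - 1) = p. *)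
Lemma phi_le_powR p x y : 1 < p -> 0 <= x -> x <= y -> 0 < y ->
  phi p x <= (x / y) `^ (p - 1) * phi p y.
Proof.
move=> p1 x0 xy y0; set k := _ `^ _.
have : k * (\sum_(0 <= j < n | p - 1 <= j%:R) y ^+ j / j`!%:R) @[n --> \oo] --> k * phi p y.
  by apply: cvgMr; rewrite phiE; exact: cvg_phi.
move=> cy; rewrite -(cvg_lim _ cy)//; apply: ler_lim.
- exact: is_cvg_phi.
- exact: cvgP cy.
near=> n; rewrite mulr_sumr; apply: ler_sum => j pj.
rewrite mulrA ler_wpM2r ?invr_ge0//.
have xE : x = x / y * y by rewrite divfK// gt_eqF.
rewrite [in leLHS]xE exprMn ler_wpM2r ?exprn_ge0 ?(ltW y0)//.
have xy0 : 0 <= x / y by rewrite divr_ge0// ltW.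
have xy1 : x / y <= 1 by rewrite ler_pdivrMr// mul1r.
rewrite -powR_mulrn// /k; move: xy0; rewrite le_eqVlt => /predU1P[xy0|xy0].
  by rewrite -xy0 powR0 ?powR_ge0// pnatr_eq0 -lt0n -(ltr_nat R); lra.
by apply: ger_powR => //; rewrite xy0.
Unshelve. all: by end_near. Qed.

Lemma exprn_le_expR t n : 0 <= t -> t ^+ n / n`!%:R <= expR t.
Proof.
case: n => [|n] t0.
  by rewrite expr0 fact0 divr1 (le_trans _ (expR_ge1Dx t))// lerDl.
by have := expR_ge1Dxn n t0; apply: le_trans; rewrite lerDr.
Qed.

(** The rate 1/2 is chosen for y = - ln r: it bounds a power of the logarithm by a multiple of 1 /
    sqrt r, which is integrable at 0. *)
Lemma powR_le_expR m : 0 <= m -> exists2 C : R, 0 < C & forall y, 0 <= y ->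
  y `^ m <= C * expR (y / 2).
Proof.
move=> m0; pose n := Num.Def.archi_bound m.
exists (2 ^+ n * n`!%:R * expR (1 / 2)).
  by rewrite !mulr_gt0 ?exprn_gt0 ?expR_gt0// ltr0n fact_gt0.
move=> y y0; have y1 : 0 <= (1 + y) / 2 by rewrite divr_ge0//; lra.
have nf : 0 < n`!%:R :> R by rewrite ltr0n fact_gt0.
apply: (@le_trans _ _ ((1 + y) `^ n%:R)).
  apply: (@le_trans _ _ ((1 + y) `^ m)).
    by apply: ge0_ler_powR; rewrite ?nnegrE//; lra.
  by apply: ler_powR; [lra|apply/ltW; exact: archi_boundP].
rewrite powR_mulrn; last by lra.
have := exprn_le_expR n y1; rewrite ler_pdivrMr// => h.
have -> : (1 + y) ^+ n = 2 ^+ n * ((1 + y) / 2) ^+ n.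
  by rewrite -exprMn; congr (_ ^+ _); field.
rewrite -!mulrA ler_pM2l ?exprn_gt0//; apply: (le_trans h).
by rewrite mulrC -expRD ler_pM2l// ler_expR; lra.
Qed.

(** Each removed term is 2^j (t / 2)^j / j!, hence at most 2^j exp(t / 2): the truncation is
    negligible for large t. *)
Lemma phi_ge_expR p : exists C : R, forall t, 0 <= t ->
  expR t - C * expR (t / 2) <= phi p t.
Proof.
exists (\sum_(0 <= j < sval (cid (phi_index p))) 2 ^+ j) => t t0.
rewrite phiE lerD2l lerN2 /phi_head mulr_suml; apply: ler_sum => j _.
have -> : t ^+ j / j`!%:R = 2 ^+ j * ((t / 2) ^+ j / j`!%:R).
  by rewrite mulrA -exprMn mulrCA mulfV// mulr1.
by rewrite ler_pM2l ?exprn_gt0// exprn_le_expR// divr_ge0.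
Qed.

End phi_theory.

(** * Positivity of omega *)

Section omega_gt0.
Context {R : realType}.
Implicit Types (a b s t theta : R).
Notation leb := (@lebesgue_measure R).

Lemma EFin_integral_le_exhaust (f : R -> R) (C : R) :
  measurable_fun (`]0, +oo[%classic : set R) f -> (forall x, 0 < x -> 0 <= f x) ->
  (forall a b, 0 < a -> a < b -> (\int[leb]_(x in `]a, b[) (f x)%:E <= C%:E)%E) ->
  (\int[leb]_(x in `]0%R, +oo[) (f x)%:E <= C%:E)%E.
Proof.
(* Starting at 2 keeps the inverse below 1, so that no interval is degenerate and [fC] applies to
   all of them. *)
move=> mf f0 fC; pose F n : set R := `]n.+2%:R^-1, n.+2%:R[%classic.
have FD n : F n `<=` `]0, +oo[.
  move=> x; rewrite /F /= !in_itv/= andbT => /andP[nx _].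
  by apply: lt_trans nx; rewrite invr_gt0.
have -> : `]0%R, +oo[%classic = \bigcup_n F n.
  apply/seteqP; split => [x/=|x [n _ /FD]//]; rewrite in_itv/= andbT => x0.
  exists (maxn (Num.Def.archi_bound x) (Num.Def.archi_bound x^-1)) => //.
  rewrite /F /= in_itv/=; apply/andP; split.
    rewrite -[ltRHS]invrK ltf_pV2 ?posrE ?invr_gt0//.
    apply: lt_le_trans (archi_boundP (_ : 0 <= x^-1)) _; first by rewrite invr_ge0 ltW.
    by rewrite ler_nat -addn2 (leq_trans (leq_maxr (Num.Def.archi_bound x) _))// leq_addr.
  apply: lt_le_trans (archi_boundP (ltW x0)) _.
  by rewrite ler_nat -addn2 (leq_trans (leq_maxl _ (Num.Def.archi_bound x^-1)))// leq_addr.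
have : (\int[leb]_(x in F i) (f x)%:E)%E @[i --> \oo] -->
    (\int[leb]_(x in \bigcup_i F i) (f x)%:E)%E.
  apply: ge0_nondecreasing_set_cvg_integral.
  - move=> n m nm; apply/subsetPset => x; rewrite /F /= !in_itv/= => /andP[nx xn].
    rewrite (le_lt_trans _ nx) ?(lt_le_trans xn) ?ler_nat ?ltnS//.
    by rewrite lef_pV2 ?posrE// ler_nat !ltnS.
  - by move=> n; exact: measurable_itv.
  - by move=> n; apply/measurable_EFinP; apply: measurable_funS mf => //; exact: FD.
  - by move=> n x /FD; rewrite /= in_itv/= andbT lee_fin; exact: f0.
move=> /[dup] /cvg_lim <-//; move=> /cvgP c.
apply: lime_le => //; near=> n; apply: fC; first by rewrite invr_gt0.
by rewrite (@lt_trans _ _ 1)// ?invf_lt1// ltr1n.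
Unshelve. all: by end_near. Qed.

Lemma is_derive_atan_sqrt t : 0 < t ->
  is_derive t 1 (fun x : R => atan (Num.sqrt x)) ((1 + t)^-1 * (2 * Num.sqrt t)^-1).
Proof.
move=> t0; have := is_derive1_comp (is_derive1_atan (Num.sqrt t)) (is_derive1_sqrt t0).
by rewrite sqr_sqrtr// ltW.
Qed.

(** The derivative of atan (sqrt t): of order t^(-1/2) at 0 and t^(-3/2) at infinity, with an
    explicit bounded primitive. It dominates both the Gamma integrand and the norms of the Moser
    functions. *)
Definition majorant t : R := (1 + t)^-1 * (2 * Num.sqrt t)^-1.

Lemma majorant_ge0 t : 0 < t -> 0 <= majorant t.
Proof. by move=> t0; rewrite mulr_ge0// invr_ge0// ?mulr_ge0// ?sqrtr_ge0//; lra. Qed.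

Lemma measurable_majorant : measurable_fun (`]0, +oo[%classic : set R) majorant.
Proof.
apply: (eq_measurable_fun (fun t => (1 + t) `^ (-1) * (2 * t `^ 2^-1) `^ (-1))).
  move=> t; rewrite inE/= in_itv/= andbT => t0.
  rewrite /majorant !powR_inv1 ?powR12_sqrt ?mulr_ge0 ?sqrtr_ge0 ?(ltW t0)//.
  by lra.
apply: measurable_funM.
  apply: (measurableT_comp (measurable_powR _)); exact: measurable_funD.
apply: (measurableT_comp (measurable_powR _)).
by apply: measurable_funM => //; exact: measurable_fun_powR.
Qed.

Lemma integral_majorant :
  (\int[leb]_(t in `]0%R, +oo[) (majorant t)%:E <= (pi : R)%:E)%E.
Proof.
apply: EFin_integral_le_exhaust; [exact: measurable_majorant|exact: majorant_ge0|].
move=> a b a0 ab.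
have sub : `]a, b[%classic `<=` (`]0, +oo[%classic : set R).
  by move=> x /=; rewrite !in_itv/= andbT => /andP[/(lt_trans a0)].
rewrite -(@integral_itv_bndoo _ _ _ _ true false); last first.
  by apply/measurable_EFinP; exact: measurable_funS measurable_majorant.
have pos x : x \in `[a, b] -> 0 < x.
  by rewrite in_itv/= => /andP[ax _]; exact: lt_le_trans ax.
have cF x : 0 < x -> {for x, continuous (fun x : R => atan (Num.sqrt x))}.
  move=> x0; apply: differentiable_continuous; apply/derivable1_diffP.
  by have [] := is_derive_atan_sqrt x0.
rewrite (@continuous_FTC2 _ _ (fun x : R => atan (Num.sqrt x)))//.
- rewrite -EFinB lee_fin; have := atan_ltpi2 (Num.sqrt b).
  by have := atan_gtNpi2 (Num.sqrt a); lra.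
- apply: continuous_in_subspaceT => x /set_mem/= /pos x0.
  rewrite /majorant; apply: (@continuousM _ _ (fun t => (1 + t)^-1) (fun t => (2 * Num.sqrt t)^-1)); apply: continuousV.
  + by rewrite gt_eqF//; lra.
  + by apply: continuousD => //; exact: cvg_cst.
  + by rewrite gt_eqF// mulr_gt0// sqrtr_gt0.
  + apply: continuousM; first exact: cvg_cst.
    exact: sqrt_continuous.
- split.
  + by move=> x /subset_itv_oo_cc/pos x0; have [] := is_derive_atan_sqrt x0.
  + exact/cvg_at_right_filter/cF.
  + by apply/cvg_at_left_filter/cF; exact: lt_trans ab.
- move=> x /subset_itv_oo_cc/pos x0; rewrite derive1E.
  by have [_ ->] := is_derive_atan_sqrt x0.
Qed.

Lemma powR_12_gt0 t : 0 < t -> t `^ 2^-1 = Num.sqrt t.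
Proof. by move=> t0; rewrite powR12_sqrt// ltW. Qed.

(** 1/2 is the argument of [Gamma] in [omega 0], the smallest that occurs; there the integrand has
    exactly the singularity of [majorant] at 0. *)
Lemma gamma_le_majorant s : 1 / 2 <= s -> exists2 C : R, 0 < C &
  forall t, 0 < t -> t `^ (s - 1) * expR (- t) <= C * majorant t.
Proof.
move=> s12; have s0 : 0 <= s + 1 / 2 by lra.
have [C C0 HC] := powR_le_expR s0; exists (2 * C * expR (1 / 2)).
  by rewrite !mulr_gt0 ?expR_gt0.
move=> t t0; have t1 : 0 < 1 + t by lra.
have q0 : 0 < t `^ 2^-1 by exact: powR_gt0.
rewrite /majorant -powR_12_gt0// -invfM ler_pdivlMr ?mulr_gt0//.
rewrite expRN mulrAC ler_pdivrMr ?expR_gt0//.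
have -> : t `^ (s - 1) * ((1 + t) * (2 * t `^ 2^-1)) =
    2 * (t `^ (s - 1 / 2) * (1 + t)).
  rewrite (_ : s - 1 / 2 = s - 1 + 2^-1); last by field.
  by rewrite (@powRD _ t (s - 1)) ?(gt_eqF t0) ?implybT//; ring.
rewrite -!mulrA ler_pM2l//.
apply: (@le_trans _ _ ((1 + t) `^ (s + 1 / 2))).
  rewrite (_ : s + 1 / 2 = s - 1 / 2 + 1); last by field.
  rewrite (@powRD _ (1 + t) (s - 1 / 2) 1) ?(gt_eqF t1) ?implybT// powRr1 ?(ltW t1)// ler_pM2r//.
  by apply: le_powR; lra.
apply: (le_trans (HC _ (ltW t1))); rewrite ler_pM2l// -expRD ler_expR; lra.
Qed.

Lemma Gamma_gt0 s : 1 / 2 <= s -> 0 < Gamma s.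
Proof.
move=> s12; rewrite /Gamma /Rintegral.
have mg : measurable_fun (`]0, +oo[%classic : set R) (fun t => t `^ (s - 1) * expR (- t)).
  apply: measurable_funM; first exact: measurable_fun_powR.
  by apply: measurableT_comp => //; exact: measurable_funN.
have g0 x : 0 <= x `^ (s - 1) * expR (- x) by rewrite mulr_ge0 ?powR_ge0 ?expR_ge0.
(* [Gamma] is a [fine], which sends [+oo] to 0; positivity therefore also requires the integral to
   be finite. *)
rewrite fine_gt0//; apply/andP; split.
  have m12 : measurable (`]1%R, 2%R[%classic : set (measurableTypeR R)).
    exact: measurable_itv.
  apply: (@lt_le_trans _ _ (\int[leb]_(t in `]1%R, 2%R[) (cst (expR (- 2) / 2) t)%:E)%E).
    rewrite [ltRHS](integral_cst leb m12 (expR (- 2) / 2)%:E).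
    have l12 : leb `]1%R, 2%R[%classic = 1%:E.
      by rewrite lebesgue_measure_itv/= lte_fin ltr1n -EFinB; congr EFin; lra.
    by rewrite [X in (_ * X)%E]l12 mule1 lte_fin divr_gt0// expR_gt0.
  apply: (@le_trans _ _ (\int[leb]_(t in `]1%R, 2%R[) (t `^ (s - 1) * expR (- t))%:E)%E).
    apply: EFin_le_integral => //.
    - by apply: measurable_funS mg => // x /=; rewrite !in_itv/= andbT => /andP[/(lt_trans ltr01)].
    - by move=> x _; rewrite divr_ge0 ?expR_ge0.
    - move=> x /=; rewrite in_itv/= => /andP[x1 x2].
      rewrite mulrC ler_pM ?expR_ge0 ?invr_ge0//; last by rewrite ler_expR; lra.
      apply: (@le_trans _ _ (x `^ (- 1))).
        by rewrite powR_inv1 ?lef_pV2 ?posrE//; lra.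
      by rewrite ler_powR//; lra.
  apply: EFin_integral_subset => //.
  by move=> x /=; rewrite !in_itv/= andbT => /andP[/(lt_trans ltr01)].
have [C C0 HC] := gamma_le_majorant s12.
apply: (@le_lt_trans _ _ (C * pi)%:E); last exact: ltry.
apply: (@le_trans _ _ (\int[leb]_(t in `]0%R, +oo[) (C * majorant t)%:E)%E).
  apply: EFin_le_integral => //.
    by apply: measurable_funM => //; exact: measurable_majorant.
  by move=> x /=; rewrite in_itv/= andbT; exact: HC.
rewrite EFin_integralZl ?(ltW C0)//; last 2 first.
- exact: measurable_majorant.
- by move=> x /=; rewrite in_itv/= andbT; exact: majorant_ge0.
by rewrite EFinM lee_wpmul2l ?integral_majorant// lee_fin ltW.
Qed.

Lemma omega_gt0 theta : 0 <= theta -> 0 < omega theta.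
Proof.
move=> th0; rewrite /omega divr_gt0 ?mulr_gt0 ?powR_gt0 ?pi_gt0//.
by apply: Gamma_gt0; lra.
Qed.

End omega_gt0.

(** * Scaling and norms *)

Section scaling.
Context {R : realType}.
Implicit Types (f : R -> \bar R) (u : R -> R) (c l theta p : R).
Notation leb := (@lebesgue_measure R).

(** Both sides are measures in [A] that agree on half-open intervals, and this determines the
    Lebesgue measure. *)
Lemma lebesgue_measure_scale l (l0 : 0 < l) (A : set R) : measurable A ->
  leb A = (l%:E * leb ((fun x => (l * x)%R) @^-1` A))%E.
Proof.
move=> mA.
have mphi : measurable_fun [set: measurableTypeR R]
    ((fun x => l * x) : measurableTypeR R -> measurableTypeR R).
  exact: measurable_funM.
pose phi : measurableTypeR R -> measurableTypeR R := fun x => l * x.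
unshelve epose (nu := (pushforward leb phi :
  {measure set (measurableTypeR R) -> \bar R})); first exact: mphi.
pose mu : {measure set (measurableTypeR R) -> \bar R} := mscale (NngNum (ltW l0)) nu.
apply: (@lebesgue_measure_unique R mu) => // X [[a b] _ <-].
rewrite /mu /= /mscale /= /pushforward.
have -> : (fun x : R => l * x) @^-1` `]a, b]%classic = `]a / l, b / l]%classic.
  apply/seteqP; split => x /=; rewrite !in_itv/=.
    by rewrite ltr_pdivrMr// ler_pdivlMr// mulrC.
  by rewrite ltr_pdivrMr// ler_pdivlMr// mulrC.
rewrite !lebesgue_measure_itv/= !lte_fin ltr_pM2r ?invr_gt0//.
case: ifP => ab; last by rewrite mule0.
by rewrite -!EFinB -EFinM; congr EFin; field; rewrite gt_eqF.
Qed.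

Lemma integral_scale l f : 0 < l ->
  measurable_fun (`]0, +oo[%classic : set R) f ->
  (forall x, 0 < x -> (0 <= f x)%E) ->
  (\int[leb]_(x in `]0%R, +oo[) f (l * x)%R =
   (l^-1)%:E * \int[leb]_(x in `]0%R, +oo[) f x)%E.
Proof.
move=> l0 mf f0.
have mphi : measurable_fun [set: measurableTypeR R]
    ((fun x => l * x) : measurableTypeR R -> measurableTypeR R).
  exact: measurable_funM.
have mP : measurable (`]0%R, +oo[%classic : set (measurableTypeR R)).
  exact: measurable_itv.
have f0P x : (`]0%R, +oo[%classic : set R) x -> (0 <= f x)%E.
  by rewrite /= in_itv/= andbT; exact: f0.
pose phi : measurableTypeR R -> measurableTypeR R := fun x => l * x.
unshelve epose (nu := (pushforward leb phi :
  {measure set (measurableTypeR R) -> \bar R})); first exact: mphi.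
pose mu : {measure set (measurableTypeR R) -> \bar R} := mscale (NngNum (ltW l0)) nu.
have -> : (\int[leb]_(x in `]0%R, +oo[) f x = \int[mu]_(x in `]0%R, +oo[) f x)%E.
  by apply: eq_measure_integral => A mA _; exact: lebesgue_measure_scale.
rewrite ge0_integral_mscale//= ge0_integral_pushforward//; last first.
  by move=> x /set_mem; exact: f0P.
rewrite muleA -EFinM mulVf ?gt_eqF// mul1e; congr (integral _ _ _).
apply/seteqP; split => x /=; rewrite !in_itv/= !andbT.
  by move=> x0; rewrite mulr_gt0.
by rewrite pmulr_rgt0.
Qed.

Lemma dnbhs0_scale l : 0 < l -> (fun h : R => l * h) @ 0^' = 0^' :> set_system R.
Proof.
have sub k : 0 < k -> forall A : set R, (0 : R)^' A -> ((fun h : R => k * h) @ 0^') A.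
  move=> k0 A /nbhs_ballP[e /= e0 eA]; apply/nbhs_ballP; exists (e / k) => /=.
    by rewrite divr_gt0.
  move=> h; rewrite /ball/= sub0r normrN => he h0.
  apply: eA; last exact: mulf_neq0 (lt0r_neq0 k0) h0.
  by rewrite /ball/= sub0r normrN normrM gtr0_norm// mulrC -ltr_pdivlMr.
move=> l0; apply/seteqP; split => A; last exact: sub.
move=> lA; have li : 0 < l^-1 by rewrite invr_gt0.
have := sub _ li _ lA; rewrite /fmap/= -comp_preimage.
by rewrite (_ : _ \o _ = id)//; apply/funext => h /=; rewrite mulrA divff ?gt_eqF// mul1r.
Qed.

(** Holds without convergence, because a divergent limit is the default value 0. Therefore
    [derive1_scale] is true at every point, differentiable or not, with no exceptional null set. *)
Lemma lim_scale (F : set_system R) (g : R -> R) c : ProperFilter F -> c != 0 ->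
  lim (c * g h @[h --> F]) = c * lim (g h @[h --> F]).
Proof.
move=> FF c0; have [cg|dg] := pselect (cvg (g h @[h --> F])).
  by apply/cvg_lim => //; exact: cvgMr.
have ncg : ~ cvg (c * g h @[h --> F]).
  move=> cg; apply: dg.
  have : cvg (c^-1 * (c * g h) @[h --> F]) by apply: is_cvgMr.
  by under eq_fun do rewrite mulrA mulVf// mul1r.
by rewrite (dvgP dg) (dvgP ncg) mulr0.
Qed.

Lemma derive1_scale u c l a : c != 0 -> 0 < l ->
  derive1 (fun x => c * u (l * x)) a = c * l * derive1 u (l * a).
Proof.
move=> c0 l0; have ln0 : l != 0 by rewrite gt_eqF.
rewrite /derive1 -lim_scale ?mulf_neq0//.
rewrite -[in RHS](dnbhs0_scale l0); congr (lim _); rewrite -fmap_comp.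
have -> : (fun h : R => h^-1 *: (c * u (l * (h + a)) - c * u (l * a))) =
    (fun h => c * l * (h^-1 *: (u (h + l * a) - u (l * a)))) \o (fun h => l * h).
  apply/funext => h /=; rewrite /GRing.scale/=.
  have [->|h0] := eqVneq h 0; first by rewrite mulr0 invr0 !mul0r mulr0.
  have aux (d : R) : h^-1 * (c * d) = c * l * (l^-1 / h * d).
    by field; rewrite h0 ln0.
  by rewrite (mulrDr l h a) invfM -mulrBr; exact: aux.
by [].
Qed.

End scaling.

(** * Norms and integrals under rescaling *)

Section norms.
Context {R : realType}.
Implicit Types (u F G : R -> R) (c l theta p sigma : R).
Notation leb := (@lebesgue_measure R).

Definition lp_int p theta u : \bar R :=
  int_lambda theta (fun r => (`|u r| `^ p)%:E).

Lemma int_lambdaE theta G : int_lambda theta (fun r => (G r)%:E) =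
  ((omega theta)%:E * \int[leb]_(r in `]0%R, +oo[) (G r * r `^ theta)%:E)%E.
Proof. by rewrite /int_lambda; under [in RHS]eq_integral do rewrite EFinM. Qed.

Lemma int_lambda_ge0 theta G : 0 <= theta -> (forall r, 0 < r -> 0 <= G r) ->
  (0 <= int_lambda theta (fun r => (G r)%:E))%E.
Proof.
move=> th0 G0; rewrite int_lambdaE mule_ge0//.
  by rewrite lee_fin ltW// omega_gt0.
apply: EFin_integral_ge0 => r; rewrite /= in_itv/= andbT => r0.
by rewrite mulr_ge0 ?powR_ge0 ?G0.
Qed.

Lemma int_lambdaZ theta G (k : R) : 0 <= theta -> 0 <= k ->
  measurable_fun (`]0, +oo[%classic : set R) G ->
  (forall r, 0 < r -> 0 <= G r) ->
  (int_lambda theta (fun r => (k * G r)%:E) =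
   k%:E * int_lambda theta (fun r => (G r)%:E))%E.
Proof.
move=> th0 k0 mG G0; rewrite !int_lambdaE muleCA; congr (_ * _)%E.
under eq_integral do rewrite -mulrA.
apply: EFin_integralZl => //.
- by apply: measurable_funM => //; exact: measurable_fun_powR.
- move=> r; rewrite /= in_itv/= andbT => r0.
  by rewrite mulr_ge0 ?powR_ge0 ?G0.
Qed.

Lemma int_lambda_scale theta G l : 0 <= theta -> 0 < l ->
  measurable_fun (`]0, +oo[%classic : set R) G ->
  (forall r, 0 < r -> 0 <= G r) ->
  (int_lambda theta (fun r => (G (l * r))%:E) =
   (l `^ (- (theta + 1)))%:E * int_lambda theta (fun r => (G r)%:E))%E.
Proof.
move=> th0 l0 mG G0; rewrite !int_lambdaE [RHS]muleCA; congr (_ * _)%E.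
pose F (r : R) := ((G r * r `^ theta)%:E : \bar R).
rewrite [X in (_ = _ * X)%E](_ : _ = \int[leb]_(r in `]0%R, +oo[) F r)%E//.
have mF : measurable_fun (`]0, +oo[%classic : set R) F.
  apply/measurable_EFinP; apply: measurable_funM => //.
  exact: measurable_fun_powR.
have F0 x : 0 < x -> (0 <= F x)%E.
  by move=> x0; rewrite lee_fin mulr_ge0 ?powR_ge0 ?G0.
have -> : ((l `^ (- (theta + 1)))%:E = (l `^ (- theta))%:E * (l^-1)%:E)%E.
  rewrite -EFinM opprD powRD ?(gt_eqF l0) ?implybT//.
  by rewrite powR_inv1// ltW.
rewrite -muleA -integral_scale// -ge0_integralZl_EFin ?powR_ge0//; last 2 first.
- move=> x; rewrite /= in_itv/= andbT => x0.
  by apply: F0; rewrite mulr_gt0.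
- apply: (measurable_comp _ _ mF) => //.
    move=> _ [x /= xD <-]; move: xD; rewrite !in_itv/= !andbT => x0.
    by rewrite mulr_gt0.
apply: eq_integral => x; rewrite inE/= in_itv/= andbT => x0.
rewrite /F -EFinM powRM ?(ltW l0) ?(ltW x0)//; congr EFin.
have : l `^ (- theta) * l `^ theta = 1.
  by rewrite -powRD ?(gt_eqF l0) ?implybT// addNr powRr0.
by move=> E; rewrite -[LHS]mul1r -E; ring.
Qed.

Lemma Lq_norm_powR p theta u : p != 0 -> 0 <= theta ->
  (Lq_norm p theta u `^ p)%E = lp_int p theta u.
Proof.
move=> p0 th0; rewrite /Lq_norm -poweRrM mulVf// poweRe1//.
by apply: int_lambda_ge0 => // r _; exact: powR_ge0.
Qed.

Lemma lp_int_ge0 p theta u : 0 <= theta -> (0 <= lp_int p theta u)%E.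
Proof. by move=> th0; apply: int_lambda_ge0 => // r _; exact: powR_ge0. Qed.

Lemma LqP p theta u : p != 0 -> 0 <= theta -> Lq p theta u <->
  measurable_fun (`]0, +oo[%classic : set R) u /\ (lp_int p theta u < +oo)%E.
Proof.
move=> p0 th0; rewrite /Lq /Lq_norm /=; split => -[mu h]; split => //.
  by apply: lty_poweRy h; rewrite invr_neq0.
exact: poweR_lty.
Qed.

Lemma poweR_le1 (x : \bar R) p : 0 < p -> (0 <= x)%E -> (x `^ p <= 1)%E = (x <= 1)%E.
Proof.
move=> p0; case: x => [x| |]//; last by rewrite poweRyr// gt_eqF.
rewrite poweR_EFin !lee_fin => x0.
have p1 : 1 `^ p = 1 :> R by rewrite powR1.
apply/idP/idP => [|x1].
  apply: contraTT; rewrite -!ltNge => x1.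
  by rewrite -[ltLHS]p1 gt0_ltr_powR// nnegrE.
by rewrite -[leRHS]p1; apply: le_powR => //; exact: ltW.
Qed.

Lemma X1p_norm_le1 p alpha theta u : 0 < p -> 0 <= theta -> 0 <= alpha ->
  (X1p_norm p alpha theta u <= 1)%E =
  (lp_int p theta u + lp_int p alpha (derive1 u) <= 1)%E.
Proof.
move=> p0 th0 al0; have pn0 : p != 0 by rewrite gt_eqF.
have -> : X1p_norm p alpha theta u =
    ((lp_int p theta u + lp_int p alpha (derive1 u)) `^ p^-1)%E.
  by congr ((_ + _) `^ _)%E; exact: Lq_norm_powR.
apply: poweR_le1; first by rewrite invr_gt0.
by apply: adde_ge0; exact: lp_int_ge0.
Qed.

Lemma Lq_norm_le1 p theta u : 0 < p -> 0 <= theta ->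
  (Lq_norm p theta u <= 1)%E = (lp_int p theta u <= 1)%E.
Proof.
by move=> p0 th0; rewrite /Lq_norm poweR_le1 ?invr_gt0// lp_int_ge0.
Qed.

Lemma lp_int_scale p theta u c l : 0 < c -> 0 < l -> 0 <= theta ->
  measurable_fun (`]0, +oo[%classic : set R) u ->
  lp_int p theta (fun r => c * u (l * r)) =
  ((c `^ p * l `^ (- (theta + 1)))%:E * lp_int p theta u)%E.
Proof.
move=> c0 l0 th0 mu; rewrite /lp_int.
have mP : measurable_fun (`]0, +oo[%classic : set R) (fun r => `|u r| `^ p).
  exact: measurable_fun_norm_powR.
have P0 (v : R -> R) r : 0 < r -> 0 <= `|v r| `^ p by move=> _; exact: powR_ge0.
rewrite EFinM -muleA -(int_lambda_scale th0 l0 mP (P0 u)).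
have mPl : measurable_fun (`]0, +oo[%classic : set R) (fun r => `|u (l * r)| `^ p).
  apply: (measurable_comp _ _ mP) => //.
  move=> _ [x /= xD <-]; move: xD; rewrite !in_itv/= !andbT => x0.
  by rewrite mulr_gt0.
rewrite -(int_lambdaZ th0 (powR_ge0 c p) mPl (P0 (fun r => u (l * r)))).
congr int_lambda; apply/funext => r.
by rewrite normrM (gtr0_norm c0) (powRM _ (ltW c0) (normr_ge0 _)).
Qed.

(** The chain rule contributes l^p and the weight r^(p - 1) dr contributes l^(- p): dilations leave
    the energy unchanged, so [c] and [l] can adjust the energy and the norm independently. *)
Lemma lp_int_derive_scale p u c l : 1 <= p -> 0 < c -> 0 < l ->
  measurable_fun (`]0, +oo[%classic : set R) (derive1 u) ->
  lp_int p (p - 1) (derive1 (fun r => c * u (l * r))) =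
  ((c `^ p)%:E * lp_int p (p - 1) (derive1 u))%E.
Proof.
move=> p1 c0 l0 mu.
have -> : derive1 (fun r => c * u (l * r)) = fun r => (c * l) * derive1 u (l * r).
  by apply/funext => r; rewrite derive1_scale// gt_eqF.
rewrite lp_int_scale ?mulr_gt0 ?subr_ge0// powRM ?(ltW c0) ?(ltW l0)//.
by rewrite subrK -mulrA -powRD ?(gt_eqF l0) ?implybT// subrr powRr0 mulr1.
Qed.

Lemma locally_ac_scale u c l : 0 < c -> 0 < l ->
  locally_absolutely_continuous u ->
  locally_absolutely_continuous (fun r => c * u (l * r)).
Proof.
move=> c0 l0 uac a b a0 ab e e0.
have la0 : 0 < l * a by rewrite mulr_gt0.
have lab : l * a < l * b by rewrite ltr_pM2l.
have ec0 : 0 < e / c by rewrite divr_gt0.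
have [d d0 ud] := uac _ _ la0 lab _ ec0.
exists (d / l); first by rewrite divr_gt0.
move=> n x y xy txy sxy.
have -> : \sum_(i < n) `|c * u (l * y i) - c * u (l * x i)| =
    c * \sum_(i < n) `|u (l * y i) - u (l * x i)|.
  rewrite mulr_sumr; apply: eq_bigr => i _.
  by rewrite -mulrBr normrM gtr0_norm.
rewrite mulrC -ltr_pdivlMr//; apply: ud.
- by move=> i; have [? [? ?]] := xy i; rewrite !ler_pM2l.
- move=> i j _ _ [z /= []]; rewrite !in_itv/= => iz jz.
  apply: (txy i j) => //; exists (z / l); split; rewrite /= in_itv/=.
    by rewrite ltr_pdivlMr// ltr_pdivrMr// ![_ * l]mulrC.
  by rewrite ltr_pdivlMr// ltr_pdivrMr// ![_ * l]mulrC.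
- under eq_bigr do rewrite -mulrBr.
  by rewrite -mulr_sumr mulrC -ltr_pdivlMr.
Qed.

Lemma X1p_scale p theta u c l : 2 <= p -> 0 <= theta -> 0 < c -> 0 < l ->
  X1p p (p - 1) theta u -> X1p p (p - 1) theta (fun r => c * u (l * r)).
Proof.
move=> p2 th0 c0 l0; have p0 : 0 < p by lra.
have pn0 : p != 0 by rewrite gt_eqF.
have al0 : 0 <= p - 1 by lra.
have sub : (fun r : R => l * r) @` `]0, +oo[%classic `<=` `]0, +oo[%classic.
  move=> _ [x /= xD <-]; move: xD; rewrite !in_itv/= !andbT => x0.
  by rewrite mulr_gt0.
have mscale G : measurable_fun (`]0, +oo[%classic : set R) G ->
    measurable_fun (`]0, +oo[%classic : set R) (fun r => G (l * r)).
  by move=> mG; apply: (measurable_comp _ sub mG) => //; exact: measurable_funM.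
move=> [uac ulim /(LqP _ pn0 th0)[mu Au] /(LqP _ pn0 al0)[mdu Bu]]; split.
- exact: locally_ac_scale.
- rewrite -(mulr0 c); apply: cvgMr.
  apply: (cvg_comp _ _ _ ulim).
  apply/cvgryPgt => A; near=> r.
  by rewrite mulrC -ltr_pdivrMr//; near: r; apply: nbhs_pinfty_gt; rewrite num_real.
- apply/(LqP _ pn0 th0); split.
    by apply: measurable_funM => //; exact: mscale.
  rewrite lp_int_scale// -ge0_fin_numE; last first.
    by rewrite mule_ge0 ?lp_int_ge0// lee_fin mulr_ge0 ?powR_ge0.
  by apply: fin_numM => //; rewrite ge0_fin_numE; [exact: Au|exact: lp_int_ge0].
- apply/(LqP _ pn0 al0); split.
    have -> : derive1 (fun r => c * u (l * r)) = fun r => (c * l) * derive1 u (l * r).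
      by apply/funext => r; rewrite derive1_scale// gt_eqF.
    by apply: measurable_funM => //; exact: mscale.
  rewrite lp_int_derive_scale//; last by lra.
  rewrite -ge0_fin_numE; last first.
    by rewrite mule_ge0 ?lp_int_ge0// lee_fin powR_ge0.
  by apply: fin_numM => //; rewrite ge0_fin_numE; [exact: Bu|exact: lp_int_ge0].
Unshelve. all: by end_near. Qed.

Lemma measurable_phi_comp p sigma u :
  measurable_fun (`]0, +oo[%classic : set R) u ->
  measurable_fun (`]0, +oo[%classic : set R)
    (fun r => phi p (sigma * `|u r| `^ (p / (p - 1)))).
Proof.
move=> mu; apply: measurableT_comp; first exact: measurable_phi.
by apply: measurable_funM => //; exact: measurable_fun_norm_powR.
Qed.

Lemma TM_integral_scale p sigma theta u c l : 0 <= sigma -> 0 <= theta ->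
  0 < c -> 0 < l -> measurable_fun (`]0, +oo[%classic : set R) u ->
  TM_integral p sigma theta (fun r => c * u (l * r)) =
  ((l `^ (- (theta + 1)))%:E *
   TM_integral p (sigma * c `^ (p / (p - 1))) theta u)%E.
Proof.
move=> s0 th0 c0 l0 mu; rewrite /TM_integral.
have mP := measurable_phi_comp p (sigma * c `^ (p / (p - 1))) mu.
rewrite -(int_lambda_scale th0 l0 mP); last first.
  by move=> r _; rewrite phi_ge0// !mulr_ge0 ?powR_ge0.
congr int_lambda; apply/funext => r.
by rewrite normrM (gtr0_norm c0) (powRM _ (ltW c0) (normr_ge0 _)) mulrA.
Qed.

Lemma TM_integral_ge0 p sigma theta u : 0 <= sigma -> 0 <= theta ->
  (0 <= TM_integral p sigma theta u)%E.
Proof.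
move=> s0 th0; apply: int_lambda_ge0 => // r _.
by rewrite phi_ge0// mulr_ge0 ?powR_ge0.
Qed.

End norms.

(** * The critical exponent *)

#[local] Opaque omega.

(** * Pointwise estimates for one function of the space *)

Section pointwise.
Context {R : realType}.
Variables (p theta : R) (u : R -> R).
Hypotheses (p2 : 2 <= p) (th0 : 0 <= theta) (Xu : X1p p (p - 1) theta u).
Notation leb := (@lebesgue_measure R).

Let p0 : 0 < p. Proof. by have p2' := p2; lra. Qed.
Let pn0 : p != 0. Proof. by rewrite gt_eqF. Qed.
Let al0 : 0 <= p - 1. Proof. by have p2' := p2; lra. Qed.
Let mu : measurable_fun (`]0, +oo[%classic : set R) u.
Proof. by have [_ _ /(LqP _ pn0 th0)[]] := Xu. Qed.
Let mdu : measurable_fun (`]0, +oo[%classic : set R) (derive1 u).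
Proof. by have [_ _ _ /(LqP _ pn0 al0)[]] := Xu. Qed.
Let A := lp_int p theta u.
Let B := lp_int p (p - 1) (derive1 u).
Let oa : 0 < omega (p - 1) :> R. Proof. exact: omega_gt0. Qed.
Let ot : 0 < omega theta :> R. Proof. exact: omega_gt0. Qed.

Lemma lp_int_fin : A \is a fin_num.
Proof. by have [_ _ /(LqP _ pn0 th0)[_]] := Xu; rewrite ge0_fin_numE ?lp_int_ge0. Qed.

Lemma lp_int_derive_fin : B \is a fin_num.
Proof. by have [_ _ _ /(LqP _ pn0 al0)[_]] := Xu; rewrite ge0_fin_numE ?lp_int_ge0. Qed.

Let itv_sub a b : 0 <= a -> `]a, b[%classic `<=` (`]0, +oo[%classic : set R).
Proof. by move=> a0 x /=; rewrite !in_itv/= andbT => /andP[/(le_lt_trans a0)]. Qed.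

Let density r := `|derive1 u r| `^ p * r `^ (p - 1).

Let mdensity : measurable_fun (`]0, +oo[%classic : set R) density.
Proof.
apply: measurable_funM; last exact: measurable_fun_powR.
exact: measurable_fun_norm_powR.
Qed.

Let density_ge0 r : 0 <= density r. Proof. by rewrite mulr_ge0 ?powR_ge0. Qed.

Definition energy a b : R := fine (\int[leb]_(r in `]a, b[) (density r)%:E)%E.

Let energy_le_total a b : 0 <= a ->
  ((omega (p - 1))%:E * \int[leb]_(r in `]a, b[) (density r)%:E <= B)%E.
Proof.
move=> a0; rewrite /B /lp_int int_lambdaE; apply: lee_wpmul2l.
  rewrite lee_fin; exact: ltW oa.
by apply: EFin_integral_subset => //; exact: itv_sub.
Qed.

Let energy_fin a b : 0 <= a ->
  (\int[leb]_(r in `]a, b[) (density r)%:E)%E \is a fin_num.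
Proof.
move=> a0; have E0 : (0 <= \int[leb]_(r in `]a, b[) (density r)%:E)%E.
  by apply: EFin_integral_ge0.
rewrite ge0_fin_numE//; have := energy_le_total b a0.
case: (\int[leb]_(r in _) _)%E E0 => [r _ _|_|//]; first exact: ltry.
rewrite gt0_muley; last by rewrite lte_fin; exact: oa.
move=> h.
by have := lp_int_derive_fin; rewrite ge0_fin_numE ?lp_int_ge0// ltNge h.
Qed.

Lemma energy_ge0 a b : 0 <= energy a b.
Proof. by apply/fine_ge0/EFin_integral_ge0. Qed.

Lemma omega_energy_le a b : 0 <= a -> omega (p - 1) * energy a b <= fine B.
Proof.
move=> a0; rewrite -lee_fin EFinM !fineK ?energy_fin ?lp_int_derive_fin//.
exact: energy_le_total.
Qed.

Lemma energyD a b c : 0 <= a -> a <= b -> b <= c ->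
  energy a b + energy b c <= energy a c.
Proof.
move=> a0 ab bc; have b0 := le_trans a0 ab.
rewrite -lee_fin EFinD !fineK ?energy_fin//.
have mo x y : measurable (`]x, y[%classic : set (measurableTypeR R)).
  exact: measurable_itv.
have sub : `]a, b[%classic `|` `]b, c[%classic `<=` (`]a, c[%classic : set R).
  move=> x [] /=; rewrite !in_itv/= => /andP[ax xb].
    by rewrite ax (lt_le_trans xb).
  by rewrite xb (le_lt_trans ab).
rewrite -ge0_integral_setU//.
- apply: EFin_integral_subset => //; first exact: measurableU.
  by apply: measurable_funS mdensity => //; exact: itv_sub.
- apply/measurable_EFinP; apply: measurable_funS mdensity => //.
  by apply: subset_trans sub _; exact: itv_sub.
- by move=> z _; rewrite lee_fin.
- apply/disj_setPS => x [] /=; rewrite !in_itv/= => /andP[_ xb] /andP[bx _].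
  by have := lt_trans xb bx; rewrite ltxx.
Qed.

Lemma energyxx a : energy a a = 0.
Proof. by rewrite /energy set_itvoo0 integral_set0. Qed.

Lemma oscillation a b : 0 < a -> a <= b ->
  `|u b - u a| `^ p <= energy a b * (ln b - ln a) `^ (p - 1).
Proof.
move=> a0; rewrite le_eqVlt => /predU1P[<-|ab].
  by rewrite subrr normr0 powR0// mulr_ge0 ?energy_ge0 ?powR_ge0.
have [uac _ _ _] := Xu.
have p1 : 1 < p by have p2' := p2; lra.
rewrite -lee_fin EFinM fineK; last by apply: energy_fin; exact: ltW.
apply: energy_ineq => //.
  by apply: absolutely_continuous_on_seq; exact: uac.
by apply: measurable_funS mdu => //; apply: itv_sub; exact: ltW.
Qed.

Section nonzero.
Variable x : R.
Hypotheses (x0 : 0 < x) (ux : u x != 0).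

(** With zero energy [u] would keep the value [u x] on [[x, +oo[], against its limit 0 at
    infinity. *)
Lemma lp_int_derive_gt0 : 0 < fine B.
Proof.
rewrite lt_neqAle fine_ge0 ?lp_int_ge0// andbT eq_sym; apply/negP => /eqP B0.
have cst y : x <= y -> u y = u x.
  move=> xy; have := oscillation x0 xy.
  have := omega_energy_le y (ltW x0); rewrite B0 (pmulr_rle0 _ oa) => E0.
  have -> : energy x y = 0 by apply/eqP; rewrite eq_le E0 energy_ge0.
  rewrite mul0r => h.
  have : `|u y - u x| `^ p == 0 by rewrite eq_le h powR_ge0.
  by rewrite powR_eq0 normr_eq0 subr_eq0 => /andP[/eqP].
have [_ ulim _ _] := Xu.
have : u r @[r --> +oo] --> u x.
  apply/cvgrPdist_lt => e e0; near=> y.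
  have xy : x <= y by near: y; apply: nbhs_pinfty_ge; exact: num_real.
  by rewrite (cst y xy) subrr normr0.
move=> /(cvg_unique _ ulim) h.
by have /eqP := ux; apply; rewrite h.
Unshelve. all: by end_near. Qed.

(** By continuity |u| stays above |u x| / 2 on an interval to the right of [x]. *)
Lemma lp_int_gt0 : 0 < fine A.
Proof.
have [uac _ _ _] := Xu.
have x1 : x < x + 1 by rewrite ltrDl.
have ac := absolutely_continuous_on_seq (uac _ _ x0 x1).
have e0 : 0 < `|u x| / 2 by rewrite divr_gt0// normr_gt0.
have [d d0 ud] := ac_seq_dist ac e0.
pose y := x + Num.min d 1 / 2.
have md : 0 < Num.min d 1 by rewrite lt_min d0 ltr01.
have xy : x < y by rewrite ltrDl divr_gt0.
have low z : x < z -> z < y -> (`|u x| / 2) `^ p * x `^ theta <= `|u z| `^ p * z `^ theta.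
  move=> xz zy; apply: ler_pM; rewrite ?powR_ge0//.
    apply: le_powR; [exact: ltW|exact: ltW|].
    have := ud x z (lexx _) (ltW xz).
    have h1 : z <= x + 1.
      apply/ltW/(lt_trans zy); rewrite ltrD2l; have : Num.min d 1 <= 1 by rewrite ge_min lexx orbT.
      by lra.
    have h2 : z - x < d.
      have : Num.min d 1 <= d by rewrite ge_min lexx.
      by move: zy md; rewrite /y; lra.
    move=> /(_ h1 h2); have := ler_distD (u z) (u x) 0; rewrite !subr0 distrC.
    by lra.
  by apply: le_powR => //; exact: ltW.
pose k := (`|u x| / 2) `^ p * x `^ theta.
have k0 : 0 < k by rewrite mulr_gt0 ?powR_gt0.
rewrite fine_gt0//; apply/andP; split; last first.
  by have := lp_int_fin; rewrite ge0_fin_numE ?lp_int_ge0.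
rewrite /A /lp_int int_lambdaE mule_gt0 ?lte_fin//.
have mo : measurable (`]x, y[%classic : set (measurableTypeR R)).
  exact: measurable_itv.
have mI : measurable_fun (`]0, +oo[%classic : set R) (fun r => `|u r| `^ p * r `^ theta).
  apply: measurable_funM; last exact: measurable_fun_powR.
  exact: measurable_fun_norm_powR.
apply: (@lt_le_trans _ _ (\int[leb]_(t in `]x, y[) (cst k t)%:E)%E).
  rewrite [ltRHS](integral_cst leb mo k%:E).
  have lxy : leb `]x, y[%classic = (y - x)%:E.
    by rewrite lebesgue_measure_itv/= lte_fin xy EFinB.
  by rewrite [X in (_ * X)%E]lxy mule_gt0 ?lte_fin// subr_gt0.
apply: (@le_trans _ _ (\int[leb]_(t in `]x, y[) (`|u t| `^ p * t `^ theta)%:E)%E).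
  apply: EFin_le_integral => //.
  - by apply: measurable_funS mI => //; apply: itv_sub; exact: ltW.
  - by move=> z _; exact: ltW.
  - by move=> z; rewrite /= in_itv/= => /andP[]; exact: low.
apply: EFin_integral_subset => //.
- by move=> z _; rewrite mulr_ge0 ?powR_ge0.
- by apply: itv_sub; exact: ltW.
Qed.

End nonzero.

(** Chebyshev's argument: were |u|^p above the bound on all of []r, 2 * r[], that interval alone
    would contribute [2 * fine A] to the norm. *)
Lemma small_value r : 0 < r -> 0 < fine A -> exists r1, [/\ r < r1, r1 < 2 * r &
  `|u r1| `^ p <= 2 * fine A / (omega theta * r `^ (theta + 1))].
Proof.
move=> r0 A0; apply: contrapT => no.
pose k := 2 * fine A / (omega theta * r `^ (theta + 1)).
have rt0 : 0 < r `^ (theta + 1) by exact: powR_gt0.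
have k0 : 0 < k by apply: divr_gt0; apply: mulr_gt0.
have low z : r < z -> z < 2 * r -> k * r `^ theta <= `|u z| `^ p * z `^ theta.
  move=> rz zr; apply: ler_pM; rewrite ?powR_ge0 ?(ltW k0)//.
    by rewrite leNgt; apply/negP => h; apply: no; exists z; split => //; exact: ltW.
  by apply: le_powR => //; exact: ltW.
have r2 : r < 2 * r by lra.
have mo : measurable (`]r, 2 * r[%classic : set (measurableTypeR R)).
  exact: measurable_itv.
have mI : measurable_fun (`]0, +oo[%classic : set R) (fun r => `|u r| `^ p * r `^ theta).
  apply: measurable_funM; last exact: measurable_fun_powR.
  exact: measurable_fun_norm_powR.
have : ((2 * fine A)%:E <= A)%E.
  rewrite [leRHS]int_lambdaE.
  have -> : 2 * fine A = omega theta * (k * r `^ theta * r).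
    have rE : r `^ (theta + 1) = r `^ theta * r.
      by rewrite powRD ?(gt_eqF r0) ?implybT// powRr1// ltW.
    have rn0 : r `^ theta != 0 by rewrite gt_eqF// powR_gt0.
    rewrite /k rE; field.
    by rewrite rn0 (gt_eqF r0) (gt_eqF ot).
  rewrite EFinM; apply: lee_wpmul2l; first by rewrite lee_fin (ltW ot).
  apply: (@le_trans _ _ (\int[leb]_(t in `]r, (2 * r)%R[) (cst (k * r `^ theta) t)%:E)%E).
    rewrite [leRHS](integral_cst leb mo (k * r `^ theta)%:E).
    have lr : leb `]r, 2 * r[%classic = r%:E.
      by rewrite lebesgue_measure_itv/= lte_fin r2 -EFinB; congr EFin; lra.
    by rewrite [X in (_ * X)%E]lr.
  apply: (@le_trans _ _ (\int[leb]_(t in `]r, (2 * r)%R[) (`|u t| `^ p * t `^ theta)%:E)%E).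
    apply: EFin_le_integral => //.
    - by apply: measurable_funS mI => //; apply: itv_sub; exact: ltW.
    - by move=> z _; rewrite mulr_ge0 ?powR_ge0 ?(ltW k0).
    - by move=> z; rewrite /= in_itv/= => /andP[]; exact: low.
  apply: EFin_integral_subset => //.
  - by move=> z _; rewrite mulr_ge0 ?powR_ge0.
  - by apply: itv_sub; exact: ltW.
rewrite -[leRHS]fineK ?lp_int_fin// lee_fin; lra.
Qed.

End pointwise.

Lemma fineD_le {R : realType} (x y : \bar R) (z : R) :
  x \is a fin_num -> y \is a fin_num ->
  (x + y <= z%:E)%E -> fine x + fine y <= z.
Proof. by case: x => // x; case: y. Qed.

(** * Finiteness up to the critical constant *)

Section critical.
Context {R : realType}.
Variables (p theta : R).
Hypotheses (p2 : 2 <= p) (th0 : 0 <= theta).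
Notation leb := (@lebesgue_measure R).
Let q := p / (p - 1).
Let k := theta + 1.
Let mu := mu_crit (p - 1) theta.
Let oa := omega (p - 1) : R.
Let ot := omega theta : R.
Let K := 2 `^ p * (p - 1).

(* [C1]: exponential factor of the additive constant; [C2]: the Moser integral;
   [U]: uniform bound of [u] on [1, +oo[. *)
Let C1 := mu * (2 / ot) `^ (q - 1).
Let C2 := 2 `^ k * ((8 + 10 * K) / k * (2 / (1 - expR (- 2^-1)))).
Let U := (2 / ot) `^ p^-1 + (1 / oa) `^ p^-1.
Let C3 := phi p (mu * U `^ q) / U `^ p.

Section bound.
Variables (sigma : R) (u : R -> R).
Hypotheses (s0 : 0 <= sigma) (smu : sigma <= mu) (Xu : X1p p (p - 1) theta u).
Variable x : R.
Hypotheses (x0 : 0 < x) (ux : u x != 0).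
Let A := fine (lp_int p theta u).
Let B := fine (lp_int p (p - 1) (derive1 u)).
Hypothesis AB : A + B <= 1.

Let p0 : 0 < p. Proof. by have p2' := p2; lra. Qed.
Let p10 : 0 < p - 1. Proof. by have p2' := p2; lra. Qed.
Let pn0 : p != 0. Proof. by rewrite gt_eqF. Qed.
Let pn1 : p - 1 != 0. Proof. by rewrite gt_eqF. Qed.
Let q1 : 1 < q. Proof. by rewrite /q ltr_pdivlMr//; have p2' := p2; lra. Qed.
Let q0 : 0 < q. Proof. exact: lt_trans q1. Qed.
Let k1 : 1 <= k. Proof. by rewrite /k lerDr. Qed.
Let k0 : 0 < k. Proof. exact: lt_le_trans k1. Qed.
Let oa0 : 0 < oa. Proof. by apply: omega_gt0; exact: ltW. Qed.
Let ot0 : 0 < ot. Proof. exact: omega_gt0. Qed.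
Let mu0 : 0 < mu. Proof. apply: mulr_gt0; [exact: k0|apply: powR_gt0; exact: oa0]. Qed.
Let A0 : 0 < A. Proof. exact: (lp_int_gt0 p2 th0 Xu x0 ux). Qed.
Let B0 : 0 < B. Proof. exact: (lp_int_derive_gt0 p2 Xu x0 ux). Qed.
Let A1 : A < 1. Proof. by have := AB; have := B0; lra. Qed.

Let measu : measurable_fun (`]0, +oo[%classic : set R) u.
Proof. by have [_ _ /(LqP _ pn0 th0)[]] := Xu. Qed.

(** The origin of the critical constant: k^(p - 1) compensates the change of variable t = k (ln r0 -
    ln r), and [oa] is the factor in front of the energy integral. *)
Let muE : mu `^ (p - 1) = k `^ (p - 1) * oa.
Proof.
rewrite /mu /mu_crit powRM ?powR_ge0//; last exact: ltW k0.
by rewrite (powRVK pn1 (ltW oa0)).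
Qed.

Section inner.
Variable r0 : R.
Hypotheses (r01 : 1 < r0) (r02 : r0 < 2) (ur0 : `|u r0| `^ p <= 2 * A / ot).

Let r00 : 0 < r0. Proof. exact: lt_trans r01. Qed.
(** Makes |V r|^q equal to [mu] times the first term of the convex split of |u r|^q. Correspondingly
    [M] is the energy divided by 1 - A, at most 1 because A + B <= 1. *)
Let kappa := (mu * (1 - A) `^ (1 - q)) `^ q^-1.
Let V r := kappa * (u r - u r0).
Let rt t := r0 * expR (- (t / k)).
Let w t := V (rt t).
Let M t := oa * energy p u (rt t) r0 / (1 - A).

Let rt_gt0 t : 0 < rt t. Proof. by rewrite mulr_gt0 ?expR_gt0. Qed.

Let rt_le s t : s <= t -> rt t <= rt s.
Proof.
by move=> st; rewrite ler_pM2l// ler_expR lerN2 ler_pM2r ?invr_gt0.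
Qed.

Let rt0 : rt 0 = r0. Proof. by rewrite /rt mul0r oppr0 expR0 mulr1. Qed.

Let ln_rt t : ln (rt t) = ln r0 - t / k.
Proof. by rewrite lnM ?posrE ?expR_gt0// expRK. Qed.

Let kappaE : kappa `^ p = k `^ (p - 1) * oa / (1 - A).
Proof.
have A1' : 0 < 1 - A by rewrite subr_gt0.
rewrite /kappa -powRrM; have -> : q^-1 * p = p - 1.
  by rewrite /q; field; rewrite pn0 pn1.
rewrite powRM ?powR_ge0 ?(ltW mu0)// muE -powRrM.
have -> : (1 - q) * (p - 1) = - 1 by rewrite /q; field.
by rewrite powR_inv1// ltW.
Qed.

Let w_energy s t : 0 <= s -> s <= t ->
  `|w t - w s| `^ p <= (M t - M s) * (t - s) `^ (p - 1).
Proof.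
move=> s_ge0 st; have A1' : 0 < 1 - A by rewrite subr_gt0.
rewrite /w /V -mulrBr opprB addrA subrK normrM powRM//.
rewrite ger0_norm ?powR_ge0// kappaE distrC.
have osc := oscillation p2 Xu (rt_gt0 t) (rt_le st).
have lnE : ln (rt s) - ln (rt t) = (t - s) / k by rewrite !ln_rt; field; rewrite gt_eqF.
rewrite lnE in osc.
have eD : energy p u (rt t) (rt s) <= energy p u (rt t) r0 - energy p u (rt s) r0.
  rewrite lerBrDr; apply: (energyD p2 Xu) (rt_le st) _; first exact: ltW.
  by rewrite -[leRHS]rt0; exact: rt_le.
have kp : k `^ (p - 1) != 0 by rewrite gt_eqF// powR_gt0.
have -> : (M t - M s) * (t - s) `^ (p - 1) = k `^ (p - 1) * oa / (1 - A) *
    ((energy p u (rt t) r0 - energy p u (rt s) r0) * ((t - s) / k) `^ (p - 1)).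
  rewrite powRM ?subr_ge0 ?invr_ge0 ?(ltW k0)//.
  have -> : k^-1 `^ (p - 1) = (k `^ (p - 1))^-1.
    by rewrite -powRN -powR_inv1 ?(ltW k0)// -powRrM mulN1r.
  have aux (e1 e2 X Y o a : R) : Y != 0 -> a != 0 ->
      (o * e1 / a - o * e2 / a) * X = Y * o / a * ((e1 - e2) * (X / Y)).
    by move=> Y0 a0; field; rewrite Y0 a0.
  by apply: aux => //; rewrite gt_eqF.
apply: ler_wpM2l.
  apply: divr_ge0; last exact: ltW A1'.
  by apply: mulr_ge0; [exact: powR_ge0|exact: ltW oa0].
apply: (le_trans osc); apply: ler_wpM2r => //; exact: powR_ge0.
Qed.

Let M_le1 t : M t <= 1.
Proof.
have A1' : 0 < 1 - A by rewrite subr_gt0.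
rewrite /M ler_pdivrMr// mul1r.
apply: (le_trans (omega_energy_le p2 Xu r0 (ltW (rt_gt0 t)))).
by rewrite -/B; have := AB; lra.
Qed.

Lemma inner_integral :
  (\int[leb]_(r in `]0%R, r0[) (phi p (sigma * `|u r| `^ q) * r `^ theta)%:E <=
   (expR C1 * C2)%:E)%E.
Proof.
have A1' : 0 < 1 - A by rewrite subr_gt0.
have sub : `]0, r0[%classic `<=` (`]0, +oo[%classic : set R).
  by move=> r /=; rewrite !in_itv/= andbT => /andP[].
have mu' : measurable_fun (`]0, r0[%classic : set R) u.
  exact: measurable_funS measu.
have mV : measurable_fun (`]0, r0[%classic : set R) V.
  by apply: measurable_funM => //; exact: measurable_funB.
have w0 : w 0 = 0 by rewrite /w rt0 /V subrr mulr0.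
have M0 : M 0 = 0 by rewrite /M rt0 energyxx mulr0 mul0r.
have VE r : 0 < r -> r < r0 -> V r = w (k * (ln r0 - ln r)).
  move=> rpos _; rewrite /w; congr V; rewrite /rt.
  have -> : - (k * (ln r0 - ln r) / k) = ln r - ln r0 by field; rewrite gt_eqF.
  by rewrite -ln_div ?posrE// lnK ?posrE ?divr_gt0// mulrCA divff ?mulr1// gt_eqF.
have := moser_integral p2 w0 M0 (fun t _ => M_le1 t) w_energy k0 r00 mV VE.
rewrite -/q -/K => moser.
have thE : k - 1 = theta by rewrite /k addrK.
rewrite thE in moser.
have mE : measurable_fun (`]0, r0[%classic : set R)
    (fun r => expR (`|V r| `^ q) * r `^ theta).
  apply: measurable_funM; last exact: measurable_fun_powR.
  by apply: measurableT_comp => //; exact: measurable_fun_norm_powR.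
apply: (@le_trans _ _ (\int[leb]_(r in `]0%R, r0[)
    (expR C1 * (expR (`|V r| `^ q) * r `^ theta))%:E)%E).
  apply: EFin_le_integral => //.
  - apply: measurable_funM; last exact: measurable_fun_powR.
    by apply: measurable_funS (measurable_phi_comp p sigma measu).
  - exact: measurable_funM.
  - move=> r _; rewrite mulr_ge0 ?powR_ge0// phi_ge0//.
    by rewrite mulr_ge0 ?powR_ge0.
  - move=> r _; rewrite mulrA; apply: ler_wpM2r; first exact: powR_ge0.
    have su0 : 0 <= sigma * `|u r| `^ q by rewrite mulr_ge0 ?powR_ge0.
    apply: (le_trans (phi_le_expR p su0)); rewrite -expRD ler_expR.
    have h1 : `|u r| `^ q <= (`|u r - u r0| + `|u r0|) `^ q.
      apply: le_powR; [exact: ltW|exact: normr_ge0|].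
      by rewrite -{1}(subrK (u r0) (u r)) ler_normD.
    have h2 := powRD_split q1 A0 A1 (normr_ge0 (u r - u r0)) (normr_ge0 (u r0)).
    (* The cancellation on which the full norm rests: |u r0|^q = (|u r0|^p)^(q - 1) is of order A^(q
       - 1), so the cost A^(1 - q) of the split disappears and [C1] is independent of [u]. *)
    have h3 : A `^ (1 - q) * `|u r0| `^ q <= (2 / ot) `^ (q - 1).
      have -> : `|u r0| `^ q = (`|u r0| `^ p) `^ (q - 1).
        by rewrite -powRrM; congr powR; rewrite /q; field.
      have h : (`|u r0| `^ p) `^ (q - 1) <= (2 * A / ot) `^ (q - 1).
        apply: le_powR; [|exact: powR_ge0|exact: ur0].
        by rewrite subr_ge0; exact: ltW q1.
      apply: (le_trans (ler_wpM2l (powR_ge0 _ _) h)).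
      have -> : 2 * A / ot = A * (2 / ot) by ring.
      have t0 : 0 <= 2 / ot by apply: divr_ge0; [exact: ler0n|exact: ltW ot0].
      rewrite (powRM (q - 1) (ltW A0) t0) mulrA -powRD.
        by rewrite addrA subrK subrr powRr0 mul1r.
      by rewrite (gt_eqF A0) implybT.
    have VqE : `|V r| `^ q = mu * ((1 - A) `^ (1 - q) * `|u r - u r0| `^ q).
      rewrite /V normrM powRM// (ger0_norm (powR_ge0 _ _)) powRVK ?gt_eqF//.
        by rewrite mulrA.
      by rewrite mulr_ge0 ?powR_ge0// ltW.
    apply: (@le_trans _ _ (mu * `|u r| `^ q)).
      by rewrite ler_wpM2r// powR_ge0.
    rewrite VqE /C1 -mulrDr ler_pM2l//.
    by apply: (le_trans h1); apply: (le_trans h2); rewrite addrC lerD2r.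
have e1 : 0 <= expR C1 by exact: expR_ge0.
rewrite EFin_integralZl//; last by move=> r _; rewrite mulr_ge0 ?expR_ge0 ?powR_ge0.
rewrite EFinM; apply: lee_wpmul2l; first by rewrite lee_fin.
apply: (le_trans moser); rewrite lee_fin /C2; apply: ler_wpM2r.
  have K0 : 0 <= K by rewrite mulr_ge0 ?powR_ge0// ltW.
  apply: mulr_ge0; apply: divr_ge0; [by lra|exact: ltW k0|exact: ler0n|].
  by rewrite subr_ge0 -[leRHS]expR0 ler_expR oppr_le0 invr_ge0.
by apply: le_powR; exact: ltW.
Qed.

End inner.

(** [small_value] provides a point between r and 2 r where |u| is bounded by the first term of [U];
    on the way back to r the logarithm changes by at most ln 2 <= 1, so the oscillation is at most
    the second term. *)
Lemma outer_bound r : 1 <= r -> `|u r| <= U.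
Proof.
move=> r1; have rpos : 0 < r by exact: lt_le_trans r1.
have [r1' [rr1 r1r h]] := small_value p2 th0 Xu rpos A0.
have osc := oscillation p2 Xu rpos (ltW rr1).
have h1 : `|u r1'| `^ p <= 2 / ot.
  apply: (le_trans h); rewrite -/A -/ot ler_pdivrMr; last first.
    by rewrite mulr_gt0// powR_gt0.
  have rk : 1 <= r `^ (theta + 1).
    by rewrite -[leLHS](powRr0 r); apply: ler_powR => //; rewrite addr_ge0.
  have -> : 2 / ot * (ot * r `^ (theta + 1)) = 2 * r `^ (theta + 1).
    by field; rewrite gt_eqF.
  by have := A1; lra.
have h2 : `|u r1' - u r| `^ p <= 1 / oa.
  apply: (le_trans osc); apply: (@le_trans _ _ (energy p u r r1' * 1)).
    apply: ler_wpM2l; first exact: energy_ge0.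
    have lnp : ln r1' - ln r <= 1.
      have : ln r1' <= ln (2 * r).
        by rewrite ler_ln ?posrE ?mulr_gt0// ?(lt_trans rpos)// ltW.
      rewrite lnM ?posrE// => l2.
      have : ln 2 <= 1 :> R.
        rewrite -[leRHS]expRK ler_ln ?posrE ?expR_gt0//.
        by have := expR_ge1Dx (1 : R); lra.
      by lra.
    have p1 : 1 `^ (p - 1) = 1 :> R by rewrite powR1.
    rewrite -[leRHS]p1; apply: le_powR => //; first exact: ltW.
    by rewrite subr_ge0 ler_ln ?posrE; [exact: ltW rr1|exact: rpos|exact: lt_trans rr1].
  rewrite mulr1 (ler_pdivlMr _ _ oa0) mulrC.
  apply: (le_trans (omega_energy_le p2 Xu _ (ltW rpos))).
  by rewrite -/B; have := AB; have := A0; lra.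
have root (y z : R) : 0 <= y -> y `^ p <= z -> y <= z `^ p^-1.
  move=> y0 yz; rewrite -[leLHS](powRK pn0 y0); apply: le_powR => //.
    by rewrite invr_ge0 ltW.
  exact: powR_ge0.
rewrite -(subrK (u r1') (u r)) addrC; apply: (le_trans (ler_normD _ _)).
rewrite distrC; apply: lerD.
  exact: root (normr_ge0 _) h1.
exact: root (normr_ge0 _) h2.
Qed.

Lemma TM_integral_nonzero_le :
  (TM_integral p sigma theta u <= (ot * (expR C1 * C2) + C3)%:E)%E.
Proof.
(* [r0 > 1] lets [outer_bound] cover [[r0, +oo[], and [r0 < 2] bounds r0^k by the factor 2^k of
   [C2]. *)
have [r0 [r01 r02' ur0]] := small_value p2 th0 Xu ltr01 A0.
have r02 : r0 < 2 by rewrite -[ltRHS]mulr1.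
have {}ur0 : `|u r0| `^ p <= 2 * A / ot by move: ur0; rewrite powR1 mulr1.
have r00 : 0 < r0 by exact: lt_trans r01.
have U0 : 0 < U by apply: addr_gt0; apply: powR_gt0; apply: divr_gt0;
  [exact: ltr0n|exact: ot0|exact: ltr01|exact: oa0].
pose I r := phi p (sigma * `|u r| `^ q) * r `^ theta.
have mI : measurable_fun (`]0, +oo[%classic : set R) I.
  apply: measurable_funM; last exact: measurable_fun_powR.
  exact: measurable_phi_comp.
have I0 r : 0 <= I r.
  by rewrite mulr_ge0 ?powR_ge0// phi_ge0// mulr_ge0 ?powR_ge0.
have mL : measurable (`]0, r0[%classic : set (measurableTypeR R)).
  exact: measurable_itv.
have mR : measurable (`[r0, +oo[%classic : set (measurableTypeR R)).
  exact: measurable_itv.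
have DE : (`]0, +oo[%classic : set R) = `]0, r0[%classic `|` `[r0, +oo[%classic.
  apply/seteqP; split => r /=; rewrite !in_itv/= !andbT.
    by move=> rpos; rewrite rpos/=; case: (ltP r r0) => ?; [left|right].
  by move=> [/andP[]//|]; exact: lt_le_trans.
rewrite /TM_integral int_lambdaE -/ot DE ge0_integral_setU//=; last 3 first.
- by rewrite -DE; apply/measurable_EFinP.
- by move=> r _; rewrite lee_fin; exact: I0.
- apply/disj_setPS => r [] /=; rewrite !in_itv/= andbT => /andP[_ rr0] r0r.
  by have := lt_le_trans rr0 r0r; rewrite ltxx.
rewrite ge0_muleDr; last 2 first.
- by apply: EFin_integral_ge0 => r _; exact: I0.
- by apply: EFin_integral_ge0 => r _; exact: I0.
rewrite EFinD; apply: leeD.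
  rewrite [leRHS]EFinM; apply: lee_wpmul2l; first by rewrite lee_fin; exact: ltW ot0.
  exact: inner_integral.
have C30 : 0 <= C3.
  apply: divr_ge0; last exact: powR_ge0.
  by rewrite phi_ge0// mulr_ge0 ?powR_ge0// ltW.
have mN : measurable_fun (`]0, +oo[%classic : set R) (fun r => `|u r| `^ p * r `^ theta).
  apply: measurable_funM; last exact: measurable_fun_powR.
  exact: measurable_fun_norm_powR.
have subR : `[r0, +oo[%classic `<=` (`]0, +oo[%classic : set R).
  by rewrite DE; exact: subsetUr.
have fA : (ot%:E * \int[leb]_(r in `]0%R, +oo[) (`|u r| `^ p * r `^ theta)%:E = A%:E)%E.
  by rewrite /A fineK ?(lp_int_fin p2 th0 Xu)// -int_lambdaE.
apply: (@le_trans _ _ (C3%:E * A%:E)%E); last first.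
  by rewrite -EFinM lee_fin ler_piMr// ltW.
rewrite -fA muleCA; apply: lee_wpmul2l; first by rewrite lee_fin; exact: ltW ot0.
rewrite -EFin_integralZl//; last by move=> r _; rewrite mulr_ge0 ?powR_ge0.
apply: (@le_trans _ _ (\int[leb]_(r in `[r0, +oo[) (C3 * (`|u r| `^ p * r `^ theta))%:E)%E).
  apply: EFin_le_integral => //.
  - exact: measurable_funS mI.
  - by apply: measurable_funM => //; exact: measurable_funS mN.
  - by move=> r _; exact: I0.
  - move=> r /=; rewrite in_itv/= andbT => r0r.
    have r1 : 1 <= r by exact: le_trans (ltW r01) r0r.
    rewrite /I mulrA; apply: ler_wpM2r; first exact: powR_ge0.
    have uU := outer_bound r1.
    have uUq : `|u r| `^ q <= U `^ q by apply: le_powR => //; exact: ltW.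
    have su0 : 0 <= sigma * `|u r| `^ q by rewrite mulr_ge0 ?powR_ge0.
    have smu' : sigma * `|u r| `^ q <= mu * `|u r| `^ q.
      by apply: ler_wpM2r => //; exact: powR_ge0.
    apply: (le_trans (le_phi p su0 smu')).
    have mU0 : 0 < mu * U `^ q by rewrite mulr_gt0// powR_gt0.
    have m0 : 0 <= mu * `|u r| `^ q by rewrite mulr_ge0 ?powR_ge0// ltW.
    have p1 : 1 < p by have := p10; lra.
    have mle : mu * `|u r| `^ q <= mu * U `^ q by rewrite ler_pM2l.
    (* Comparison with the value at [U]: the ratio of the arguments is (|u r| / U)^q, whose power p
       - 1 is (|u r| / U)^p. This leaves [C3] times |u r|^p. *)
    apply: (le_trans (phi_le_powR p1 m0 mle mU0)).
    have -> : mu * `|u r| `^ q / (mu * U `^ q) = (`|u r| / U) `^ q.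
      rewrite powRM ?invr_ge0 ?(ltW U0)//.
      have -> : U^-1 `^ q = (U `^ q)^-1.
        by rewrite -powRN -powR_inv1 ?(ltW U0)// -powRrM mulN1r.
      have Un0 : U `^ q != 0 by rewrite gt_eqF// powR_gt0.
      by field; rewrite Un0 gt_eqF.
    rewrite -powRrM; have -> : q * (p - 1) = p by rewrite /q; field.
    rewrite powRM ?invr_ge0 ?(ltW U0)//.
    have -> : U^-1 `^ p = (U `^ p)^-1.
      by rewrite -powRN -powR_inv1 ?(ltW U0)// -powRrM mulN1r.
    by rewrite /C3 le_eqVlt; apply/orP; left; apply/eqP; ring.
apply: EFin_integral_subset => //.
- exact: measurable_funM.
- move=> r _; apply: mulr_ge0; first exact: C30.
  by apply: mulr_ge0; exact: powR_ge0.
Qed.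

End bound.

Lemma TM_integral_le : exists C : R, forall sigma u, 0 <= sigma -> sigma <= mu ->
  X1p p (p - 1) theta u -> (X1p_norm p (p - 1) theta u <= 1)%E ->
  (TM_integral p sigma theta u <= C%:E)%E.
Proof.
have p0 : 0 < p by have p2' := p2; lra.
have al0 : 0 <= p - 1 by have p2' := p2; lra.
(* The maximum with 0 covers functions that vanish on the half-line, whose integral is 0. *)
exists (Num.max (ot * (expR C1 * C2) + C3) 0) => sigma u s0 smu Xu.
rewrite X1p_norm_le1// => AB.
have [[x x0 ux]|no] := pselect (exists2 x, 0 < x & u x != 0).
  apply: (@le_trans _ _ (ot * (expR C1 * C2) + C3)%:E); last first.
    by rewrite lee_fin le_max lexx.
  apply: (TM_integral_nonzero_le s0 smu Xu x0 ux).
  exact: fineD_le (lp_int_fin p2 th0 Xu) (lp_int_derive_fin p2 Xu) AB.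
rewrite /TM_integral int_lambdaE integral0_eq ?mule0 ?lee_fin ?le_max ?lexx ?orbT//.
move=> r /=; rewrite in_itv/= andbT => r0.
have -> : u r = 0 by apply: contrapT => /eqP ur; apply: no; exists r.
have p1 : 1 < p by have p2' := p2; lra.
have qn0 : q != 0.
  by rewrite mulf_neq0 ?invr_neq0// gt_eqF// subr_gt0.
by rewrite normr0 powR0// mulr0 phi0// mul0r.
Qed.

End critical.

(** * Moser functions *)

Section moser_function.
Context {R : realType}.
Implicit Types (p theta a L r : R).
Notation leb := (@lebesgue_measure R).

(** Constant up to exp(- L), logarithmic from there to 1, and zero beyond. Between the two kinks it
    attains equality in [energy_ineq]. *)
Definition moser_fun a L r : R := a * clamp 0 L (- ln r).

Lemma moser_fun_ge0 a L r : 0 <= a -> 0 <= moser_fun a L r.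
Proof. by move=> a0; rewrite mulr_ge0// clamp_ge. Qed.

Lemma moser_fun_inner a L r : 0 <= L -> 0 < r -> r <= expR (- L) ->
  moser_fun a L r = a * L.
Proof.
move=> L0 r0 rL; congr (a * _); rewrite /clamp.
have Ll : L <= - ln r by rewrite lerNr -[leRHS](expRK (- L)) ler_ln ?posrE ?expR_gt0.
by rewrite (min_idPl Ll) (max_idPr L0).
Qed.

Lemma moser_fun_middle a L r : expR (- L) <= r -> r <= 1 ->
  moser_fun a L r = - (a * ln r).
Proof.
move=> Lr r1; have r0 : 0 < r by apply: lt_le_trans Lr; exact: expR_gt0.
rewrite /moser_fun clampE ?mulrN//; first by rewrite oppr_ge0 ln_le0.
by rewrite lerNl -[leLHS](expRK (- L)) ler_ln ?posrE ?expR_gt0.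
Qed.

Lemma moser_fun_outer a L r : 0 <= L -> 1 <= r -> moser_fun a L r = 0.
Proof.
move=> L0 r1; rewrite /moser_fun /clamp.
have l0 : - ln r <= 0 by rewrite oppr_le0 ln_ge0.
by rewrite (min_idPr (le_trans l0 L0)) (max_idPl l0) mulr0.
Qed.

Lemma measurable_moser_fun a L D : measurable_fun D (moser_fun a L).
Proof.
apply: measurable_funM => //; apply: measurable_maxr => //.
apply: measurable_minr => //; apply: measurableT_comp => //.
by apply: measurable_funTS; exact: measurable_ln.
Qed.

(** On [[x, y]] the logarithm has Lipschitz constant 1 / x, and clamping does not increase it. *)
Lemma moser_fun_ac a L : 0 < a -> 0 <= L ->
  locally_absolutely_continuous (moser_fun a L).
Proof.
move=> a0 L0 x y x0 xy e e0.
exists (e * x / a); first by rewrite divr_gt0 ?mulr_gt0.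
move=> n s t st _ sum_lt.
have lip i : `|moser_fun a L (t i) - moser_fun a L (s i)| <= a / x * (t i - s i).
  have [xs [sti ty]] := st i.
  have s0 : 0 < s i by exact: lt_le_trans xs.
  have t0 : 0 < t i by exact: lt_le_trans sti.
  have lnst : ln (s i) <= ln (t i) by rewrite ler_ln ?posrE.
  rewrite /moser_fun -mulrBr normrM gtr0_norm// -mulrA ler_pM2l// distrC.
  have cl : - ln (t i) <= - ln (s i) by rewrite lerN2.
  rewrite ger0_norm ?subr_ge0 ?le_clamp//.
  apply: (le_trans (clampB L0 cl)).
  have -> : - ln (s i) - - ln (t i) = ln (1 + (t i - s i) / s i).
    have -> : 1 + (t i - s i) / s i = t i / s i by field; rewrite gt_eqF.
    by rewrite ln_div ?posrE//; lra.
  apply: (@le_trans _ _ ((t i - s i) / s i)).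
    apply: le_ln1Dx; apply: (@lt_le_trans _ _ 0); first by lra.
    by rewrite divr_ge0 ?subr_ge0// ltW.
  by rewrite mulrC ler_wpM2r ?subr_ge0// lef_pV2 ?posrE.
apply: (le_lt_trans (ler_sum _ (fun i _ => lip i))).
rewrite -mulr_sumr mulrAC ltr_pdivrMr// mulrC -ltr_pdivlMr//.
Qed.

Lemma derive1_moser_inner a L r : 0 <= L -> 0 < r -> r < expR (- L) ->
  derive1 (moser_fun a L) r = 0.
Proof.
move=> L0 r0 rL; rewrite (@derive1_near_eq _ _ (cst (a * L))); first exact: derive1_cst.
near=> s; apply: moser_fun_inner => //; near: s; first exact: lt_nbhsr.
by apply: filterS (lt_nbhsl rL) => s /ltW.
Unshelve. all: by end_near. Qed.

Lemma derive1_moser_outer a L r : 0 <= L -> 1 < r ->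
  derive1 (moser_fun a L) r = 0.
Proof.
move=> L0 r1; rewrite (@derive1_near_eq _ _ (cst 0)); first exact: derive1_cst.
near=> s; apply: moser_fun_outer => //; near: s.
by apply: filterS (lt_nbhsr r1) => s /ltW.
Unshelve. all: by end_near. Qed.

Lemma derive1_moser_middle a L r : expR (- L) < r -> r < 1 ->
  derive1 (moser_fun a L) r = - a / r.
Proof.
move=> Lr r1; have r0 : 0 < r by apply: lt_trans Lr; exact: expR_gt0.
rewrite (@derive1_near_eq _ _ (fun s => - (a * ln s))).
  have := is_derive1_ln r0 => dln.
  rewrite derive1E; have [_ ->] : is_derive r 1 (fun s => - (a * ln s)) (- (a * r^-1)).
    by apply: is_deriveN; apply: is_deriveZ.
  by rewrite mulNr.
near=> s; apply: moser_fun_middle; near: s.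
  by apply: filterS (lt_nbhsr Lr) => s /ltW.
by apply: filterS (lt_nbhsl r1) => s /ltW.
Unshelve. all: by end_near. Qed.

Definition moser_slope a L r : R :=
  (- a * r `^ (-1)) * \1_(`]expR (- L), 1%R[%classic : set R) r.

Lemma derive1_moser a L r : 0 <= L -> 0 < r -> r != expR (- L) -> r != 1 ->
  derive1 (moser_fun a L) r = moser_slope a L r.
Proof.
move=> L0 r0 rL r1; rewrite /moser_slope indicE.
have [rl|lr|e] := ltgtP r (expR (- L)); last by rewrite e eqxx in rL.
  rewrite derive1_moser_inner// memNset ?mulr0//=.
  by rewrite in_itv/= ltNge (ltW rl).
have [r_1|r_1|e] := ltgtP r 1; last by rewrite e eqxx in r1.
  rewrite derive1_moser_middle// mem_set/=; last by rewrite in_itv/= lr.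
  by rewrite mulr1 powR_inv1// ltW.
rewrite derive1_moser_outer// memNset ?mulr0//=.
by rewrite in_itv/= [r < 1]ltNge (ltW r_1) andbF.
Qed.

Lemma measurable_moser_slope a L D : measurable_fun D (moser_slope a L).
Proof.
apply: measurable_funM; last exact: measurable_indic.
by apply: measurable_funM => //; exact: measurable_fun_powR.
Qed.

(* The derivative is modified at the two kinks, where [derive1] is unspecified. *)
Lemma measurable_derive1_moser a L : 0 <= L ->
  measurable_fun (`]0, +oo[%classic : set R) (derive1 (moser_fun a L)).
Proof.
move=> L0; set d := derive1 _; set e := expR (- L).
apply: (eq_measurable_fun (fun r => if r == e then d e else
  if r == 1 then d 1 else moser_slope a L r)).
  move=> r; rewrite inE/= in_itv/= andbT => r0.
  have [->//|re] := eqVneq r e; have [->//|r1] := eqVneq r 1.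
  by rewrite /d derive1_moser.
apply: measurable_funTS; apply: measurable_fun_ifT => //.
  exact: measurable_fun_eqr.
apply: measurable_fun_ifT => //; first exact: measurable_fun_eqr.
exact: measurable_moser_slope.
Qed.

Lemma lp_int_derive_moser p a L : 2 <= p -> 0 < a -> 0 < L ->
  lp_int p (p - 1) (derive1 (moser_fun a L)) = (omega (p - 1) * (a `^ p * L))%:E.
Proof.
move=> p2 a0 L0; have p0 : 0 < p by lra.
have mD : measurable (`]0%R, +oo[%classic : set (measurableTypeR R)).
  exact: measurable_itv.
have eL1 : expR (- L) < 1 by rewrite -[ltRHS]expR0 ltr_expR oppr_lt0.
rewrite /lp_int int_lambdaE [RHS]EFinM; congr (_ * _)%E.
have mind : measurable_fun (`]0, +oo[%classic : set R)
    (fun x => \1_(`]expR (- L), 1%R[%classic : set R) x * x^-1).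
  apply: measurable_funM; first exact: measurable_indic.
  apply: (eq_measurable_fun (fun x => x `^ (-1))).
    by move=> x; rewrite inE/= in_itv/= andbT => x0; rewrite powR_inv1// ltW.
  exact: measurable_fun_powR.
transitivity (\int[leb]_(x in `]0%R, +oo[)
    (a `^ p * (\1_(`]expR (- L), 1%R[%classic : set R) x * x^-1))%:E)%E; last first.
  rewrite EFin_integralZl ?powR_ge0//; last first.
    by move=> x /=; rewrite in_itv/= andbT => x0; rewrite mulr_ge0// invr_ge0 ltW.
  by rewrite integral_inv_indic ?expR_gt0// ln1 expRK sub0r opprK EFinM.
apply: ae_eq_integral => //.
- apply/measurable_EFinP; apply: measurable_funM; last exact: measurable_fun_powR.
  by apply: measurable_fun_norm_powR; apply: measurable_derive1_moser; exact: ltW.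
- by apply/measurable_EFinP; exact: measurable_funM.
exists [set expR (- L); 1]; split.
- by apply: measurableU; exact: measurable_set1.
- by apply: countable_lebesgue_measure0; apply: finite_set_countable; exact: finite_set2.
move=> r /=; apply: contra_notP => /not_orP[rL r1]; rewrite in_itv/= andbT => r0.
congr EFin; rewrite derive1_moser//; [|exact: ltW|exact/eqP|exact/eqP].
rewrite /moser_slope indicE; case: (r \in _); last first.
  by rewrite !mulr0 normr0 powR0 ?mul0r ?mulr0 ?gt_eqF.
rewrite mulr1 mul1r normrM normrN (gtr0_norm a0) powR_inv1 ?(ltW r0)//.
rewrite (gtr0_norm (_ : 0 < r^-1)) ?invr_gt0// powRM ?invr_ge0 ?(ltW a0) ?(ltW r0)//.
rewrite -mulrA; congr (_ * _).
rewrite -[r^-1 in LHS]powR_inv1 ?(ltW r0)// -powRrM -powRD ?(gt_eqF r0) ?implybT//.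
have -> : -1 * p + (p - 1) = -1 by lra.
by rewrite powR_inv1 ?(ltW r0).
Qed.

(** The point is that [C] does not depend on [L]: below 1 the function is at most - a ln r whatever
    the truncation. In [TMC_infty], where a^p is of order 1 / L, the norm thus becomes negligible
    for large [L]. *)
Lemma lp_int_moser p theta : 2 <= p -> 0 <= theta -> exists2 C : R, 0 < C &
  forall a L, 0 < a -> 0 < L ->
  (lp_int p theta (moser_fun a L) <= (C * a `^ p)%:E)%E.
Proof.
move=> p2 th0; have p0 : 0 < p by lra.
have [C C0 HC] := powR_le_expR (ltW p0).
have om := omega_gt0 th0.
exists (omega theta * (4 * C * pi)).
  by apply: mulr_gt0 => //; rewrite !mulr_gt0 ?pi_gt0.
move=> a L a0 L0; rewrite /lp_int int_lambdaE.
rewrite -mulrA [leRHS]EFinM; apply: lee_wpmul2l; first by rewrite lee_fin; exact: ltW om.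
have mU : measurable_fun (`]0, +oo[%classic : set R)
    (fun r => `|moser_fun a L r| `^ p * r `^ theta).
  apply: measurable_funM; last exact: measurable_fun_powR.
  by apply: measurable_fun_norm_powR; exact: measurable_moser_fun.
have k0 : 0 <= 4 * C * a `^ p by rewrite !mulr_ge0 ?powR_ge0// ltW.
apply: (@le_trans _ _ (\int[leb]_(r in `]0%R, +oo[) (4 * C * a `^ p * majorant r)%:E)%E).
  apply: EFin_le_integral => //.
  - by apply: measurable_funM => //; exact: measurable_majorant.
  - by move=> r _; rewrite mulr_ge0 ?powR_ge0.
  move=> r /=; rewrite in_itv/= andbT => r0.
  have [r1|r1] := leP 1 r.
    rewrite moser_fun_outer ?(ltW L0)// normr0 powR0 ?mul0r ?gt_eqF//.
    by rewrite mulr_ge0// majorant_ge0.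
  have l0 : 0 <= - ln r by rewrite oppr_ge0 ln_le0// ltW.
  have u_le : `|moser_fun a L r| <= a * - ln r.
    rewrite ger0_norm ?moser_fun_ge0 ?(ltW a0)// /moser_fun ler_pM2l//.
    by rewrite /clamp ge_max l0 ge_min lexx orbT.
  have h1 : `|moser_fun a L r| `^ p <= a `^ p * (C * (Num.sqrt r)^-1).
    apply: (@le_trans _ _ ((a * - ln r) `^ p)).
      by apply: le_powR => //; exact: ltW.
    rewrite powRM ?(ltW a0)// ler_pM2l ?powR_gt0//.
    apply: (le_trans (HC _ l0)); rewrite ler_pM2l//.
    rewrite -powR12_sqrt ?(ltW r0)// -powRN /powR gt_eqF// le_eqVlt.
    by apply/orP; left; apply/eqP; congr expR; lra.
  have sq : 0 < Num.sqrt r by rewrite sqrtr_gt0.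
  have h2 : (Num.sqrt r)^-1 <= 4 * majorant r.
    have r10 : 0 < 1 + r by lra.
    have -> : 4 * majorant r = 2 / (1 + r) * (Num.sqrt r)^-1.
      by rewrite /majorant; field; rewrite (gt_eqF sq) (gt_eqF r10).
    rewrite ler_peMl ?invr_ge0 ?(ltW sq)// ler_pdivlMr//.
    by lra.
  apply: (@le_trans _ _ (`|moser_fun a L r| `^ p * 1)).
    apply: ler_wpM2l; first exact: powR_ge0.
    have p1 : 1 `^ theta = 1 :> R by rewrite powR1.
    by rewrite -[leRHS]p1; apply: le_powR => //; exact: ltW.
  rewrite mulr1; apply: (le_trans h1).
  rewrite [leRHS](_ : _ = a `^ p * (C * (4 * majorant r))); last by ring.
  by rewrite ler_pM2l ?powR_gt0// ler_pM2l.
rewrite EFin_integralZl//; last 2 first.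
- exact: measurable_majorant.
- by move=> r /=; rewrite in_itv/= andbT; exact: majorant_ge0.
have -> : 4 * C * pi * a `^ p = 4 * C * a `^ p * pi by ring.
by rewrite [leRHS]EFinM; apply: lee_wpmul2l; [rewrite lee_fin|exact: integral_majorant].
Qed.

Lemma X1p_moser p theta a L : 2 <= p -> 0 <= theta -> 0 < a -> 0 < L ->
  X1p p (p - 1) theta (moser_fun a L).
Proof.
move=> p2 th0 a0 L0; have pn0 : p != 0 by rewrite gt_eqF//; lra.
have al0 : 0 <= p - 1 by lra.
split.
- by apply: moser_fun_ac => //; exact: ltW.
- apply/cvgrPdist_lt => e e0; near=> r.
  have r1 : 1 <= r by near: r; apply: nbhs_pinfty_ge; exact: num_real.
  by rewrite moser_fun_outer ?(ltW L0)// subr0 normr0.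
- apply/(LqP _ pn0 th0); split; first exact: measurable_moser_fun.
  have [C C0 HC] := lp_int_moser p2 th0.
  by apply: le_lt_trans (HC a L a0 L0) _; exact: ltry.
- apply/(LqP _ pn0 al0); split; first by apply: measurable_derive1_moser; exact: ltW.
  by rewrite lp_int_derive_moser// ltry.
Unshelve. all: by end_near. Qed.

(** Only the outer half of the plateau is kept, where r^theta is at least its value at exp(- L) / 2.
    The loss is a constant factor, harmless against exponential growth in [L]. *)
Lemma TM_integral_moser_ge p sigma theta a L : 0 <= sigma -> 0 <= theta ->
  0 < a -> 0 < L ->
  ((omega theta * (phi p (sigma * (a * L) `^ (p / (p - 1))) *
     (expR (- L) / 2) `^ (theta + 1)))%:E <= TM_integral p sigma theta (moser_fun a L))%E.
Proof.
move=> s0 th0 a0 L0; have om := omega_gt0 th0.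
rewrite /TM_integral int_lambdaE [leLHS]EFinM.
apply: lee_wpmul2l; first by rewrite lee_fin; exact: ltW om.
set P := phi p _; set b := expR (- L).
have b0 : 0 < b by exact: expR_gt0.
have b20 : 0 < b / 2 by rewrite divr_gt0.
have bb : b / 2 < b by lra.
have aL0 : 0 <= a * L by rewrite mulr_ge0 ?ltW.
have P0 : 0 <= P by rewrite phi_ge0// mulr_ge0 ?powR_ge0.
have mo : measurable (`]b / 2, b[%classic : set (measurableTypeR R)).
  exact: measurable_itv.
have sub : `]b / 2, b[%classic `<=` (`]0, +oo[%classic : set R).
  by move=> r /=; rewrite !in_itv/= andbT => /andP[/(lt_trans b20)].
have mI : measurable_fun (`]0, +oo[%classic : set R)
    (fun r => phi p (sigma * `|moser_fun a L r| `^ (p / (p - 1))) * r `^ theta).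
  apply: measurable_funM; last exact: measurable_fun_powR.
  by apply: measurable_phi_comp; exact: measurable_moser_fun.
apply: (@le_trans _ _ (\int[leb]_(r in `](b / 2)%R, b[) (cst (P * (b / 2) `^ theta) r)%:E)%E).
  rewrite [leRHS](integral_cst leb mo (P * (b / 2) `^ theta)%:E).
  have lb : leb `]b / 2, b[%classic = (b / 2)%:E.
    by rewrite lebesgue_measure_itv/= lte_fin bb -EFinB; congr EFin; lra.
  rewrite [X in (_ * X)%E]lb -EFinM lee_fin.
  rewrite (@powRD _ (b / 2) theta 1) ?(gt_eqF b20) ?implybT// powRr1 ?(ltW b20)//.
  by rewrite mulrA.
apply: (@le_trans _ _ (\int[leb]_(r in `](b / 2)%R, b[)
    (phi p (sigma * `|moser_fun a L r| `^ (p / (p - 1))) * r `^ theta)%:E)%E).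
  apply: EFin_le_integral => //.
  - exact: measurable_funS mI.
  - by move=> r _; rewrite mulr_ge0 ?powR_ge0.
  - move=> r /=; rewrite in_itv/= => /andP[br rb].
    have r0 : 0 < r by exact: lt_trans br.
    rewrite moser_fun_inner ?(ltW L0) ?(ltW rb)// (ger0_norm aL0) -/P.
    by apply: ler_wpM2l => //; apply: le_powR => //; exact: ltW.
apply: EFin_integral_subset => // r _.
by rewrite mulr_ge0 ?powR_ge0// phi_ge0// mulr_ge0 ?powR_ge0.
Qed.

End moser_function.

(** * Finiteness, sharpness, and the identity *)

Lemma powR_lt1 {R : realType} (x r : R) : 0 <= x -> x < 1 -> 0 < r -> x `^ r < 1.
Proof.
move=> x0 x1 r0; have e1 : 1 `^ r = 1 :> R by rewrite powR1.
by rewrite -[ltRHS]e1; apply: gt0_ltr_powR; rewrite ?nnegrE.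
Qed.

Section main.
Context {R : realType}.
Variables (p theta : R).
Hypotheses (p2 : 2 <= p) (th0 : 0 <= theta).
Implicit Types (sigma nu : R) (u v : R -> R).
Let q := p / (p - 1).
Let k := theta + 1.
Let mu := mu_crit (p - 1) theta.
Let oa := omega (p - 1) : R.
Let ot := omega theta : R.

Let p0 : 0 < p. Proof. by have p2' := p2; lra. Qed.
Let p1le : 1 <= p. Proof. by have p2' := p2; lra. Qed.
Let p10 : 0 < p - 1. Proof. by have p2' := p2; lra. Qed.
Let pn0 : p != 0. Proof. by rewrite gt_eqF. Qed.
Let pn1 : p - 1 != 0. Proof. by rewrite gt_eqF. Qed.
Let k0 : 0 < k. Proof. by have := th0; rewrite /k; lra. Qed.
Let kn0 : k != 0. Proof. by rewrite gt_eqF. Qed.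
Let oa0 : 0 < oa. Proof. by apply: omega_gt0; exact: ltW. Qed.
Let ot0 : 0 < ot. Proof. exact: omega_gt0. Qed.
Let mu0 : 0 < mu.
Proof. by apply: mulr_gt0; [exact: k0|apply: powR_gt0; exact: oa0]. Qed.

Lemma X1p_norm_moser_le1 (C : R) a L : 0 < a -> 0 < L ->
  (lp_int p theta (moser_fun a L) <= (C * a `^ p)%:E)%E ->
  C * a `^ p + oa * (a `^ p * L) <= 1 ->
  (X1p_norm p (p - 1) theta (moser_fun a L) <= 1)%E.
Proof.
move=> a0 L0 HC CL; rewrite X1p_norm_le1//; last exact: ltW.
rewrite lp_int_derive_moser//.
by apply: (le_trans (leeD2r _ HC)); rewrite -EFinD lee_fin.
Qed.

(** A competitor for both suprema, which shows that neither is the [-oo] of an empty set; [TMSC]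
    requires it to be nonzero. *)
Lemma X1p_unit : exists u, [/\ X1p p (p - 1) theta u,
  (X1p_norm p (p - 1) theta u <= 1)%E,
  (lp_int p (p - 1) (derive1 u) <= 1)%E & exists2 r, 0 < r & u r != 0].
Proof.
have [C C0 HC] := lp_int_moser p2 th0.
pose a := (1 / (C + oa)) `^ p^-1.
have Co : 0 < C + oa by exact: (addr_gt0 C0 oa0).
have c0 : 0 < 1 / (C + oa) by exact: divr_gt0.
have a0 : 0 < a by exact: powR_gt0.
have aE : a `^ p = 1 / (C + oa) by rewrite powRVK// ltW.
have sum1 : C * a `^ p + oa * (a `^ p * 1) = 1.
  by rewrite aE; field; rewrite gt_eqF.
exists (moser_fun a 1); split.
- exact: X1p_moser.
- by apply: X1p_norm_moser_le1 (HC _ _ a0 ltr01) _ => //; rewrite sum1.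
- rewrite lp_int_derive_moser// lee_fin -[leRHS]sum1 lerDr.
  by apply: mulr_ge0; [exact: ltW|exact: powR_ge0].
- exists (expR (- 1)); first exact: expR_gt0.
  by rewrite moser_fun_inner ?expR_gt0// mulr1 gt_eqF.
Qed.

Lemma TMC_ge0 sigma : 0 <= sigma -> (0 <= TMC p sigma (p - 1) theta)%E.
Proof.
move=> s0; have [u [Xu u1 _ _]] := X1p_unit.
apply: (@le_trans _ _ (TM_integral p sigma theta u)); first exact: TM_integral_ge0.
by apply: ereal_sup_ubound; exists u.
Qed.

Lemma TMSC_ge0 nu : 0 <= nu -> (0 <= TMSC p nu (p - 1) theta)%E.
Proof.
move=> n0; have [u [Xu _ u1 [r r0 ur]]] := X1p_unit.
apply: (@le_trans _ _ ((Lq_norm p theta u `^ p)^-1 * TM_integral p nu theta u)%E).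
  by apply: mule_ge0; [rewrite inve_ge0; exact: poweR_ge0|exact: TM_integral_ge0].
apply: ereal_sup_ubound; exists u => //; split => //; first by exists r.
by rewrite Lq_norm_le1//; exact: ltW.
Qed.

Lemma TMC_fin_num sigma : 0 <= sigma -> sigma <= mu ->
  TMC p sigma (p - 1) theta \is a fin_num.
Proof.
move=> s0 smu; rewrite ge0_fin_numE ?TMC_ge0//.
have [C HC] := TM_integral_le p2 th0.
apply: (@le_lt_trans _ _ C%:E); last exact: ltry.
by apply: ge_ereal_sup => _ [u [Xu u1] <-]; exact: HC.
Qed.

Lemma expR_growth (rho C T : R) : 1 < rho -> 0 <= C -> 0 <= T ->
  exists Y0, forall Y, Y0 <= Y ->
  T <= (expR (rho * Y) - C * expR (rho * Y / 2)) * expR (- Y).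
Proof.
(* The second threshold makes exp(rho Y / 2) at least 2 C, so at most half of the main term is
   subtracted; the first makes the remaining half of exp((rho - 1) Y) at least T. *)
move=> rho1 C0 T0; exists (Num.max (2 * T / (rho - 1)) (4 * C / rho)) => Y.
rewrite ge_max ler_pdivrMr; last by lra.
rewrite ler_pdivrMr; last by lra.
move=> /andP[YT YC].
pose E := expR (rho * Y / 2).
have E2 : expR (rho * Y) = E * E by rewrite /E -expRD; congr expR; field.
have EC : 2 * C <= E.
  by apply: le_trans (expR_ge1Dx _); lra.
have E0 : 0 < E by exact: expR_gt0.
apply: (@le_trans _ _ (expR (rho * Y) / 2 * expR (- Y))).
  have -> : expR (rho * Y) / 2 * expR (- Y) = expR ((rho - 1) * Y) / 2.
    by rewrite mulrAC -expRD; congr (expR _ / 2); ring.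
  have := expR_ge1Dx ((rho - 1) * Y); lra.
rewrite ler_pM2r ?expR_gt0// E2 -/E.
have : 0 <= E * (E - 2 * C).
  by apply: mulr_ge0; [exact: ltW|rewrite subr_ge0].
by lra.
Qed.

Lemma TMC_infty sigma : mu < sigma -> TMC p sigma (p - 1) theta = +oo%E.
Proof.
move=> mus; have s0 : 0 < sigma by exact: lt_trans mus.
apply/eqyP => T T0.
have [C C0 HC] := lp_int_moser p2 th0.
have [D HD] := phi_ge_expR p.
(* The midpoint of mu / sigma and 1. Energy b = c^(p - 1) leaves 1 - b for the norm of the function,
   and the exponent is still supercritical: rho = sigma c / mu > 1, against the plateau of size
   exp(- k L). *)
pose c := (sigma + mu) / (2 * sigma).
have c0 : 0 < c by apply: divr_gt0; [exact: addr_gt0|exact: mulr_gt0].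
have c1 : c < 1 by rewrite /c ltr_pdivrMr ?mulr_gt0//; move: mus; lra.
pose b := c `^ (p - 1).
have b0 : 0 < b by exact: powR_gt0.
have b1 : b < 1.
  exact: powR_lt1 (ltW c0) c1 p10.
pose rho := (sigma + mu) / (2 * mu).
have rho1 : 1 < rho.
  rewrite /rho ltr_pdivlMr; last exact: mulr_gt0.
  by move: mus; generalize mu => m; lra.
have D0 : 0 <= Num.max D 0 by rewrite le_max lexx orbT.
have T' : 0 <= T / (ot * 2 `^ (- k)).
  by apply: divr_ge0; [exact: ltW|apply: mulr_ge0; [exact: ltW|exact: powR_ge0]].
have [Y0 HY] := expR_growth rho1 D0 T'.
(* The second entry fits the norm, at most C b / (oa L), into 1 - b; the third brings [k * L] above
   the threshold [Y0]. *)
pose L := Num.max 1 (Num.max (C * b / (oa * (1 - b))) (Y0 / k)).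
have L1 : 1 <= L by rewrite /L le_max lexx.
have LC : C * b / (oa * (1 - b)) <= L by rewrite /L !le_max lexx ?orbT.
have LY : Y0 / k <= L by rewrite /L !le_max lexx ?orbT.
have L0 : 0 < L by exact: lt_le_trans L1.
have oL0 : 0 < oa * L by exact: (mulr_gt0 oa0 L0).
pose a := (b / (oa * L)) `^ p^-1.
have boL : 0 < b / (oa * L) by exact: divr_gt0.
have a0 : 0 < a by exact: powR_gt0.
have aE : a `^ p = b / (oa * L) by rewrite powRVK// ltW.
have norm1 : (X1p_norm p (p - 1) theta (moser_fun a L) <= 1)%E.
  apply: X1p_norm_moser_le1 (HC _ _ a0 L0) _ => //.
  have b1' : 0 < 1 - b by rewrite subr_gt0.
  have -> : oa * (a `^ p * L) = b.
    by rewrite aE; field; rewrite (gt_eqF oa0) (gt_eqF L0).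
  rewrite aE mulrA -lerBrDr (ler_pdivrMr _ _ oL0).
  move: LC; rewrite (ler_pdivrMr _ _ (mulr_gt0 oa0 b1')).
  by have -> : L * (oa * (1 - b)) = (1 - b) * (oa * L) by ring.
apply: (@le_trans _ _ (TM_integral p sigma theta (moser_fun a L))); last first.
  apply: ereal_sup_ubound; exists (moser_fun a L) => //; split => //.
  exact: X1p_moser.
apply: le_trans (TM_integral_moser_ge p (ltW s0) th0 a0 L0).
rewrite lee_fin -/ot -/q -/k.
have XE : sigma * (a * L) `^ q = rho * (k * L).
  have -> : (a * L) `^ q = c * oa `^ (- (p - 1)^-1) * L.
    have -> : q = p * (p - 1)^-1 by [].
    rewrite powRrM powRM ?(ltW a0) ?(ltW L0)// aE.
    have -> : b / (oa * L) * L `^ p = (c * oa `^ (- (p - 1)^-1) * L) `^ (p - 1).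
      rewrite powRM ?(ltW L0)//; last by rewrite mulr_ge0 ?powR_ge0// ltW.
      rewrite powRM ?powR_ge0 ?(ltW c0)// -[(oa `^ _) `^ _]powRrM mulNr mulVf//.
      rewrite powR_inv1 ?(ltW oa0)// -/b -(mulr_powRB1 (ltW L0) p0).
      by field; rewrite (gt_eqF oa0) (gt_eqF L0).
    rewrite (powRK pn1)//; apply: mulr_ge0; last exact: ltW.
    by apply: mulr_ge0; [exact: ltW|exact: powR_ge0].
  have muE : mu = k * oa `^ (p - 1)^-1 by [].
  have on0 : oa `^ (p - 1)^-1 != 0 by rewrite gt_eqF// powR_gt0.
  rewrite powRN /rho /c muE; field.
  by rewrite (gt_eqF s0) kn0 on0.
rewrite XE.
have Ypos : 0 <= k * L by rewrite mulr_ge0 ?ltW.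
have YL : Y0 <= k * L by move: LY; rewrite ler_pdivrMr// mulrC.
have {HY} := HY _ YL.
have otP : 0 < ot * 2 `^ (- k) by apply: mulr_gt0; [exact: ot0|exact: powR_gt0].
rewrite (ler_pdivrMr _ _ otP).
move=> /le_trans; apply.
have -> : (expR (- L) / 2) `^ k = expR (- (k * L)) * 2 `^ (- k).
  rewrite powRM ?expR_ge0// -expRM mulNr [L * k]mulrC; congr (_ * _).
  by rewrite -powR_inv1// -powRrM mulN1r.
rewrite [leRHS](_ : _ = phi p (rho * (k * L)) * expR (- (k * L)) * (ot * 2 `^ (- k))).
  2: by ring.
apply: ler_wpM2r; first exact: ltW otP.
apply: ler_wpM2r; first exact: expR_ge0.
have Z0 : 0 <= rho * (k * L).
  by apply: mulr_ge0 => //; apply: ltW; exact: lt_trans rho1.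
apply: le_trans (HD _ Z0); rewrite lerD2l lerN2; apply: ler_wpM2r.
  exact: expR_ge0.
by rewrite le_max lexx.
Qed.

Section equality.
Variable sigma : R.
Hypotheses (s0 : 0 < sigma).

Let coef nu := (1 - (nu / sigma) `^ (p - 1)) / (nu / sigma) `^ (p - 1).

Let ratio_bounds nu : 0 < nu -> nu < sigma ->
  0 < (nu / sigma) `^ (p - 1) /\ (nu / sigma) `^ (p - 1) < 1.
Proof.
move=> n0 ns; have r0 : 0 < nu / sigma by exact: divr_gt0.
have r1 : nu / sigma < 1 by rewrite ltr_pdivrMr// mul1r.
split; first exact: powR_gt0.
exact: powR_lt1 (ltW r0) r1 p10.
Qed.

(** A competitor [u] of [TMSC] becomes one of [TMC] after rescaling. The amplitude [c] has sigma c^q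
    = nu and brings the energy down to at most t; the dilation [l] then brings the norm term to
    exactly 1 - t. *)
Lemma TMSC_le_TMC nu : 0 < nu -> nu < sigma ->
  ((coef nu)%:E * TMSC p nu (p - 1) theta <= TMC p sigma (p - 1) theta)%E.
Proof.
move=> n0 ns; have [t0 t1] := ratio_bounds n0 ns.
rewrite /coef; set t := (nu / sigma) `^ (p - 1) in t0 t1 *.
have c0 : 0 < (1 - t) / t by rewrite divr_gt0 ?subr_gt0.
rewrite -lee_pdivlMl//; apply: ge_ereal_sup => _ [u [Xu [r r0 ur] u1] <-].
rewrite lee_pdivlMl//.
have al0 : 0 <= p - 1 by exact: ltW.
have [_ _ /(LqP _ pn0 th0)[mu' _] /(LqP _ pn0 al0)[mdu _]] := Xu.
pose A := fine (lp_int p theta u).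
have A0 : 0 < A := lp_int_gt0 p2 th0 Xu r0 ur.
have AE : A%:E = lp_int p theta u := fineK (lp_int_fin p2 th0 Xu).
clearbody A; rewrite (Lq_norm_powR _ pn0 th0) -AE inver gt_eqF// muleA -EFinM.
pose c := t `^ p^-1; have cpos : 0 < c by exact: powR_gt0.
have cE : c `^ p = t by rewrite powRVK// ltW.
(* Solves t l^(- k) A = 1 - t. The factor l^(- k) that the integral acquires is then the coefficient
   divided by A, as in the quotient defining [TMSC]. *)
pose l := (A * t / (1 - t)) `^ k^-1.
have lpos : 0 < A * t / (1 - t) by rewrite divr_gt0 ?mulr_gt0 ?subr_gt0.
have l0 : 0 < l by exact: powR_gt0.
have lE : l `^ (- k) = (1 - t) / t / A.
  rewrite powRN powRVK ?(ltW lpos)//; field.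
  by rewrite (gt_eqF A0) (gt_eqF t0) subr_eq0 (gt_eqF t1).
have cqE : sigma * c `^ q = nu.
  rewrite /c -powRrM /t -powRrM.
  have -> : (p - 1) * (p^-1 * q) = 1 by rewrite /q; field; rewrite pn0 pn1.
  by rewrite powRr1 ?divr_ge0 ?ltW// mulrCA divff ?mulr1// gt_eqF.
have := TM_integral_scale p (ltW s0) th0 cpos l0 mu'.
rewrite -/k lE -/q cqE => <-.
apply: ereal_sup_ubound; exists (fun r => c * u (l * r)); last by [].
split; first exact: X1p_scale.
rewrite (X1p_norm_le1 _ p0 th0 al0) (lp_int_scale _ cpos l0 th0 mu').
rewrite (lp_int_derive_scale p1le cpos l0 mdu).
rewrite -/k cE lE -AE -EFinM.
have -> : t * ((1 - t) / t / A) * A = 1 - t by field; rewrite (gt_eqF A0) (gt_eqF t0).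
have B1 : (lp_int p (p - 1) (derive1 u) <= 1)%E by rewrite -Lq_norm_le1.
apply: (@le_trans _ _ ((1 - t)%:E + t%:E * 1)%E).
  by rewrite leeD2l// lee_wpmul2l// lee_fin ltW.
by rewrite mule1 -EFinD subrK.
Qed.

(** [nu] is read off from the energy d of [u]: normalizing it to 1 multiplies |u|^q by d^(-1 / (p -
    1)), and (nu / sigma)^(p - 1) = d. The norm term becomes A / d, which A + d <= 1 bounds by the
    coefficient (1 - d) / d. *)
Lemma TM_integral_le_TMSC u : X1p p (p - 1) theta u ->
  (X1p_norm p (p - 1) theta u <= 1)%E -> (exists2 r, 0 < r & u r != 0) ->
  exists nu, [/\ 0 < nu, nu < sigma &
    (TM_integral p sigma theta u <= (coef nu)%:E * TMSC p nu (p - 1) theta)%E].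
Proof.
move=> Xu u1 [r r0 ur]; have al0 : 0 <= p - 1 by exact: ltW.
have [_ _ /(LqP _ pn0 th0)[mu' _] /(LqP _ pn0 al0)[mdu _]] := Xu.
pose A := fine (lp_int p theta u).
pose d := fine (lp_int p (p - 1) (derive1 u)).
have AB : A + d <= 1.
  apply: fineD_le (lp_int_fin p2 th0 Xu) (lp_int_derive_fin p2 Xu) _.
  by rewrite -X1p_norm_le1.
have A0 : 0 < A := lp_int_gt0 p2 th0 Xu r0 ur.
have d0 : 0 < d := lp_int_derive_gt0 p2 Xu r0 ur.
have AE : A%:E = lp_int p theta u := fineK (lp_int_fin p2 th0 Xu).
have dE : d%:E = lp_int p (p - 1) (derive1 u) := fineK (lp_int_derive_fin p2 Xu).
clearbody A d.
have d1 : d < 1 by lra.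
pose nu := sigma * d `^ (p - 1)^-1.
have dp0 : 0 < d `^ (p - 1)^-1 by exact: powR_gt0.
have n0 : 0 < nu by exact: mulr_gt0.
have ns : nu < sigma.
  rewrite (gtr_pMr _ s0); apply: powR_lt1 (ltW d0) d1 _.
  by rewrite invr_gt0; exact: p10.
have dnu : (nu / sigma) `^ (p - 1) = d.
  have -> : nu / sigma = d `^ (p - 1)^-1 by rewrite /nu; field; rewrite gt_eqF.
  by rewrite powRVK// ltW.
exists nu; split => //; rewrite /coef dnu.
pose c := (d^-1) `^ p^-1; have di0 : 0 < d^-1 by rewrite invr_gt0.
have cpos : 0 < c by exact: powR_gt0.
have cE : c `^ p = d^-1 by rewrite powRVK// ltW.
have cqE : nu * c `^ q = sigma.
  have e : p^-1 * q = (p - 1)^-1 by rewrite /q; field; rewrite pn0 pn1.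
  have -> : c `^ q = d^-1 `^ (p - 1)^-1 by rewrite -e (powRrM _ p^-1 q).
  rewrite /nu -mulrA -(powRM _ (ltW d0) (ltW di0)) divff ?(gt_eqF d0)//.
  by rewrite powR1 mulr1.
clearbody c nu.
(* The quotient in [TMSC] is invariant under dilations, so none is made; the factor 1 only puts [v]
   in the form of the scaling lemmas. *)
pose v r := c * u (1 * r).
have Xv : X1p p (p - 1) theta v by exact: X1p_scale.
have Av : lp_int p theta v = (A / d)%:E.
  by rewrite /v (lp_int_scale _ cpos ltr01 th0 mu') cE powR1 mulr1 -AE -EFinM mulrC.
have Bv : lp_int p (p - 1) (derive1 v) = 1%E.
  rewrite /v (lp_int_derive_scale p1le cpos ltr01 mdu).
  by rewrite cE -dE -EFinM mulVf// gt_eqF.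
have TMv : TM_integral p nu theta v = TM_integral p sigma theta u.
  rewrite /v (TM_integral_scale p (ltW n0) th0 cpos ltr01 mu') powR1 mul1e.
  by congr (TM_integral p _ theta u).
have TM0 : (0 <= TM_integral p nu theta v)%E by exact: (TM_integral_ge0 p v (ltW n0) th0).
have Ad0 : 0 < A / d by exact: divr_gt0.
have Ad1 : A / d <= (1 - d) / d by rewrite ler_pM2r ?invr_gt0; [move: AB; lra|exact: d0].
rewrite -TMv.
have -> : TM_integral p nu theta v =
    ((A / d)%:E * ((Lq_norm p theta v `^ p)^-1 * TM_integral p nu theta v))%E.
  rewrite (Lq_norm_powR _ pn0 th0) Av inver (gt_eqF Ad0) muleA -EFinM.
  by rewrite (mulfV (lt0r_neq0 Ad0)); apply: (esym (mul1e _)).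
apply: lee_pmul.
- by rewrite lee_fin; exact: ltW Ad0.
- by apply: mule_ge0 TM0; rewrite inve_ge0; exact: poweR_ge0.
- by rewrite lee_fin.
apply: ereal_sup_ubound; exists v; last by [].
split; first exact: Xv.
  exists r; first exact: r0.
  by rewrite /v mul1r mulf_neq0 ?(lt0r_neq0 cpos).
by rewrite (Lq_norm_le1 _ p0 al0) Bv.
Qed.

Lemma TMC_eq : TMC p sigma (p - 1) theta =
  ereal_sup [set ((coef nu)%:E * TMSC p nu (p - 1) theta)%E
            | nu in [set nu : R | 0 < nu /\ nu < sigma] ].
Proof.
apply/eqP; rewrite eq_le; apply/andP; split; last first.
  by apply: ge_ereal_sup => _ [nu [n0 ns] <-]; exact: TMSC_le_TMC.
apply: ge_ereal_sup => _ [u [Xu u1] <-].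
have [nz|no] := pselect (exists2 r, 0 < r & u r != 0).
  have [nu [n0 ns h]] := TM_integral_le_TMSC Xu u1 nz.
  by apply: (le_trans h); apply: ereal_sup_ubound; exists nu.
have -> : TM_integral p sigma theta u = 0%E.
  rewrite /TM_integral int_lambdaE integral0_eq ?mule0//.
  move=> r /=; rewrite in_itv/= andbT => r0.
  have -> : u r = 0 by apply: contrapT => /eqP ur; apply: no; exists r.
  have p1 : 1 < p by have p2' := p2; lra.
  have qn0 : q != 0 by rewrite mulf_neq0 ?invr_neq0.
  by rewrite normr0 powR0// mulr0 phi0// mul0r.
(* The zero function is no competitor for [TMSC]; its integral is 0, and one nonnegative term of the
   supremum, here at sigma / 2, suffices. *)
have n0 : 0 < sigma / 2 by exact: divr_gt0.
have ns : sigma / 2 < sigma by have := s0; lra.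
have [t0 t1] := ratio_bounds n0 ns.
apply: (@le_trans _ _ ((coef (sigma / 2))%:E * TMSC p (sigma / 2) (p - 1) theta)%E).
  apply: mule_ge0; last by apply: TMSC_ge0; exact: ltW.
  by rewrite lee_fin divr_ge0// ?subr_ge0 ltW.
by apply: ereal_sup_ubound; exists (sigma / 2).
Qed.

End equality.
End main.

Theorem theorem1p2 (R : realType) (p alpha theta : R)
    (hp : 2 <= p) (halpha : alpha = p - 1) (htheta : 0 <= theta) :
  [/\ forall sigma : R, 0 <= sigma -> sigma <= mu_crit alpha theta ->
        TMC p sigma alpha theta \is a fin_num,
      forall sigma : R, mu_crit alpha theta < sigma ->
        TMC p sigma alpha theta = +oo%E &
      forall sigma : R, 0 < sigma -> sigma <= mu_crit alpha theta ->
        TMC p sigma alpha theta =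
        ereal_sup [set (((1 - (mu / sigma) `^ (p - 1))
                          / (mu / sigma) `^ (p - 1))%:E
                        * TMSC p mu alpha theta)%E
                  | mu in [set mu : R | 0 < mu /\ mu < sigma] ] ].
Proof.
rewrite halpha; split => sigma.
- exact: TMC_fin_num.
- exact: TMC_infty.
- by move=> s0 _; exact: TMC_eq.
Qed.
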